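(* Let $Q$ be a finite quiver with vertex set $Q_0$. For every $\mathbf{d}\in\mathbb{N}Q_0$ we have $$[N_{\mathbf d}]=(-1)^{\dim\mathbf{d}}\cdot\mathbb{L}^{\sum_i\binom{d_i}{2}}\cdot\sum_{\mathbf{d}^*}(-1)^s\cdot\mathbb{L}^{-\sum_{k<l}\langle\mathbf{d}^k,\mathbf{d}^l\rangle}\cdot\left[{\mathbf{d}\atop\mathbf{d}^1,\dots,\mathbf{d}^s}\right]_{\mathbb L}$$ in $\mathbb{M}$, where the sum ranges over all ordered decompositions $\mathbf{d}^*=(\mathbf{d}^1,\dots,\mathbf{d}^s)$, $\mathbf{d}=\mathbf{d}^1+\dots+\mathbf{d}^s$, of $\mathbf{d}$ into non-zero parts $\mathbf{d}^k\in\mathbb{N}Q_0$ (of arbitrary length $s\geq 0$).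
   Context: $\mathbb{N}$ includes $0$. Arrows of $Q$ are written $\alpha:i\to j$. The Euler form is $\langle\mathbf{d},\mathbf{e}\rangle=\sum_{i\in Q_0}d_ie_i-\sum_{\alpha:i\to j}d_ie_j$. For $\mathbf{d}\in\mathbb{N}Q_0$ fix complex vector spaces $V_i$ with $\dim V_i=d_i$; $R_{\mathbf d}=\bigoplus_{\alpha:i\to j}\mathrm{Hom}_{\mathbb C}(V_i,V_j)$, with the base change action of $G_{\mathbf d}=\prod_{i\in Q_0}\mathrm{GL}(V_i)$. The nullcone $N_{\mathbf d}\subset R_{\mathbf d}$ is the closed subvariety (with reduced structure) of those $V$ such that $0$ lies in the closure of $G_{\mathbf d}\cdot V$; equivalently, such that $V_{\alpha_1}\circ\cdots\circ V_{\alpha_s}$ is nilpotent for every oriented cycle $\alpha_1\cdots\alpha_s$ in $Q$; equivalently, such that $V$ has a filtration by subrepresentations whose subquotients are among the one-dimensional representations $S_i$ ($i\in Q_0$) concentrated at vertex $i$ with all arrows acting as zero. $K_0(\mathrm{Var}_{\mathbb C})$ is the Grothendieck ring of complex varieties, $[X]$ the class of $X$, $\mathbb{L}=[\mathbb{A}^1]$, and $\mathbb{M}=K_0(\mathrm{Var}_{\mathbb C})[\mathbb{L}^{-1},(1-\mathbb{L}^i)^{-1}: i\ge 1]$. Put $\dim\mathbf{d}=\sum_id_i$, $(q)_n=(1-q)\cdots(1-q^n)$ and $\left[{\mathbf{d}\atop\mathbf{d}^1,\dots,\mathbf{d}^s}\right]_q=\prod_{i\in Q_0}\frac{(q)_{d_i}}{\prod_{k=1}^s(q)_{d_i^k}}$.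 *)

(* Defs.v *)
From HB Require Import structures.
From mathcomp Require Import all_boot all_order all_algebra all_field.
From mathcomp Require Import boolp classical_sets functions cardinality fsbigop.
From mathcomp Require Import reals complex Rstruct.
From Stdlib Require Rdefinitions.

Set Implicit Arguments.
Unset Strict Implicit.
Unset Printing Implicit Defensive.

Import GRing.Theory.
Local Open Scope classical_set_scope.
Local Open Scope ring_scope.

(* Commutative rings presented by generators and relations.  They may be
   trivial as far as the construction knows, hence [comPzRingType]. *)
Inductive rexpr (G : Type) : Type :=
| RGen of G
| RZero
| ROne
| ROpp of rexpr G
| RAdd of rexpr G & rexpr G
| RMul of rexpr G & rexpr G.
Arguments RZero {G}.
Arguments ROne {G}.

HB.instance Definition _ (G : Type) := gen_eqMixin (rexpr G).
HB.instance Definition _ (G : Type) := gen_choiceMixin (rexpr G).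

Section Presentation.
Variables (G : Type) (rel : rexpr G -> rexpr G -> Prop).

(* The least congruence that contains [rel] and the axioms of commutative
   rings. *)
Inductive rcong : rexpr G -> rexpr G -> Prop :=
| rcong_rel x y : rel x y -> rcong x y
| rcong_refl x : rcong x x
| rcong_sym x y : rcong x y -> rcong y x
| rcong_trans y x z : rcong x y -> rcong y z -> rcong x z
| rcong_opp x y : rcong x y -> rcong (ROpp x) (ROpp y)
| rcong_add x x' y y' :
    rcong x x' -> rcong y y' -> rcong (RAdd x y) (RAdd x' y')
| rcong_mul x x' y y' :
    rcong x x' -> rcong y y' -> rcong (RMul x y) (RMul x' y')
| rcong_addA x y z : rcong (RAdd x (RAdd y z)) (RAdd (RAdd x y) z)
| rcong_addC x y : rcong (RAdd x y) (RAdd y x)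
| rcong_add0 x : rcong (RAdd RZero x) x
| rcong_addN x : rcong (RAdd (ROpp x) x) RZero
| rcong_mulA x y z : rcong (RMul x (RMul y z)) (RMul (RMul x y) z)
| rcong_mulC x y : rcong (RMul x y) (RMul y x)
| rcong_mul1 x : rcong (RMul ROne x) x
| rcong_mulDl x y z :
    rcong (RMul (RAdd x y) z) (RAdd (RMul x z) (RMul y z)).

Definition rcongb (x y : rexpr G) : bool := `[< rcong x y >].

Lemma rcongb_refl : reflexive rcongb.
Proof. by move=> x; apply/asboolP/rcong_refl. Qed.

Lemma rcongb_sym : symmetric rcongb.
Proof. by move=> x y; apply/asboolP/asboolP; exact: rcong_sym. Qed.

Lemma rcongb_trans : transitive rcongb.
Proof.
by move=> y x z /asboolP xy /asboolP yz; apply/asboolP/(rcong_trans xy yz).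
Qed.

Canonical rcong_equiv := EquivRel rcongb rcongb_refl rcongb_sym rcongb_trans.

Definition presented : Type := {eq_quot rcong_equiv}%qT.
HB.instance Definition _ := Choice.on presented.

Definition presented_pi (e : rexpr G) : presented := (\pi_{eq_quot rcong_equiv} e)%qT.

Lemma presented_piP (x y : rexpr G) :
  presented_pi x = presented_pi y <-> rcong x y.
Proof.
rewrite /presented_pi; split; first by move=> /eqmodP /asboolP.
by move=> xy; apply/eqmodP/asboolP.
Qed.

Definition presented_repr (x : presented) : rexpr G := repr (x : {eq_quot rcong_equiv}%qT).

Lemma presented_reprK x : presented_pi (presented_repr x) = x.
Proof. exact: reprK. Qed.

Lemma presented_ind (P : presented -> Prop) :
  (forall e, P (presented_pi e)) -> forall x, P x.
Proof. by move=> Pe x; rewrite -(presented_reprK x). Qed.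

Lemma presented_piK e : rcong (presented_repr (presented_pi e)) e.
Proof. by apply/presented_piP; rewrite presented_reprK. Qed.

Definition presented_zero : presented := presented_pi RZero.
Definition presented_one : presented := presented_pi ROne.
Definition presented_opp (x : presented) : presented :=
  presented_pi (ROpp (presented_repr x)).
Definition presented_add (x y : presented) : presented :=
  presented_pi (RAdd (presented_repr x) (presented_repr y)).
Definition presented_mul (x y : presented) : presented :=
  presented_pi (RMul (presented_repr x) (presented_repr y)).

Let oppE e : presented_opp (presented_pi e) = presented_pi (ROpp e).
Proof. by apply/presented_piP/rcong_opp/presented_piK. Qed.

Let addE e f :
  presented_add (presented_pi e) (presented_pi f) = presented_pi (RAdd e f).
Proof. by apply/presented_piP/rcong_add; exact: presented_piK. Qed.

Let mulE e f :
  presented_mul (presented_pi e) (presented_pi f) = presented_pi (RMul e f).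
Proof. by apply/presented_piP/rcong_mul; exact: presented_piK. Qed.

Let addA : associative presented_add.
Proof.
elim/presented_ind=> x; elim/presented_ind=> y; elim/presented_ind=> z.
by rewrite !addE; apply/presented_piP/rcong_addA.
Qed.

Let addC : commutative presented_add.
Proof.
elim/presented_ind=> x; elim/presented_ind=> y.
by rewrite !addE; apply/presented_piP/rcong_addC.
Qed.

Let add0 : left_id presented_zero presented_add.
Proof.
by elim/presented_ind=> x; rewrite addE; apply/presented_piP/rcong_add0.
Qed.

Let addN : left_inverse presented_zero presented_opp presented_add.
Proof.
by elim/presented_ind=> x; rewrite oppE addE; apply/presented_piP/rcong_addN.
Qed.

HB.instance Definition _ :=
  GRing.isZmodule.Build presented addA addC add0 addN.

Let mulA : associative presented_mul.
Proof.
elim/presented_ind=> x; elim/presented_ind=> y; elim/presented_ind=> z.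
by rewrite !mulE; apply/presented_piP/rcong_mulA.
Qed.

Let mulC : commutative presented_mul.
Proof.
elim/presented_ind=> x; elim/presented_ind=> y.
by rewrite !mulE; apply/presented_piP/rcong_mulC.
Qed.

Let mul1 : left_id presented_one presented_mul.
Proof.
by elim/presented_ind=> x; rewrite mulE; apply/presented_piP/rcong_mul1.
Qed.

Let mulDl : left_distributive presented_mul presented_add.
Proof.
elim/presented_ind=> x; elim/presented_ind=> y; elim/presented_ind=> z.
by rewrite !(addE, mulE); apply/presented_piP/rcong_mulDl.
Qed.

HB.instance Definition _ :=
  GRing.Zmodule_isComPzRing.Build presented mulA mulC mul1 mulDl.

Definition presented_gen (g : G) : presented := presented_pi (RGen g).

Lemma presented_pi0 : presented_pi RZero = 0. Proof. by []. Qed.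

Lemma presented_pi1 : presented_pi ROne = 1. Proof. by []. Qed.

Lemma presented_piN e : presented_pi (ROpp e) = - presented_pi e.
Proof. by rewrite -oppE. Qed.

Lemma presented_piD e f :
  presented_pi (RAdd e f) = presented_pi e + presented_pi f.
Proof. by rewrite -addE. Qed.

Lemma presented_piM e f :
  presented_pi (RMul e f) = presented_pi e * presented_pi f.
Proof. by rewrite -mulE. Qed.

Lemma presented_rel e f : rel e f -> presented_pi e = presented_pi f.
Proof. by move=> ef; apply/presented_piP/rcong_rel. Qed.

End Presentation.

(* A[S^-1], presented over A by one inverse for each element of S. *)
Section Localization.
Variables (A : comPzRingType) (S : set A).

Inductive loc_gen : Type := LFrac of A | LInv of {s : A | S s}.

Inductive loc_rel : rexpr loc_gen -> rexpr loc_gen -> Prop :=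
| loc_relD a b : loc_rel (RGen (LFrac (a + b)))
                         (RAdd (RGen (LFrac a)) (RGen (LFrac b)))
| loc_relM a b : loc_rel (RGen (LFrac (a * b)))
                         (RMul (RGen (LFrac a)) (RGen (LFrac b)))
| loc_rel1 : loc_rel (RGen (LFrac 1)) ROne
| loc_relV s : loc_rel (RMul (RGen (LFrac (sval s))) (RGen (LInv s))) ROne.

Definition localization : comPzRingType := presented loc_rel.

Definition loc_map (a : A) : localization := presented_gen loc_rel (LFrac a).

End Localization.

Notation C := (complex Rdefinitions.R).

(* 'I_n lives in the universe of MathComp's structures.  Points of varieties
   must be smaller than that, as varieties generate a ring below; hence this
   copy of 'I_n in Set, and complex numbers over the concrete R : Set. *)
Definition index (n : nat) : Set := {i : nat | (i < n)%N}.
Definition index_of_ord n (i : 'I_n) : index n := exist _ (i : nat) (ltn_ord i).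
Definition ord_of_index n (i : index n) : 'I_n := Ordinal (svalP i).

Section Varieties.

(* Complex varieties in the sense of Serre: spaces with a sheaf of
   complex-valued functions that are locally affine algebraic sets,
   quasi-compact and separated.  They are the same as reduced separated
   schemes of finite type over C, not necessarily irreducible.
   [regular U f] says that [f] is regular on [U]; it is only meaningful for
   open [U] and only depends on the values of [f] on [U]. *)
Record fspace := FSpace {
  point :> Type ;
  openv : set (set point) ;
  regular : set point -> set (point -> C)
}.

Definition closedv (X : fspace) (Z : set X) : Prop := openv (~` Z).

Definition morphism (X Y : fspace) (f : X -> Y) : Prop :=
  forall V : set Y, openv V ->
    openv (f @^-1` V) /\
    (forall g : Y -> C, regular V g -> regular (f @^-1` V) (g \o f)).

Definition isomorphic (X Y : fspace) : Prop :=
  exists (f : X -> Y) (g : Y -> X),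
    [/\ cancel f g, cancel g f, morphism f & morphism g].

(* The induced structure on a subset: regular functions are those that extend
   locally to the ambient space.  For closed [A] this is the reduced induced
   structure, for open [A] the restriction. *)
Definition subspace (X : fspace) (A : set X) : fspace := @FSpace
  {x : X | A x}
  [set U | exists2 W : set X, openv W & U = sval @^-1` W]
  (fun U f => forall x, U x -> exists (W : set X) (g : X -> C),
     [/\ openv W, W (sval x), regular W g &
         forall y, U y -> W (sval y) -> f y = g (sval y)]).

(* C is infinite, so polynomials may be identified with polynomial
   functions. *)
Inductive polyfun (n : nat) : ((index n -> C) -> C) -> Prop :=
| polyfun_const c : polyfun (fun=> c)
| polyfun_coord i : polyfun (fun x => x i)
| polyfun_add p q : polyfun p -> polyfun q -> polyfun (fun x => p x + q x)
| polyfun_mul p q : polyfun p -> polyfun q -> polyfun (fun x => p x * q x).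

Definition zero_locus (n : nat) (S : set ((index n -> C) -> C)) : set (index n -> C) :=
  [set x | forall p, S p -> p x = 0].

Definition zariski_closed (n : nat) (Z : set (index n -> C)) : Prop :=
  exists2 S, S `<=` @polyfun n & Z = zero_locus S.

Definition affine_space (n : nat) : fspace := @FSpace
  (index n -> C)
  [set U | zariski_closed (~` U)]
  (fun U f => forall x, U x -> exists V p q,
     [/\ zariski_closed (~` V), V x, polyfun p, polyfun q &
         forall y, U y -> V y -> q y != 0 /\ f y = p y / q y]).

Definition is_affine (X : fspace) : Prop :=
  exists (n : nat) (Z : set (affine_space n)),
    closedv Z /\ isomorphic X (subspace Z).

Definition topology_axioms (X : fspace) : Prop :=
  [/\ openv [set: X],
      forall U V : set X, openv U -> openv V -> openv (U `&` V) &
      forall F : set (set X), F `<=` @openv X -> openv (\bigcup_(U in F) U)].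

Definition sheaf_axioms (X : fspace) : Prop :=
  (forall (U V : set X) (f g : X -> C), openv V -> V `<=` U -> regular U f ->
     (forall x, V x -> f x = g x) -> regular V g) /\
  (forall (U : set X) (f : X -> C), openv U ->
     (forall x, U x -> exists V, [/\ openv V, V x, V `<=` U & regular V f]) ->
     regular U f).

(* Finiteness of the cover is quasi-compactness. *)
Definition locally_affine (X : fspace) : Prop :=
  exists (m : nat) (U : 'I_m -> set X),
    (forall i, openv (U i) /\ is_affine (subspace (U i))) /\
    (forall x, exists i, U i x).

(* Equalizers of morphisms from affine varieties are closed; equivalently,
   the diagonal is closed in the product. *)
Definition separated (X : fspace) : Prop :=
  forall (Y : fspace) (f g : Y -> X), is_affine Y -> morphism f -> morphism g ->
    closedv [set y | f y = g y].


Implicit Types X Y Z : fspace.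

Lemma isomorphic_refl X : isomorphic X X.
Proof. by exists id, id; split=> // V oV; split. Qed.

Lemma morphism_comp (X Y Z : fspace) (f : X -> Y) (g : Y -> Z) :
  morphism f -> morphism g -> morphism (g \o f).
Proof.
move=> mf mg V oV; have [oW rW] := mg _ oV; have [oU rU] := mf _ oW.
by split=> // h /rW /rU.
Qed.

Lemma isomorphic_sym X Y : isomorphic X Y -> isomorphic Y X.
Proof. by move=> [f [g [fg gf mf mg]]]; exists g, f. Qed.

Lemma isomorphic_trans X Y Z :
  isomorphic X Y -> isomorphic Y Z -> isomorphic X Z.
Proof.
move=> [f [g [fg gf mf mg]]] [f' [g' [fg' gf' mf' mg']]].
exists (f' \o f), (g \o g'); split; [exact: can_comp|exact: can_comp| |];
  exact: morphism_comp.
Qed.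

Lemma open_local (X : fspace) (U : set X) : topology_axioms X ->
  (forall x, U x -> exists V, [/\ openv V, V x & V `<=` U]) -> openv U.
Proof.
move=> [_ _ openU] locU.
have -> : U = \bigcup_(V in [set V | openv V /\ V `<=` U]) V.
  apply/seteqP; split=> [x /locU[V [oV Vx VU]]|x [V [_ VU] /VU//]].
  by exists V.
by apply: openU => V [].
Qed.

Lemma subspace_topology X (A : set X) :
  topology_axioms X -> topology_axioms (subspace A).
Proof.
move=> [oT oI oU]; split.
- by exists setT.
- move=> _ _ [U oV ->] [V oW ->]; exists (U `&` V) => //; exact: oI.
- move=> F FO.
  exists (\bigcup_(W in [set W | openv W /\ F (sval @^-1` W)]) W).
    by apply: oU => W [].
  apply/seteqP; split=> x /=.
    move=> [U FU Ux]; have [W oW UW] := FO _ FU; exists W => /=.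
      by split=> //; rewrite -UW.
    by rewrite UW in Ux.
  by move=> [W [oW FW] Wx]; exists (sval @^-1` W).
Qed.

Lemma subspace_sheaf X (A : set X) :
  topology_axioms X -> sheaf_axioms X -> sheaf_axioms (subspace A).
Proof.
move=> [oT oI oU] [res glue]; split.
- move=> U V f g oV VU rf fg x Vx; have [W [h [oW Wx rh fh]]] := rf x (VU _ Vx).
  by exists W, h; split=> // y Vy Wy; rewrite -fg// fh//; exact: VU.
- move=> U f oU' loc x Ux; have [V [oV Vx VU rf]] := loc _ Ux.
  case: oV => W oW VW; have [W' [h [oW' W'x rh fh]]] := rf _ Vx.
  exists (W `&` W'), h; split.
  + exact: oI.
  + by split=> //; rewrite VW in Vx.
  + by apply: (res W' _ h) => //; exact: oI.
  + by move=> y Uy [Wy W'y]; rewrite fh// VW.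
Qed.

Lemma subspace_setT X : topology_axioms X -> sheaf_axioms X ->
  isomorphic (subspace [set: X]) X.
Proof.
move=> [oT oI oU] [res glue].
exists sval, (fun x => exist _ x I); split.
- by move=> [x []].
- by [].
- move=> V oV; split; first by exists V.
  by move=> g rg x Vx; exists V, g; split.
- move=> _ [V oV ->]; split; first by [].
  move=> f rf; apply: glue => // x Vx.
  have [W [g [oW Wx rg fg]]] := rf (exist _ x I) Vx.
  exists (V `&` W); split=> //; first exact: oI.
  apply: (res W _ g) => //; first exact: oI.
  by move=> y [Vy Wy] /=; rewrite fg.
Qed.

Lemma affine_locally_affine X : topology_axioms X -> sheaf_axioms X ->
  is_affine X -> locally_affine X.
Proof.
move=> tX sX [n [Z [cZ XZ]]]; exists 1%N, (fun=> setT); split=> [i|x].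
  split; first by case: tX.
  exists n, Z; split=> //; apply: isomorphic_trans XZ.
  exact: subspace_setT.
by exists ord0.
Qed.

Lemma zariski_closed_eq0 n (p : (index n -> C) -> C) :
  polyfun p -> zariski_closed [set x | p x = 0].
Proof.
move=> pp; exists [set p]; first by move=> _ ->.
by apply/seteqP; split=> x /=; [move=> px0 _ ->|move=> /(_ p); exact].
Qed.

Lemma affine_space_open_neq0 n (p : (index n -> C) -> C) :
  polyfun p -> @openv (affine_space n) [set x | p x <> 0].
Proof.
move=> pp; rewrite /openv /= (_ : ~` _ = [set x | p x = 0]).
  exact: zariski_closed_eq0.
by apply/seteqP; split=> x /=; [move/contrapT|move=> ? []].
Qed.

Lemma zariski_closed_bigcap n (F : set (set (index n -> C))) :
  F `<=` @zariski_closed n -> zariski_closed (\bigcap_(Z in F) Z).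
Proof.
move=> Fc.
exists [set p | polyfun p /\ exists2 Z, F Z & forall x, Z x -> p x = 0].
  by move=> p [].
apply/seteqP; split=> x /=.
  by move=> Fx p [_ [Z FZ Zp]]; apply: Zp; exact: Fx.
move=> px0 Z FZ; have [S Spoly ZE] := Fc _ FZ.
rewrite ZE => p Sp; apply: px0; split; first exact: Spoly.
by exists Z => // y; rewrite ZE; exact.
Qed.

Lemma affine_space_topology n : topology_axioms (affine_space n).
Proof.
split.
- rewrite /openv /= setCT; exists [set fun=> 1].
    by move=> _ ->; exact: polyfun_const.
  apply/seteqP; split=> x //= /(_ _ erefl) /eqP.
  by rewrite oner_eq0.
- move=> U V [S Sp US] [T Tp VT]; rewrite /openv /= setCI.
  exists [set r | exists p q, [/\ S p, T q & r = fun x => p x * q x]].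
    by move=> _ [p [q [/Sp pp /Tp pq ->]]]; exact: polyfun_mul.
  rewrite US VT; apply/seteqP; split=> x /=.
    move=> [Sx|Tx] _ [p [q [pS qT ->]]]; first by rewrite (Sx _ pS) mul0r.
    by rewrite (Tx _ qT) mulr0.
  move=> STx; apply: contrapT => /not_orP[].
  move=> /existsNP[p /not_implyP[pS px]] /existsNP[q /not_implyP[qT qx]].
  have /eqP := STx _ (ex_intro _ p (ex_intro _ q (And3 pS qT erefl))).
  by rewrite mulf_eq0 => /orP[] /eqP.
- move=> F FO; rewrite /openv /= setC_bigcup.
  rewrite (_ : \bigcap_(_ in _) _ = \bigcap_(Z in [set ~` U | U in F]) Z).
    by apply: zariski_closed_bigcap => _ [U /FO oU <-].
  by rewrite bigcap_image.
Qed.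

Lemma affine_space_sheaf n : sheaf_axioms (affine_space n).
Proof.
have [oT oI oU] := affine_space_topology n.
split.
- move=> U V f g oV VU rf fg x Vx.
  have [W [p [q [oW Wx pp pq pqE]]]] := rf _ (VU _ Vx).
  exists W, p, q; split=> // y Vy Wy; rewrite -fg//; apply: pqE => //.
  exact: VU.
- move=> U f oU' loc x Ux; have [V [oV Vx VU rf]] := loc _ Ux.
  have [W [p [q [oW Wx pp pq pqE]]]] := rf _ Vx.
  exists (V `&` W), p, q; split=> //; first exact: (oI V W).
  by move=> y Uy [Vy Wy]; exact: pqE.
Qed.

Lemma affine_space_affine n : is_affine (affine_space n).
Proof.
exists n, setT; split.
  rewrite /closedv setCT /openv /= setC0.
  exists set0 => //; apply/seteqP; split=> x //= _ p [].
apply/isomorphic_sym/subspace_setT; first exact: affine_space_topology.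
exact: affine_space_sheaf.
Qed.

Lemma affine_space_separated n : separated (affine_space n).
Proof.
have [oT oI oU] := affine_space_topology n.
have polyB m (p q : (index m -> C) -> C) :
    polyfun p -> polyfun q -> polyfun (fun x => p x - q x).
  move=> pp pq; rewrite (_ : (fun x => _) = (fun x => p x + (fun y => (fun=> -1) y * q y) x)).
    by apply: polyfun_add => //; apply: polyfun_mul => //; exact: polyfun_const.
  by apply/funext => x; rewrite mulN1r.
move=> Y f g [m [Z [cZ [e [e' [ee' e'e me me']]]]]] mf mg.
have tZ : topology_axioms (subspace Z).
  exact/subspace_topology/affine_space_topology.
have [_ oIm _] := affine_space_topology m.
have coordr (h : Y -> affine_space n) : morphism h ->
    forall i, @regular (subspace Z) setT (fun s => h (e' s) i).
  move=> mh i; have [_ /(_ (fun x => x i))] := morphism_comp me' mh oT.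
  apply=> x _; exists setT, (fun x => x i), (fun=> 1); split=> //.
  - exact: polyfun_coord.
  - exact: polyfun_const.
  - by move=> y _ _; rewrite oner_eq0 divr1.
suff cl : @openv (subspace Z) [set s | f (e' s) <> g (e' s)].
  have [+ _] := me _ cl; rewrite /closedv.
  congr openv; apply/seteqP; split=> y /=; by rewrite ee'.
apply: open_local => // s /= fgs.
have [i fgi] : exists i, f (e' s) i <> g (e' s) i.
  by apply/existsNP => fg; apply: fgs; exact/funext.
have locfrac (h : Y -> affine_space n) : morphism h -> exists W p q,
    [/\ @openv (affine_space m) W, W (sval s), polyfun p, polyfun q &
        forall y : subspace Z, W (sval y) -> q (sval y) != 0 /\
          h (e' y) i = p (sval y) / q (sval y)].
  move=> /coordr /(_ i s I)[W [u [oW Ws ru hu]]].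
  have [V [p [q [oV Vs pp pq pqE]]]] := ru _ Ws.
  exists (W `&` V), p, q; split=> //; first exact: (oIm W V).
  by move=> y [Wy Vy]; rewrite hu//; exact: pqE.
have [Wf [p [q [oWf Wfs pp pq pqE]]]] := locfrac _ mf.
have [Wg [r [t [oWg Wgs pr pt rtE]]]] := locfrac _ mg.
pose D := fun x => p x * t x - r x * q x.
have Dpoly : polyfun D by apply: polyB; exact: polyfun_mul.
have DE (y : subspace Z) : Wf (sval y) -> Wg (sval y) ->
    (f (e' y) i = g (e' y) i <-> D (sval y) = 0).
  move=> /pqE[q0 ->] /rtE[t0 ->]; rewrite /D; split.
    by move=> /eqP; rewrite eqr_div// => /eqP ->; rewrite subrr.
  by move=> /eqP; rewrite subr_eq0 -eqr_div// => /eqP.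
exists (sval @^-1` (Wf `&` Wg `&` [set x | D x <> 0])); split=> /=.
- exists (Wf `&` Wg `&` [set x | D x <> 0]) => //.
  apply: (oIm (Wf `&` Wg)); first exact: (oIm Wf Wg).
  exact: affine_space_open_neq0.
- by split=> // /(DE s Wfs Wgs).
- move=> y /= [[Wfy Wgy] Dy] fgy; apply: Dy; apply/(DE y Wfy Wgy).
  by rewrite fgy.
Qed.

Lemma subspace_separated X (A : set X) : separated X -> separated (subspace A).
Proof.
move=> sepX Y f g aY mf mg.
have mval : morphism (sval : subspace A -> X).
  move=> V oV; split; first by exists V.
  by move=> h rh x Vx; exists V, h; split.
have := sepX Y _ _ aY (morphism_comp mf mval) (morphism_comp mg mval).
congr closedv; apply/seteqP; split=> y /=; last by move=> ->.
by case: (f y) (g y) => [a Aa] [b Ab] /= ab; exact: eq_exist.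
Qed.

Record variety := Variety {
  variety_space :> fspace ;
  variety_topology : topology_axioms variety_space ;
  variety_sheaf : sheaf_axioms variety_space ;
  variety_affine : locally_affine variety_space ;
  variety_separated : separated variety_space
}.

Definition affine_space_variety (n : nat) : variety :=
  let tA := affine_space_topology n in
  let sA := affine_space_sheaf n in
  Variety tA sA (affine_locally_affine tA sA (affine_space_affine n))
    (@affine_space_separated n).

Lemma closed_subspace_affine n (Z : set (affine_space n)) :
  closedv Z -> is_affine (subspace Z).
Proof. by move=> cZ; exists n, Z; split=> //; exact: isomorphic_refl. Qed.

Definition closed_subvariety n (Z : set (affine_space n)) (cZ : closedv Z) :
    variety :=
  let tZ := subspace_topology Z (affine_space_topology n) in
  let sZ := subspace_sheaf Z (affine_space_topology n) (affine_space_sheaf n) in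
  Variety tZ sZ (affine_locally_affine tZ sZ (closed_subspace_affine cZ))
    (@subspace_separated _ Z (@affine_space_separated n)).

Definition is_product (X Y P : variety) (p : P -> X) (q : P -> Y) : Prop :=
  [/\ morphism p, morphism q &
      forall (T : variety) (f : T -> X) (g : T -> Y), morphism f -> morphism g ->
        exists! h : T -> P, [/\ morphism h, p \o h = f & q \o h = g]].

(* Since products of varieties are varieties, the ring generated by the
   classes [X] subject to these relations is the free abelian group on
   isomorphism classes modulo the scissor relations, with product
   [X][Y] = [X x Y]. *)
Inductive K0_rel : rexpr variety -> rexpr variety -> Prop :=
| K0_iso (X Y : variety) : isomorphic X Y -> K0_rel (RGen X) (RGen Y)
| K0_scissor (X Z U : variety) (A : set X) :
    closedv A -> isomorphic Z (subspace A) -> isomorphic U (subspace (~` A)) ->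
    K0_rel (RGen X) (RAdd (RGen Z) (RGen U))
| K0_prod (X Y P : variety) (p : P -> X) (q : P -> Y) :
    is_product p q -> K0_rel (RGen P) (RMul (RGen X) (RGen Y))
| K0_point (X : variety) : isomorphic X (affine_space 0) -> K0_rel (RGen X) ROne.

Definition K0 : comPzRingType := presented K0_rel.
Definition K0_class (X : variety) : K0 := presented_gen K0_rel X.

End Varieties.

Definition lefschetz : K0 := K0_class (affine_space_variety 1).

Definition motivic_ring : comPzRingType :=
  localization [set s : K0 | s = lefschetz \/
                             exists2 i, (0 < i)%N & s = 1 - lefschetz ^+ i].

Definition motive (X : variety) : motivic_ring := loc_map _ (K0_class X).

(* The image of the Lefschetz class in the localized ring. *)
Definition mL : motivic_ring := motive (affine_space_variety 1).

(* The inverse of [x] if [x] is invertible, and [0] otherwise.  Library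
   inverses require [1 != 0], which is not available here. *)
Definition pzinv (A : comPzRingType) (x : A) : A :=
  xget 0 [set y | x * y = 1].

Definition pzexpz (A : comPzRingType) (x : A) (z : int) : A :=
  match z with
  | Posz n => x ^+ n
  | Negz n => pzinv x ^+ n.+1
  end.

Lemma pzinvP (A : comPzRingType) (x y : A) : x * y = 1 -> pzinv x = y.
Proof.
move=> xy; rewrite /pzinv; case: xgetP => [z _ /= xz|/(_ y)/(_ xy)//].
by rewrite -[LHS]mul1r -xy mulrAC xz mul1r.
Qed.

Lemma loc_mapV (A : comPzRingType) (S : set A) (s : A) :
  S s -> loc_map S s * pzinv (loc_map S s) = 1.
Proof.
move=> Ss.
have sV : loc_map S s * presented_gen (@loc_rel _ S) (LInv (exist _ s Ss)) = 1.
  rewrite /loc_map /presented_gen -presented_piM -presented_pi1.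
  exact/presented_rel/(@loc_relV _ S (exist _ s Ss)).
by rewrite (pzinvP sV).
Qed.

Definition qfact (A : comPzRingType) (q : A) (n : nat) : A :=
  \prod_(1 <= i < n.+1) (1 - q ^+ i).

Record quiver := Quiver {
  vertex : finType ;
  arrow : finType ;
  source : arrow -> vertex ;
  target : arrow -> vertex
}.

Notation dimvec Q := {ffun vertex Q -> nat}.

Section Quiver.
Variable Q : quiver.
Implicit Types d e : dimvec Q.

Definition total_dim d : nat := \sum_i d i.

Definition euler_form d e : int :=
  \sum_i (d i * e i)%N%:Z - \sum_(a : arrow Q) (d (source a) * e (target a))%N%:Z.

Definition decompositions d : set (seq (dimvec Q)) :=
  [set ds : seq (dimvec Q) | (forall e, e \in ds -> e != 0) /\ d = \sum_(e <- ds) e].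

Definition decomposition_euler (ds : seq (dimvec Q)) : int :=
  \sum_(l < size ds) \sum_(k < l) euler_form (nth 0 ds k) (nth 0 ds l).

Definition qmultinomial (A : comPzRingType) (q : A) d (ds : seq (dimvec Q)) : A :=
  \prod_i (qfact q (d i) * pzinv (\prod_(e <- ds) qfact q (e i))).

Let total_dim_sum (ds : seq (dimvec Q)) :
  total_dim (\sum_(e <- ds) e) = (\sum_(e <- ds) total_dim e)%N.
Proof.
rewrite /total_dim exchange_big; apply: eq_bigr => i _.
by rewrite sum_ffunE.
Qed.

(* A sum [\sum_(x \in A) F x] over an infinite set could be [0] by
   convention; sums over [decompositions d] are genuine finite sums. *)
Lemma decompositions_finite d : finite_set (decompositions d).
Proof.
pose T := {ffun vertex Q -> 'I_(total_dim d).+1}.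
pose conv (t : T) : dimvec Q := [ffun i => t i : nat].
pose F s := [set (map conv (tval t) : seq (dimvec Q)) | t in [set: s.-tuple T]].
apply: (@sub_finite_set _ _ (\bigcup_(s in `I_(total_dim d).+1) F s)); last first.
  apply: bigcup_finite => // s _; apply: finite_image; exact: finite_finset.
move=> ds [ds0 dE].
have dim_gt0 e : e \in ds -> (0 < total_dim e)%N.
  move=> /ds0; apply: contraNltn; rewrite leqn0 sum_nat_eq0 => /forallP e0.
  by apply/eqP/ffunP => i; rewrite ffunE; exact/eqP/e0.
have dimE : total_dim d = (\sum_(e <- ds) total_dim e)%N by rewrite {1}dE total_dim_sum.
have size_ds : (size ds <= total_dim d)%N.
  rewrite dimE -sum1_size big_seq [leqRHS]big_seq.
  by apply: leq_sum => e; exact: dim_gt0.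
have le_dim e i : e \in ds -> (e i < (total_dim d).+1)%N.
  move=> eds; rewrite ltnS dimE (big_rem e)//=.
  by apply: leq_trans (leq_addr _ _); rewrite /total_dim (bigD1 i)//= leq_addr.
exists (size ds) => //=.
pose t := [tuple of map (fun e : dimvec Q => [ffun i => inord (e i)] : T) (in_tuple ds)].
exists t => //=; rewrite -map_comp -[RHS]map_id; apply/eq_in_map => e eds /=.
by apply/ffunP => i; rewrite !ffunE inordK// le_dim.
Qed.

Section Nullcone.
Variable d : dimvec Q.

(* V_i = C^(d i), written as column vectors. *)
Definition rep : Type :=
  forall a : arrow Q, 'M[C]_(d (target a), d (source a)).

Definition rep_coord : finType :=
  {a : arrow Q & ('I_(d (target a)) * 'I_(d (source a)))%type}.

Definition rep_space : fspace := affine_space #|rep_coord|.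

Definition rep_of_point (x : rep_space) : rep := fun a => \matrix_(i, j)
  x (index_of_ord (enum_rank (Tagged (fun a => _) (i, j) : rep_coord))).

Definition point_of_rep (V : rep) : rep_space := fun i =>
  let c := enum_val (ord_of_index i) in V (tag c) (tagged c).1 (tagged c).2.

Definition base_change (g : forall i : vertex Q, 'M[C]_(d i)) (V : rep) : rep :=
  fun a => g (target a) *m V a *m invmx (g (source a)).

Definition orbit (x : rep_space) : set rep_space :=
  [set y | exists2 g : forall i, 'M[C]_(d i), (forall i, g i \in unitmx) &
     y = point_of_rep (base_change g (rep_of_point x))].

Definition nullcone : set rep_space :=
  [set x | smallest (@closedv rep_space) (orbit x) (point_of_rep (fun=> 0))].

End Nullcone.
End Quiver.
Arguments nullcone {Q} d.

Lemma smallest_closedP n (A : set (affine_space n)) (x : affine_space n) :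
  smallest (@closedv (affine_space n)) A x <->
  forall F, polyfun F -> (forall y, A y -> F y = 0) -> F x = 0.
Proof.
split=> [sx F Fp FA|Fx Z [/= cZ AZ]].
  apply: (sx [set y | F y = 0]); split=> //=.
  by rewrite /closedv /openv /= setCK; exact: zariski_closed_eq0.
move: cZ; rewrite /closedv /openv /= setCK => -[S Sp ZE].
rewrite ZE => p Sp'; apply: Fx; first exact: Sp.
by move=> y /AZ; rewrite ZE; apply.
Qed.

Section PolyMatrix.
Variable N : nat.
Local Notation A := (affine_space N).

Definition polymx m n (M : A -> 'M[C]_(m, n)) :=
  forall i j, polyfun (fun x => M x i j).

Lemma polyfun_sum (I : Type) (r : seq I) (F : I -> A -> C) :
  (forall i, polyfun (F i)) -> polyfun (fun x => \sum_(i <- r) F i x).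
Proof.
move=> Fp; elim: r => [|i r IH].
  rewrite (_ : (fun x => _) = fun=> 0); first exact: polyfun_const.
  by apply/funext => x; rewrite big_nil.
rewrite (_ : (fun x => _) = fun x => F i x + \sum_(i <- r) F i x).
  exact: polyfun_add.
by apply/funext => x; rewrite big_cons.
Qed.

Lemma polyfun_prod (I : Type) (r : seq I) (F : I -> A -> C) :
  (forall i, polyfun (F i)) -> polyfun (fun x => \prod_(i <- r) F i x).
Proof.
move=> Fp; elim: r => [|i r IH].
  rewrite (_ : (fun x => _) = fun=> 1); first exact: polyfun_const.
  by apply/funext => x; rewrite big_nil.
rewrite (_ : (fun x => _) = fun x => F i x * \prod_(i <- r) F i x).
  exact: polyfun_mul.
by apply/funext => x; rewrite big_cons.
Qed.

Lemma polymx_const m n (M : 'M[C]_(m, n)) : polymx (fun=> M).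
Proof. by move=> i j; exact: polyfun_const. Qed.

Lemma polymx_mul m n p (M : A -> 'M[C]_(m, n)) (M' : A -> 'M[C]_(n, p)) :
  polymx M -> polymx M' -> polymx (fun x => M x *m M' x).
Proof.
move=> Mp M'p i j.
rewrite (_ : (fun x => _) = fun x => \sum_k M x i k * M' x k j).
  by apply: polyfun_sum => k; exact: polyfun_mul.
by apply/funext => x; rewrite mxE.
Qed.

Lemma polymx_scale m n (c : C) (M : A -> 'M[C]_(m, n)) :
  polymx M -> polymx (fun x => c *: M x).
Proof.
move=> Mp i j; rewrite (_ : (fun x => _) = fun x => (fun=> c) x * M x i j).
  by apply: polyfun_mul => //; exact: polyfun_const.
by apply/funext => x; rewrite mxE.
Qed.

Lemma polymx_add m n (M M' : A -> 'M[C]_(m, n)) :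
  polymx M -> polymx M' -> polymx (fun x => M x + M' x).
Proof.
move=> Mp M'p i j; rewrite (_ : (fun x => _) = fun x => M x i j + M' x i j).
  exact: polyfun_add.
by apply/funext => x; rewrite mxE.
Qed.

Lemma polymx_sum m n (I : Type) (r : seq I) (F : I -> A -> 'M[C]_(m, n)) :
  (forall i, polymx (F i)) -> polymx (fun x => \sum_(i <- r) F i x).
Proof.
move=> Fp; elim: r => [|i r IH].
  rewrite (_ : (fun x => _) = fun=> 0); first exact: polymx_const.
  by apply/funext => x; rewrite big_nil.
rewrite (_ : (fun x => _) = fun x => F i x + \sum_(i <- r) F i x).
  exact: polymx_add.
by apply/funext => x; rewrite big_cons.
Qed.

Lemma polymx_det n (M : A -> 'M[C]_n) :
  polymx M -> polyfun (fun x => \det (M x)).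
Proof.
move=> Mp; rewrite /determinant; apply: polyfun_sum => s.
apply: (@polyfun_mul _ (fun=> _)); first exact: polyfun_const.
by apply: polyfun_prod => i; exact: Mp.
Qed.

(* A polynomial function restricted to a line is a polynomial. *)
Lemma polyfun_line (F : A -> C) (u v : A) : polyfun F ->
  exists r : {poly C}, forall t, F (fun i => u i + t * v i) = r.[t].
Proof.
elim=> [c|i|p q _ [r rE] _ [s sE]|p q _ [r rE] _ [s sE]].
- by exists c%:P => t; rewrite hornerC.
- by exists ((u i)%:P + v i *: 'X) => t; rewrite !hornerE mulrC.
- by exists (r + s) => t; rewrite hornerD rE sE.
- by exists (r * s) => t; rewrite hornerM rE sE.
Qed.

Lemma polyfun_line0 (F : A -> C) (u v : A) : polyfun F ->
  (forall t, t != 0 -> F (fun i => u i + t * v i) = 0) -> F u = 0.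
Proof.
move=> /(@polyfun_line _ u v)[r rE] F0.
suff r0 : r * 'X = 0.
  move: r0 => /eqP; rewrite mulf_eq0 polyX_eq0 orbF => /eqP r0.
  have := rE 0; rewrite r0 horner0 => <-; congr F.
  by apply/funext => i; rewrite mul0r addr0.
apply/eqP; apply: contraT => /closed_nonrootP[t].
rewrite rootE hornerMX; have [->|t0] := eqVneq t 0; first by rewrite mulr0 eqxx.
by rewrite -rE F0// mul0r eqxx.
Qed.

End PolyMatrix.

Lemma invmx_eq n (M M' : 'M[C]_n) : M *m M' = 1%:M -> invmx M = M'.
Proof.
move=> MM'; have [Mu _] := mulmx1_unit MM'.
by rewrite -[LHS]mulmx1 -MM' mulmxA mulVmx// mul1mx.
Qed.

Lemma common_kernel_proj (J : finType) (m : J -> nat) n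
    (M : forall j, 'M[C]_(m j, n)) :
  exists P : 'M[C]_n, (forall j, M j *m P = 0) /\
    forall p (X : 'M[C]_(n, p)), (forall j, M j *m X = 0) -> P *m X = X.
Proof.
pose K := (\bigcap_j kermx (M j)^T)%MS.
exists (pinvmx K *m K)^T; split.
  move=> j; apply: trmx_inj; rewrite trmx_mul trmxK trmx0 -mulmxA.
  suff -> : K *m (M j)^T = 0 by rewrite mulmx0.
  by apply/sub_kermxP; exact: bigcapmx_inf (submx_refl _).
move=> p X MX; apply: trmx_inj; rewrite trmx_mul trmxK mulmxA mulmxKpV//.
apply/sub_bigcapmxP => j _; apply/sub_kermxP.
by rewrite -trmx_mul MX trmx0.
Qed.

Section NullconeClosed.
Variables (Q : quiver) (d : dimvec Q).
Local Notation rep := (rep d).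
Local Notation rep_space := (rep_space d).
Implicit Types (V : rep) (x : rep_space) (a : arrow Q) (w : seq (arrow Q)).

Lemma point_of_repK V : rep_of_point (point_of_rep V) = V.
Proof.
apply: functional_extensionality_dep => a; apply/matrixP => i j.
rewrite mxE /point_of_rep.
rewrite (_ : ord_of_index _ = enum_rank (Tagged (fun a => _) (i, j) : rep_coord d));
  last exact/val_inj.
by rewrite enum_rankK.
Qed.

Lemma rep_of_pointK x : point_of_rep (rep_of_point x) = x.
Proof.
apply/funext => i; rewrite /point_of_rep mxE; congr x.
rewrite -surjective_pairing.
have -> : Tagged (fun a => _) (tagged (enum_val (ord_of_index i) : rep_coord d))
          = enum_val (ord_of_index i) by case: (enum_val _).
rewrite enum_valK; case: i => i /= li; congr exist; exact: bool_irrelevance.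
Qed.

Local Notation T := {i : vertex Q & 'I_(d i)}.
Local Notation n := #|{: T}|.

Let E i : 'M[C]_(n, d i) := \matrix_(u, j) (enum_val u == Tagged _ j :> T)%:R.

Let EE1 i : (E i)^T *m E i = 1%:M.
Proof.
apply/matrixP => j k; rewrite !mxE.
rewrite (bigD1 (enum_rank (Tagged (fun i => _) j : T)))//= !mxE enum_rankK eqxx.
rewrite mul1r eq_Tagged /= big1 ?addr0// => u uj.
rewrite !mxE; case: eqP => [Eu|]; last by rewrite mul0r.
by rewrite -Eu enum_valK eqxx in uj.
Qed.

Let EE0 i j : i != j -> (E i)^T *m E j = 0.
Proof.
move=> ij; apply/matrixP => k l; rewrite !mxE big1// => u _; rewrite !mxE.
case: eqP => [->|]; last by rewrite mul0r.
rewrite mul1r; case: eqP => // /(congr1 tag) /= /eqP.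
by rewrite (negbTE ij).
Qed.

Let sumE : \sum_i E i *m (E i)^T = 1%:M.
Proof.
apply/matrixP => u v; rewrite summxE !mxE.
under eq_bigr do rewrite mxE.
rewrite (sig_big_dep (op := +%R) predT (fun _ => predT)) /=.
rewrite (bigD1 (enum_val u))//= !mxE big1 ?addr0.
  by rewrite (_ : Tagged _ _ = enum_val u) ?eqxx ?mul1r; [|by case: (enum_val u)];
    rewrite (inj_eq enum_val_inj) eq_sym.
move=> [i j] /= ij; rewrite !mxE; case: eqP => [Eu|]; last by rewrite mul0r.
by rewrite Eu eqxx in ij.
Qed.

Let tot V a : 'M[C]_n := E (target a) *m V a *m (E (source a))^T.

Let totK V a : (E (target a))^T *m tot V a *m E (source a) = V a.
Proof. by rewrite /tot !mulmxA EE1 mul1mx -mulmxA EE1 mulmx1. Qed.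

Fixpoint path_mx V w : 'M[C]_n :=
  if w is a :: w' then tot V a *m path_mx V w' else 1%:M.

Let path_cat V w w' : path_mx V (w ++ w') = path_mx V w *m path_mx V w'.
Proof. by elim: w => [|a w IH] /=; rewrite ?mul1mx// IH mulmxA. Qed.

Let comb V w (c : nat -> C) : 'M[C]_n :=
  \sum_(l < size w) c l *: path_mx V (take l.+1 w).

Let inv V := forall w c, \det (1%:M - comb V w c) = 1.

Let path0 V : inv V -> forall w, size w = n -> path_mx V w = 0.
Proof.
move=> iV w wn; apply/row_matrixP => r; rewrite row0 rowE.
set u := delta_mx _ _; apply/eqP; apply: contraT => uw.
pose v l := u *m path_mx V (take l w).
have v0 l : v l != 0.
  apply: contraNneq uw; rewrite /v -{2}(cat_take_drop l w) path_cat mulmxA => ->.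
  by rewrite mul0mx.
pose B : 'M[C]_(n.+1, n) := \matrix_(l < n.+1) v l.
have : kermx B != 0.
  by rewrite -mxrank_eq0 mxrank_ker subn_eq0 -ltnNge ltnS rank_leq_col.
rewrite -nz_row_eq0; set cv := nz_row _ => cv0.
have cvB : cv *m B = 0 by apply/sub_kermxP; exact: nz_row_sub.
pose c l := cv 0 (inord l).
have cB : \sum_(0 <= l < n.+1) c l *: v l = 0.
  rewrite big_mkord -[RHS]cvB mulmx_sum_row; apply: eq_bigr => l _.
  by rewrite rowK /c inord_val.
have exc : exists l, (l < n.+1)%N && (c l != 0).
  move/rV0Pn: cv0 => [l cl]; exists l.
  by rewrite ltn_ord /c inord_val.
have [k /andP[kn ck] kmin] := ex_minnP exc.
have clt l : (l < k)%N -> c l = 0.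
  move=> lk; apply/eqP; apply: contraLR lk => cl; rewrite -leqNgt.
  have [ln|nl] := ltnP l n.+1; first by apply: kmin; rewrite ln.
  exact: leq_trans (ltnW kn) nl.
pose c' m := - (c k)^-1 * c (k + m.+1)%N.
suff vk : v k *m comb V (drop k w) c' = v k.
  have iu : 1%:M - comb V (drop k w) c' \in unitmx by rewrite unitmxE iV unitr1.
  have /eqP[] := v0 k; rewrite -(mulmxK iu (v k)) mulmxBr mulmx1 vk subrr.
  by rewrite mul0mx.
have vE m : (m < size (drop k w))%N ->
    v k *m path_mx V (take m.+1 (drop k w)) = v (k + m.+1)%N.
  by move=> _; rewrite /v -mulmxA -path_cat -takeD addnC.
move: cB; rewrite (big_cat_nat _ (n := k)) ?leq0n 1?ltnW//=.
rewrite big_nat big1 ?add0r; last first.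
  by move=> l /andP[_ lk]; rewrite clt// scale0r.
rewrite big_ltn// (_ : \sum_(k.+1 <= l < n.+1) c l *: v l =
    \sum_(m < size (drop k w)) c (k + m.+1)%N *: v (k + m.+1)%N); last first.
  rewrite size_drop wn -{1}[k.+1]add0n big_addn subSS big_mkord.
  by apply: eq_bigr => m _; rewrite addnS addnS addnC.
move=> /eqP; rewrite addrC addr_eq0 => /eqP cE.
rewrite /comb mulmx_sumr.
under eq_bigr => m _ do rewrite -scalemxAr vE// /c' -scalerA.
by rewrite -scaler_sumr cE scaleNr scalerN opprK scalerA mulVf// scale1r.
Qed.

Let G (g : forall i, 'M[C]_(d i)) : 'M[C]_n := \sum_i E i *m g i *m (E i)^T.

Let GE g i : G g *m E i = E i *m g i.
Proof.
rewrite /G mulmx_suml (bigD1 i)//= -mulmxA EE1 mulmx1 big1 ?addr0// => j ji.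
by rewrite -mulmxA EE0// mulmx0.
Qed.

Let EG g i : (E i)^T *m G g = g i *m (E i)^T.
Proof.
rewrite /G mulmx_sumr (bigD1 i)//= !mulmxA EE1 mul1mx big1 ?addr0// => j ji.
by rewrite !mulmxA EE0 1?eq_sym// !mul0mx.
Qed.

Let G_unit g : (forall i, g i \in unitmx) -> G g \in unitmx.
Proof.
move=> gu; suff /mulmx1_unit[] : G g *m G (fun i => invmx (g i)) = 1%:M by [].
rewrite {2}/G mulmx_sumr -[RHS]sumE; apply: eq_bigr => i _.
by rewrite !mulmxA GE -(mulmxA (E i)) mulmxV// mulmx1.
Qed.

Let tot_base_change g V a : (forall i, g i \in unitmx) ->
  tot (base_change g V) a *m G g = G g *m tot V a.
Proof.
move=> gu; rewrite /tot /base_change -!mulmxA EG !mulmxA GE.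
by rewrite -!mulmxA (mulmxA (invmx (g (source a))) (g (source a))) mulVmx// mul1mx.
Qed.

Let path_base_change g V w : (forall i, g i \in unitmx) ->
  path_mx (base_change g V) w *m G g = G g *m path_mx V w.
Proof.
move=> gu; elim: w => [|a w IH] /=; first by rewrite mulmx1 mul1mx.
by rewrite -mulmxA IH mulmxA tot_base_change// mulmxA.
Qed.

Let det_base_change g V w c : (forall i, g i \in unitmx) ->
  \det (1%:M - comb (base_change g V) w c) = \det (1%:M - comb V w c).
Proof.
move=> gu.
have Gn0 : \det (G g) != 0 by move: (G_unit gu); rewrite unitmxE unitfE.
apply: (mulIf Gn0); rewrite [RHS]mulrC -!det_mulmx; congr (\det _).
rewrite mulmxBl mulmxBr mul1mx mulmx1; congr (_ - _).
rewrite /comb mulmx_suml mulmx_sumr; apply: eq_bigr => l _.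
by rewrite -scalemxAl -scalemxAr path_base_change.
Qed.

Let polymx_comb w c : polymx (fun x => 1%:M - comb (rep_of_point x) w c).
Proof.
rewrite (_ : (fun x => _) = fun x => (fun=> 1%:M) x +
    (-1) *: \sum_(l < size w) c l *: path_mx (rep_of_point x) (take l.+1 w)).
  apply: polymx_add; first exact: polymx_const.
  apply: polymx_scale; apply: polymx_sum => l; apply: polymx_scale.
  elim: (take _ _) => [|a w' IH] /=; first exact: polymx_const.
  apply: polymx_mul => //; apply: polymx_mul; last exact: polymx_const.
  apply: polymx_mul; first exact: polymx_const.
  move=> i j; rewrite (_ : (fun x => _) = fun x => x
    (index_of_ord (enum_rank (Tagged (fun a => _) (i, j) : rep_coord d)))).
    exact: polyfun_coord.
  by apply/funext => x; rewrite mxE.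
by apply/funext => x; rewrite scaleN1r.
Qed.

Let orbit0 x : orbit x x.
Proof.
exists (fun=> 1%:M); first by move=> i; exact: unitmx1.
rewrite -[LHS]rep_of_pointK; congr point_of_rep.
apply: functional_extensionality_dep => a.
by rewrite /base_change mul1mx invmx1 mulmx1.
Qed.

Let nullcone_inv x : nullcone d x -> inv (rep_of_point x).
Proof.
move=> /smallest_closedP N0 w c.
pose k := \det (1%:M - comb (rep_of_point x) w c).
have := N0 (fun y => \det (1%:M - comb (rep_of_point y) w c) + (fun=> - k) y).
have Fp : polyfun (fun y : rep_space =>
    \det (1%:M - comb (rep_of_point y) w c) + (fun=> - k) y).
  apply: polyfun_add; last exact: polyfun_const.
  exact: (polymx_det (polymx_comb w c)).
move=> /(_ Fp) H; have /subr0_eq kE : \det (1%:M - comb (fun=> 0) w c) - k = 0.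
  rewrite -[X in comb X _ _]point_of_repK; apply: H => y [g gu ->].
  by rewrite point_of_repK det_base_change// subrr.
rewrite -/k -kE /comb big1 ?subr0 ?det1// => l _.
case: w {k kE H Fp N0} l => [[]//|a w] l /=.
by rewrite /tot mulmx0 !mul0mx scaler0.
Qed.

Let zero_paths m x :
  (forall w, size w = m.+1 -> path_mx (rep_of_point x) w = 0) -> nullcone d x.
Proof.
elim: m x => [|m IH] x Vw; apply/smallest_closedP => F Fp F0.
  have V0 a : rep_of_point x a = 0.
    rewrite -totK (_ : tot _ a = 0) ?mulmx0 ?mul0mx//.
    by rewrite -[LHS]mulmx1; exact: (Vw [:: a]).
  rewrite (_ : point_of_rep _ = x); first by apply: F0; exact: orbit0.
  rewrite -[RHS]rep_of_pointK; congr point_of_rep.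
  by apply: functional_extensionality_dep => a; rewrite V0.
set V := rep_of_point x in Vw *.
have projP i : exists P : 'M[C]_(d i),
    (forall a, V a *m ((E (source a))^T *m E i) *m P = 0) /\
    forall p (X : 'M[C]_(d i, p)),
      (forall a, V a *m ((E (source a))^T *m E i) *m X = 0) -> P *m X = X.
  exact: common_kernel_proj.
pose P i := projT1 (cid (projP i)).
have VP i a : V a *m ((E (source a))^T *m E i) *m P i = 0.
  by have [+ _] := projT2 (cid (projP i)); apply.
have PX i p (X : 'M[C]_(d i, p)) :
    (forall a, V a *m ((E (source a))^T *m E i) *m X = 0) -> P i *m X = X.
  by have [_ +] := projT2 (cid (projP i)); apply.
have VPs a : V a *m P (source a) = 0.
  by have := VP (source a) a; rewrite EE1 mulmx1.
have PP i : P i *m P i = P i by apply: PX => a; exact: VP.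
pose V' a := (1%:M - P (target a)) *m V a.
have path' a w : path_mx V' (a :: w) =
    E (target a) *m (1%:M - P (target a)) *m (E (target a))^T *m path_mx V (a :: w).
  elim: w a => [|b w IHw] a.
    by rewrite /= !mulmx1 /tot /V' !mulmxA -(mulmxA _ _^T (E _)) EE1 mulmx1.
  have -> : path_mx V' [:: a, b & w] = tot V' a *m path_mx V' (b :: w) by [].
  have -> : path_mx V [:: a, b & w] = tot V a *m path_mx V (b :: w) by [].
  rewrite IHw; set Y := path_mx V (b :: w).
  have EY : E (target b) *m (E (target b))^T *m Y = Y.
    rewrite /Y /= /tot !mulmxA -(mulmxA _ _^T (E _)) EE1 mulmx1.
    by rewrite -!mulmxA.
  have VbP : V a *m (E (source a))^T *m E (target b) *m (1%:M - P (target b))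
      = V a *m (E (source a))^T *m E (target b).
    rewrite mulmxBr mulmx1 -[X in X *m P _]mulmxA.
    by rewrite VP subr0.
  rewrite {1}/tot /V' !mulmxA.
  transitivity (E (target a) *m (1%:M - P (target a)) *m
     (V a *m (E (source a))^T *m E (target b) *m (1%:M - P (target b))) *m
       (E (target b))^T *m Y).
    by rewrite !mulmxA.
  rewrite VbP /tot !mulmxA -(mulmxA _ (E (target a))^T (E _)) EE1 mulmx1.
  transitivity (E (target a) *m (1%:M - P (target a)) *m V a *m (E (source a))^T
    *m (E (target b) *m (E (target b))^T *m Y)).
    by rewrite !mulmxA.
  by rewrite EY !mulmxA.
have /IH : forall w, size w = m.+1 -> path_mx (rep_of_point (point_of_rep V')) w = 0.
  move=> [//|b w] sw; rewrite point_of_repK path' -!mulmxA.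
  set X := path_mx V (b :: w).
  suff -> : (1%:M - P (target b)) *m ((E (target b))^T *m X) = 0 by rewrite mulmx0.
  rewrite mulmxBl mul1mx PX ?subrr// => a.
  have [->|ab] := eqVneq (target b) (source a).
    rewrite EE1 mulmx1 mulmxA.
    have := Vw (a :: b :: w) (congr1 succn sw).
    rewrite (_ : path_mx _ _ = tot V a *m X)// => tX.
    have := congr1 (mulmx (E (target a))^T) tX.
    by rewrite /tot !mulmxA EE1 mul1mx mulmx0.
  by rewrite EE0 1?eq_sym// mulmx0 mul0mx.
move=> /smallest_closedP; apply=> // _ [g gu ->]; rewrite point_of_repK.
pose W a := g (target a) *m (P (target a) *m V a) *m invmx (g (source a)).
apply: (@polyfun_line0 _ F _ (point_of_rep W)) => // t t0; apply: F0.
pose h i := 1%:M - P i + t *: P i.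
pose h' i := 1%:M - P i + t^-1 *: P i.
have hh' i : h i *m h' i = 1%:M.
  have QP : (1%:M - P i) *m P i = 0 by rewrite mulmxBl mul1mx PP subrr.
  have PQ : P i *m (1%:M - P i) = 0 by rewrite mulmxBr mulmx1 PP subrr.
  have QQ : (1%:M - P i) *m (1%:M - P i) = 1%:M - P i.
    by rewrite mulmxBr mulmx1 QP subr0.
  have QP1 : 1%:M - P i + P i = 1%:M by rewrite subrK.
  rewrite /h /h'; move: (1%:M - P i) QP PQ QQ QP1 => Qi QP PQ QQ QP1.
  rewrite mulmxDl !mulmxDr -!scalemxAl -!scalemxAr QQ QP PQ PP.
  by rewrite !scaler0 addr0 add0r scalerA mulfV// scale1r.
exists (fun i => g i *m h i).
  by move=> i; rewrite unitmx_mul gu; have [] := mulmx1_unit (hh' i).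
transitivity (point_of_rep (fun a => base_change g V' a + t *: W a)).
  by apply/funext => i; rewrite /point_of_rep !mxE.
congr point_of_rep; apply: functional_extensionality_dep => a.
rewrite /base_change -/V.
rewrite (_ : invmx (g _ *m h _) = h' (source a) *m invmx (g (source a))); last first.
  by apply: invmx_eq; rewrite mulmxA -(mulmxA (g _)) hh' mulmx1 mulmxV.
have Vh' : V a *m h' (source a) = V a.
  by rewrite /h' mulmxDr mulmxBr mulmx1 -scalemxAr VPs scaler0 subr0 addr0.
rewrite !mulmxA -(mulmxA _ (V a) (h' _)) Vh' /W /V' /h.
rewrite [in RHS]addrC; move: (1%:M - P _) => Pc.
by rewrite mulmxDr !mulmxDl -scalemxAr -!scalemxAl !mulmxA addrC.
Qed.

(* The nullcone is cut out by the equations det (1 - c) = 1, for [c] running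
   over the linear combinations of the nonempty prefixes of a word in the
   arrows, acting on the direct sum of the V_i. *)
Lemma nullcone_closed : closedv (nullcone d).
Proof.
rewrite /closedv /openv /= setCK.
exists [set F | exists w c,
    F = fun x : rep_space => \det (1%:M - comb (rep_of_point x) w c) + (fun=> -1) x].
  move=> _ [w [c ->]]; apply: polyfun_add; last exact: polyfun_const.
  exact: (polymx_det (polymx_comb w c)).
apply/seteqP; split=> x /=.
  by move=> /nullcone_inv iV _ [w [c ->]]; rewrite iV subrr.
move=> Fx; apply: (@zero_paths n) => w wn.
case: w wn => // a w [wn] /=; rewrite (@path0 _ _ w wn) ?mulmx0// => w' c.
exact/subr0_eq/(Fx _ (ex_intro _ w' (ex_intro _ c erefl))).
Qed.

End NullconeClosed.

Definition nullcone_variety (Q : quiver) (d : dimvec Q) : variety :=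
  closed_subvariety (@nullcone_closed Q d).

(* Main.v *)
(* Proof idea.  A nilpotent representation V of dimension d <> 0 has a nonzero
   socle K(V), the common kernel of its arrows.  The sum over e of the classes
   of Gr(e, K(V)), with signs and powers of L, vanishes unless K(V) = 0.  On the
   other hand the pairs of V and a subspace U of dimension e
   of K(V) fibre over Gr(e, d), with fibre an affine space times the nullcone
   of d - e.  This yields a recursion for [N_d], which peels off the last part
   of the decompositions.

   Grassmannians are replaced by injective maps f : C^e -> K(V), whose classes
   are products of factors L^s - L^k that are invertible where needed.  Both
   fibrations are trivialized over finitely many locally closed strata by
   explicit frames: bases completing f by coordinate vectors, and bases of K(V)
   read off an invertible matrix formed by rows of the arrows and coordinate
   vectors.  Everything takes place in matrices over a single set of indices
   labelled by the vertices, where nilpotency reads: there is no nonzero row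
   space W contained in the sum of the W V_a. *)
Require Import Defs.
From HB Require Import structures.
From mathcomp Require Import all_boot all_order all_algebra all_field.
From mathcomp Require Import boolp classical_sets functions cardinality fsbigop.
From mathcomp Require Import reals complex Rstruct.
From mathcomp Require Import fingroup perm ring zify.

Import GRing.Theory.
Local Open Scope classical_set_scope.
Local Open Scope ring_scope.

Set Implicit Arguments.
Unset Strict Implicit.
Unset Printing Implicit Defensive.

Local Notation index := Defs.index.

(** * Morphisms into affine varieties *)

Section Embedded.

Definition locfrac n (T : Type) (k : T -> index n -> C) (U : set T)
    (f : T -> C) (x : T) : Prop :=
  exists p q, [/\ polyfun p, polyfun q, q (k x) != 0 &
    forall y, U y -> q (k y) != 0 -> f y = p (k y) / q (k y)].

Definition embedded n (Y : fspace) (k : Y -> index n -> C) : Prop :=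
  (forall U : set Y, openv U <-> forall x, U x -> exists q,
     [/\ polyfun q, q (k x) != 0 & forall y, q (k y) != 0 -> U y]) /\
  (forall (U : set Y) f, openv U ->
     (regular U f <-> forall x, U x -> locfrac k U f x)).

Lemma affine_space_embedded n : @embedded n (affine_space n) id.
Proof.
have op (U : set (affine_space n)) : openv U -> forall x, U x -> exists q,
     [/\ polyfun q, q x != 0 & forall y, q y != 0 -> U y].
  move=> [S Sp US] x Ux.
  have : ~ (~` U) x by apply.
  rewrite US => /existsNP[p /not_implyP[pS px]]; exists p; split.
  - exact: Sp.
  - exact/eqP.
  - move=> y py; apply: contrapT => Uy.
    have : (~` U) y by [].
    by rewrite US => /(_ _ pS) /eqP; rewrite (negbTE py).
split=> [U|U f oU]; split.
- exact: op.
- move=> locU; exists [set q | polyfun q /\ forall y, q y != 0 -> U y].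
    by move=> q [].
  apply/seteqP; split=> x /=.
    by move=> Ux q [_ qU]; apply/eqP; apply: contrapT => /negP /qU.
  move=> qx Ux; have [q [pq qx0 qU]] := locU _ Ux.
  by move: qx0; rewrite qx ?eqxx.
- move=> rf x Ux; have [V [p [q [oV Vx pp pq pqE]]]] := rf _ Ux.
  have /op/(_ _ Vx)[r [pr rx rV]] : @openv (affine_space n) V by [].
  exists (fun y => p y * r y), (fun y => q y * r y); split.
  + exact: polyfun_mul.
  + exact: polyfun_mul.
  + by rewrite mulf_neq0//; have [] := pqE x Ux Vx.
  + move=> y Uy; rewrite mulf_eq0 negb_or => /andP[q0 r0].
    have [_ ->] := pqE y Uy (rV y r0).
    by rewrite -mulf_div divff// mulr1.
- move=> fr x Ux; have [p [q [pp pq qx qE]]] := fr x Ux.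
  exists [set y | q y <> 0], p, q; split=> //.
  + exact: affine_space_open_neq0.
  + exact/eqP.
  + by move=> y Uy /eqP q0; split=> //; exact: qE.
Qed.

Lemma subspace_embedded n (Y : fspace) (k : Y -> index n -> C) (A : set Y) :
  embedded k -> embedded (k \o (sval : subspace A -> Y)).
Proof.
move=> [oY rY].
have openq q : polyfun q -> openv [set y : Y | q (k y) != 0].
  by move=> pq; apply/oY => x qx; exists q; split.
split=> [U|U f oU]; split.
- by move=> [W /oY oW ->] x /oW[q [pq qx qW]]; exists q; split=> // y /qW.
- move=> locU.
  exists [set y : Y | exists q, [/\ polyfun q, q (k y) != 0 &
      forall z : subspace A, q (k (sval z)) != 0 -> U z]].
    apply/oY => y [q [pq qy qU]]; exists q; split=> // z qz.
    by exists q; split.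
  apply/seteqP; split=> x /=.
    by move=> /locU[q [pq qx qU]]; exists q; split.
  by move=> [q [pq qx qU]]; exact: qU.
- move=> rf x Ux; have [W [g [oW Wx rg gE]]] := rf x Ux.
  have [p [q [pp pq qx pqE]]] := (rY _ _ oW).1 rg _ Wx.
  have [r [pr rx rW]] := (oY _).1 oW _ Wx.
  exists (fun y => p y * r y), (fun y => q y * r y); split.
  + exact: polyfun_mul.
  + exact: polyfun_mul.
  + by rewrite mulf_neq0.
  + move=> y Uy; rewrite mulf_eq0 negb_or => /andP[q0 r0].
    rewrite gE//; last exact: rW.
    rewrite pqE//; last exact: rW.
    by rewrite -mulf_div divff// mulr1.
- move=> fr x Ux; have [p [q [pp pq qx pqE]]] := fr x Ux.
  exists [set y : Y | q (k y) != 0], (fun y => p (k y) / q (k y)); split=> //.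
  + exact: openq.
  + apply/rY; first exact: openq.
    by move=> y /= qy; exists p, q; split.
Qed.

Lemma isomorphic_embedded n (X Y : fspace) (f : X -> Y) (g : Y -> X)
    (k : Y -> index n -> C) : cancel f g -> cancel g f ->
  morphism f -> morphism g -> embedded k -> embedded (k \o f).
Proof.
move=> fg gf mf mg [oY rY].
have fgU (U : set X) : f @^-1` (g @^-1` U) = U.
  by apply/seteqP; split=> x /=; rewrite fg.
have oXY (U : set X) : openv U <-> openv (g @^-1` U).
  by split=> [/mg[]//|/mf[]]; rewrite fgU.
have rXY (U : set X) h : openv U ->
    (regular U h <-> regular (g @^-1` U) (h \o g)).
  move=> oU; split=> [rh|]; first by have [_] := mg _ oU; apply.
  have [_ r] := mf _ ((oXY _).1 oU); move=> /r; rewrite fgU.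
  by rewrite (_ : _ \o f = h)//; apply/funext => x /=; rewrite fg.
split=> [U|U h oU].
- apply: iff_trans (oXY U) _; apply: iff_trans (oY _) _; split=> H x Ux.
    have [|q [pq qx qU]] := H (f x); first by rewrite /= fg.
    by exists q; split=> // y /qU; rewrite /= fg.
  have [q [pq qx qU]] := H (g x) Ux.
  by exists q; split=> //= [|y]; [move: qx; rewrite /= gf|have := qU (g y); rewrite /= gf].
- apply: iff_trans (rXY U h oU) _; apply: iff_trans (rY _ _ ((oXY _).1 oU)) _.
  split=> H x Ux.
    have [|p [q [pp pq qx qE]]] := H (f x); first by rewrite /= fg.
    exists p, q; split=> // y Uy qy.
    by have := qE (f y); rewrite /= fg => ->.
  have [p [q [pp pq qx qE]]] := H (g x) Ux; exists p, q; split=> //.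
    by move: qx; rewrite /= gf.
  by move=> y Uy; have := qE (g y) Uy; rewrite /= gf.
Qed.

Lemma locfrac_polyfun m n (T : Type) (k : T -> index n -> C) (x : T)
    (h : T -> index m -> C) : (forall i, locfrac k setT (h ^~ i) x) ->
  forall p, polyfun p -> locfrac k setT (fun y => p (h y)) x.
Proof.
move=> hfr p; elim=> [c|i|p1 p2 _ IH1 _ IH2|p1 p2 _ IH1 _ IH2].
- exists (fun=> c), (fun=> 1); split; [exact: polyfun_const|exact: polyfun_const| |].
    by rewrite oner_eq0.
  by move=> y _ _; rewrite divr1.
- exact: hfr.
- have [a [b [pa pb b0 abE]]] := IH1; have [c [d [pc pd d0 cdE]]] := IH2.
  exists (fun y => a y * d y + c y * b y), (fun y => b y * d y); split.
  + by apply: polyfun_add; apply: polyfun_mul.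
  + exact: polyfun_mul.
  + exact: mulf_neq0.
  + move=> y _; rewrite mulf_eq0 negb_or => /andP[by0 dy0].
    by rewrite abE// cdE// addf_div.
- have [a [b [pa pb b0 abE]]] := IH1; have [c [d [pc pd d0 cdE]]] := IH2.
  exists (fun y => a y * c y), (fun y => b y * d y); split.
  + exact: polyfun_mul.
  + exact: polyfun_mul.
  + exact: mulf_neq0.
  + move=> y _; rewrite mulf_eq0 negb_or => /andP[by0 dy0].
    by rewrite abE// cdE// mulf_div.
Qed.

Lemma embedded_morphism m n (X Y : fspace) (k : X -> index n -> C)
    (l : Y -> index m -> C) (h : X -> Y) : embedded k -> embedded l ->
  (forall i x, locfrac k setT (fun y => l (h y) i) x) -> morphism h.
Proof.
move=> [oX rX] [oY rY] hfr V oV.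
have frac p x := @locfrac_polyfun m n X k x (l \o h) (hfr^~ x) p.
have oU : openv (h @^-1` V).
  apply/oX => x Vx; have [q [pq qx qV]] := (oY _).1 oV _ Vx.
  have [a [b [pa pb b0 abE]]] := frac q x pq.
  exists (fun y => a y * b y); split; first exact: polyfun_mul.
    rewrite mulf_neq0//; apply: contraNneq qx => a0.
    by have /= -> := abE x I b0; rewrite a0 mul0r.
  move=> y; rewrite mulf_eq0 negb_or => /andP[a0 b1]; apply: qV.
  by have /= -> := abE y I b1; rewrite mulf_neq0// invr_eq0.
split=> // g rg; apply/rX => // x Vx.
have [p [q [pp pq qx pqE]]] := (rY _ _ oV).1 rg _ Vx.
have [a [b [pa pb b0 abE]]] := frac p x pp.
have [c [d [pc pd d0 cdE]]] := frac q x pq.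
exists (fun y => a y * (d y * d y)), (fun y => d y * (b y * c y)); split.
- by apply: polyfun_mul => //; apply: polyfun_mul.
- by apply: polyfun_mul => //; apply: polyfun_mul.
- rewrite !mulf_neq0//; apply: contraNneq qx => c0.
  by have /= -> := cdE x I d0; rewrite c0 mul0r.
- move=> y Vy; rewrite !mulf_eq0 !negb_or => /and3P[d1 b1 c1].
  have /= aE := abE y I b1; have /= cE := cdE y I d1.
  rewrite /= pqE//; last by rewrite cE mulf_neq0// invr_eq0.
  by rewrite aE cE; field; rewrite b1 c1 d1.
Qed.

Lemma regular_subspace (X : fspace) (A U : set X) (f : X -> C) : openv U -> regular U f ->
  @regular (subspace A) (sval @^-1` U) (f \o sval).
Proof. by move=> oU rf x Ux; exists U, f. Qed.

Lemma variety_morphism m (T : variety) (Y : fspace) (l : Y -> index m -> C)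
    (h : T -> Y) : embedded l ->
  (forall i, regular setT (fun y => l (h y) i)) -> morphism h.
Proof.
move=> eY hreg.
have [M [W [Wop Wcov]]] := variety_affine T.
have tT := variety_topology T; have [oT oI oU] := tT.
have [res glue] := variety_sheaf T.
have mW i : morphism (h \o (sval : subspace (W i) -> T)).
  have [oWi [n [Z [_ [f [g [fg gf mf mg]]]]]]] := Wop i.
  have ek := isomorphic_embedded fg gf mf mg
    (subspace_embedded Z (affine_space_embedded n)).
  apply: (embedded_morphism ek eY) => j x.
  have := @regular_subspace T (W i) _ _ oT (hreg j).
  rewrite preimage_setT => /(ek.2 _ _ _).1; apply=> //.
  by exists setT.
move=> V oV.
have oPre : openv (h @^-1` V).
  apply: open_local => // x Vx; have [i Wix] := Wcov x.
  have [[U oU' UE] _] := mW i _ oV.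
  exists (U `&` W i); split.
  - by apply: oI => //; have [] := Wop i.
  - split=> //.
    have : (sval @^-1` U) (exist _ x Wix : subspace (W i)) by rewrite -UE.
    by [].
  - move=> y [Uy Wy].
    have : (sval @^-1` U) (exist _ y Wy : subspace (W i)) by [].
    by rewrite -UE.
split=> // g rg; apply: glue => // x Vx; have [i Wix] := Wcov x.
have [oVi rVi] := mW i _ oV.
have [U [u [oU' Ux ru uE]]] := rVi _ rg (exist _ x Wix) Vx.
have oWi := (Wop i).1.
exists (h @^-1` V `&` (U `&` W i)); split.
- by apply: (oI) => //; apply: (oI).
- by [].
- by move=> y [].
- apply: (res U _ u) => //; first by apply: (oI) => //; apply: (oI).
    by move=> y [_ []].
  by move=> y [Vy [Uy Wy]]; rewrite -(uE (exist _ y Wy)).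
Qed.

End Embedded.

(** * Classes of locally closed sets in the motivic ring *)

Record cspace := CSpace {
  car :> Type ;
  crd : finType ;
  co : crd -> car -> C ;
  oc : (crd -> C) -> car ;
  coK : forall y j, co j (oc y) = y j ;
  ocK : forall x, oc (co^~ x) = x
}.
Arguments co {c}.

Lemma index_of_ordK n : cancel (@index_of_ord n) (@ord_of_index n).
Proof. by move=> i; apply: val_inj. Qed.

Lemma ord_of_indexK n : cancel (@ord_of_index n) (@index_of_ord n).
Proof. by move=> [i li]; congr exist; exact: bool_irrelevance. Qed.

Lemma co_inj (P : cspace) (x y : P) : (forall j, co j x = co j y) -> x = y.
Proof. by move=> xy; rewrite -(ocK x) -(ocK y); congr oc; apply/funext. Qed.

Section CoordinateSpaces.

Definition scalar_co (j : unit) (x : C) : C := x.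
Definition scalar_oc (y : unit -> C) : C := y tt.
Fact scalar_coK y j : scalar_co j (scalar_oc y) = y j. Proof. by case: j. Qed.
Fact scalar_ocK x : scalar_oc (scalar_co^~ x) = x. Proof. by []. Qed.
Definition scalar_cspace := CSpace scalar_coK scalar_ocK.

Variables P P' : cspace.

Definition prod_co (j : crd P + crd P') (x : P * P') : C :=
  match j with inl a => co a x.1 | inr b => co b x.2 end.
Definition prod_oc (y : crd P + crd P' -> C) : P * P' :=
  (oc (y \o inl), oc (y \o inr)).
Fact prod_coK y j : prod_co j (prod_oc y) = y j.
Proof. by case: j => j /=; rewrite coK. Qed.
Fact prod_ocK x : prod_oc (prod_co^~ x) = x.
Proof. by case: x => x x'; congr pair; apply: co_inj => j; rewrite coK. Qed.
Definition prod_cspace := CSpace prod_coK prod_ocK.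

Definition ffun_co (A : finType) (j : A * crd P) (x : {ffun A -> P}) : C :=
  co j.2 (x j.1).
Definition ffun_oc (A : finType) (y : A * crd P -> C) : {ffun A -> P} :=
  [ffun a => oc (fun j => y (a, j))].
Fact ffun_coK A y j : @ffun_co A j (ffun_oc y) = y j.
Proof. by case: j => a j; rewrite /ffun_co ffunE coK. Qed.
Fact ffun_ocK A x : @ffun_oc A (@ffun_co A^~ x) = x.
Proof. by apply/ffunP => a; apply: co_inj => j; rewrite ffunE coK. Qed.
Definition ffun_cspace A := CSpace (@ffun_coK A) (@ffun_ocK A).

Variables m n : nat.

Definition matrix_co (j : 'I_m * 'I_n) (M : 'M[C]_(m, n)) : C := M j.1 j.2.
Definition matrix_oc (y : 'I_m * 'I_n -> C) : 'M[C]_(m, n) :=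
  \matrix_(i, j) y (i, j).
Fact matrix_coK y j : matrix_co j (matrix_oc y) = y j.
Proof. by case: j => i j; rewrite /matrix_co mxE. Qed.
Fact matrix_ocK M : matrix_oc (matrix_co^~ M) = M.
Proof. by apply/matrixP => i j; rewrite mxE. Qed.
Definition matrix_cspace := CSpace matrix_coK matrix_ocK.

Definition affine_co (i : 'I_n) (x : index n -> C) : C := x (index_of_ord i).
Definition affine_oc (y : 'I_n -> C) : index n -> C := fun i => y (ord_of_index i).
Fact affine_coK y j : affine_co j (affine_oc y) = y j.
Proof. by rewrite /affine_co /affine_oc index_of_ordK. Qed.
Fact affine_ocK x : affine_oc (affine_co^~ x) = x.
Proof. by apply/funext => i; rewrite /affine_co /affine_oc ord_of_indexK. Qed.
Definition affine_cspace := CSpace affine_coK affine_ocK.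

End CoordinateSpaces.

Canonical scalar_cspace.
Canonical prod_cspace.
Canonical ffun_cspace.
Canonical matrix_cspace.

Section Coordinates.
Variable P : cspace.

Inductive pf : (P -> C) -> Prop :=
| pf_const c : pf (fun=> c)
| pf_co j : pf (co j)
| pf_add p q : pf p -> pf q -> pf (fun x => p x + q x)
| pf_mul p q : pf p -> pf q -> pf (fun x => p x * q x).

Definition pt (x : P) : index #|crd P| -> C :=
  fun i => co (enum_val (ord_of_index i)) x.
Definition unpt (y : index #|crd P| -> C) : P :=
  oc (fun j => y (index_of_ord (enum_rank j))).

Lemma unptK : cancel unpt pt.
Proof.
by move=> y; apply/funext => i; rewrite /pt coK enum_valK ord_of_indexK.
Qed.

Lemma ptK : cancel pt unpt.
Proof.
by move=> x; apply: co_inj => j; rewrite coK /pt index_of_ordK enum_rankK.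
Qed.

Lemma polyfun_unpt p : pf p -> polyfun (p \o unpt).
Proof.
elim=> [c|i|q r _ IHq _ IHr|q r _ IHq _ IHr]; first exact: polyfun_const.
- rewrite (_ : _ \o _ = fun y => y (index_of_ord (enum_rank i))); last first.
    by apply/funext => y /=; rewrite coK.
  exact: polyfun_coord.
- exact: (polyfun_add IHq IHr).
- exact: (polyfun_mul IHq IHr).
Qed.

Lemma pf_opp p : pf p -> pf (fun x => - p x).
Proof.
move=> pp; rewrite (_ : (fun x => _) = fun x => (fun=> -1) x * p x).
  by apply: pf_mul => //; exact: pf_const.
by apply/funext => x; rewrite mulN1r.
Qed.

Lemma pf_sub p q : pf p -> pf q -> pf (fun x => p x - q x).
Proof. by move=> pp /pf_opp; exact: pf_add. Qed.

Lemma pf_ext p q : (forall x, p x = q x) -> pf p -> pf q.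
Proof. by move=> pq; rewrite (_ : p = q)//; exact/funext. Qed.

(* One fraction on all of [X], unlike the local fractions of [regular]. *)
Definition reg (X : set P) (f : P -> C) : Prop := exists p q,
  [/\ pf p, pf q & forall x, X x -> q x != 0 /\ f x = p x / q x].

Variable X : set P.

Lemma pf_reg p : pf p -> reg X p.
Proof.
move=> pp; exists p, (fun=> 1); split=> //; first exact: pf_const.
by move=> x _; rewrite oner_eq0 divr1.
Qed.

Lemma reg_add f g : reg X f -> reg X g -> reg X (fun x => f x + g x).
Proof.
move=> [p [q [pp pq E]]] [r [s [pr ps E']]].
exists (fun x => p x * s x + r x * q x), (fun x => q x * s x); split.
- by apply: pf_add; apply: pf_mul.
- exact: pf_mul.
- move=> x Xx; have [[q0 ->] [s0 ->]] := (E x Xx, E' x Xx).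
  by rewrite mulf_neq0// addf_div.
Qed.

Lemma reg_mul f g : reg X f -> reg X g -> reg X (fun x => f x * g x).
Proof.
move=> [p [q [pp pq E]]] [r [s [pr ps E']]].
exists (fun x => p x * r x), (fun x => q x * s x); split; try exact: pf_mul.
move=> x Xx; have [[q0 ->] [s0 ->]] := (E x Xx, E' x Xx).
by rewrite mulf_neq0// mulf_div.
Qed.

Lemma reg_inv f : reg X f -> (forall x, X x -> f x != 0) ->
  reg X (fun x => (f x)^-1).
Proof.
move=> [p [q [pp pq E]]] f0.
exists q, p; split=> // x Xx; have [q0 fE] := E x Xx.
rewrite fE invf_div; split=> //; apply: contraNneq (f0 x Xx) => p0.
by rewrite fE p0 mul0r.
Qed.

Lemma reg_ext f g : (forall x, X x -> f x = g x) -> reg X f -> reg X g.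
Proof.
move=> fg [p [q [pp pq E]]]; exists p, q; split=> // x Xx.
by rewrite -fg//; exact: E.
Qed.

Definition regmap (P' : cspace) (F : P -> P') : Prop :=
  forall j, reg X (fun x => co j (F x)).

End Coordinates.
Arguments pf_const {P}.
Arguments pf_co {P}.

Lemma pf_comp (P P' : cspace) (F : P -> P') :
  (forall j, pf (fun x => co j (F x))) -> forall p, pf p -> pf (p \o F).
Proof.
move=> rF p; elim=> [c|j|q r _ IHq _ IHr|q r _ IHq _ IHr].
- exact/pf_const.
- exact: rF.
- exact: (pf_add IHq IHr).
- exact: (pf_mul IHq IHr).
Qed.

Section Basic.
Variable P : cspace.

(* Locally closed sets of the form [Z \ W] with [Z] closed and [W] defined by
   finitely many equations.  Finiteness makes them visibly finite unions of
   affine varieties, without Hilbert's basis theorem. *)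
Definition basic (X : set P) : Prop :=
  exists (S : set (P -> C)) (I : finType) (q : I -> P -> C),
    [/\ S `<=` @pf P, forall i, pf (q i) &
        forall x, X x <-> (forall p, S p -> p x = 0) /\ exists i, q i x != 0].

Lemma basicI X Y : basic X -> basic Y -> basic (X `&` Y).
Proof.
move=> [S [I [q [Sp qp XE]]]] [S' [I' [q' [Sp' qp' YE]]]].
exists (S `|` S'), (I * I')%type, (fun i x => q i.1 x * q' i.2 x); split.
- by move=> p [/Sp|/Sp'].
- by move=> i; exact: pf_mul.
- move=> x; split.
    move=> [/XE[Sx [i qi]] /YE[Sx' [i' qi']]]; split.
      by move=> p [/Sx|/Sx'].
    by exists (i, i'); rewrite mulf_neq0.
  move=> [SSx [[i i']]]; rewrite mulf_eq0 negb_or => /andP[qi qi'].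
  split; first by apply/XE; split; [move=> p Sp0; apply: SSx; left|exists i].
  by apply/YE; split; [move=> p Sp0; apply: SSx; right|exists i'].
Qed.

Lemma basic_closed (S : set (P -> C)) : S `<=` @pf P ->
  basic [set x | forall p, S p -> p x = 0].
Proof.
move=> Sp; exists S, unit, (fun _ _ => 1); split=> //.
  by move=> _; exact: pf_const.
by move=> x; split=> [Sx|[]//]; split=> //; exists tt; rewrite oner_eq0.
Qed.

Lemma basic_open (I : finType) (q : I -> P -> C) : (forall i, pf (q i)) ->
  basic [set x | exists i, q i x != 0].
Proof. by move=> pq; exists set0, I, q; split=> // x; split=> // -[]. Qed.

Lemma basicT : basic [set: P].
Proof.
rewrite (_ : setT = [set x : P | forall p : P -> C, set0 p -> p x = 0]).
  by apply: (@basic_closed set0) => p [].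
by apply/seteqP; split=> x // _ p [].
Qed.

Lemma basic_eq0 p : pf p -> basic [set x | p x = 0].
Proof.
move=> pp; rewrite (_ : mkset _ = [set x | forall q, [set p] q -> q x = 0]).
  by apply: (@basic_closed [set p]) => _ ->.
by apply/seteqP; split=> x /=; [move=> px0 _ ->|apply].
Qed.

Lemma basic_neq0 p : pf p -> basic [set x | p x != 0].
Proof.
move=> pp; rewrite (_ : mkset _ = [set x | exists i : unit, p x != 0]).
  exact: (@basic_open unit (fun=> p)).
by apply/seteqP; split=> x /=; [move=> ?; exists tt|move=> []].
Qed.

Lemma basic_eq0s (I : Type) (p : I -> P -> C) : (forall i, pf (p i)) ->
  basic [set x | forall i, p i x = 0].
Proof.
move=> pp; rewrite (_ : mkset _ = [set x | forall q, range p q -> q x = 0]).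
  by apply: (@basic_closed (range p)) => _ [i _ <-].
apply/seteqP; split=> x /=; first by move=> px0 _ [i _ <-].
by move=> px i; apply: px; exists i.
Qed.

Lemma basic_ext (X Y : set P) : (forall x, X x <-> Y x) -> basic X -> basic Y.
Proof. by move=> XY; have -> : X = Y by apply/seteqP; split=> x /XY. Qed.

Lemma basic_set0 : basic (@set0 P).
Proof.
apply: (basic_ext _ (basic_eq0 (pf_const 1))) => x; split=> //= /eqP.
by rewrite oner_eq0.
Qed.

Definition space (X : set P) : fspace :=
  subspace ([set y | X (unpt y)] : set (affine_space #|crd P|)).

Definition space_pt (X : set P) (y : space X) : P := unpt (sval y).

Lemma space_ptP X (y : space X) : X (space_pt y). Proof. by case: y. Qed.

Lemma mk_space_subproof X x : X x -> [set y | X (unpt y)] (@pt P x).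
Proof. by rewrite /= ptK. Qed.

Definition mk_space X x (Xx : X x) : space X := exist _ (@pt P x) (mk_space_subproof Xx).

Lemma mk_spaceK X x (Xx : X x) : space_pt (mk_space Xx) = x.
Proof. exact: ptK. Qed.

Lemma space_pt_inj X : injective (@space_pt X).
Proof.
move=> [x Xx] [y Xy] /(congr1 (@pt P)); rewrite /space_pt /= !unptK => xy.
exact: eq_exist.
Qed.

Lemma space_embedded X : embedded (fun y : space X => pt (space_pt y)).
Proof.
rewrite (_ : (fun y => _) = id \o sval).
  exact/subspace_embedded/affine_space_embedded.
by apply/funext => y /=; rewrite /space_pt unptK.
Qed.

End Basic.

Lemma basic_preimage (P P' : cspace) (F : P -> P') (X : set P') :
  (forall j, pf (fun x => co j (F x))) -> basic X -> basic (F @^-1` X).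
Proof.
move=> pF [S [I [q [Sp qp XE]]]].
exists [set p \o F | p in S], I, (fun i => q i \o F); split.
- by move=> _ [p /Sp pp <-]; exact: pf_comp.
- by move=> i; exact: pf_comp.
- move=> x; apply: iff_trans (XE _) _; split=> -[SF qF]; split=> //.
    by move=> _ [p /SF pF0 <-].
  by move=> p Sp0; apply: (SF (p \o F)); exists p.
Qed.

Lemma basic_setX (P P' : cspace) (X : set P) (X' : set P') :
  basic X -> basic X' -> @basic (prod_cspace P P') (X `*` X').
Proof.
move=> bX bX'.
apply: (@basicI _ (fst @^-1` X) (snd @^-1` X')).
  by apply: (basic_preimage _ bX) => j; exact: (@pf_co (prod_cspace P P') (inl j)).
by apply: (basic_preimage _ bX') => j; exact: (@pf_co (prod_cspace P P') (inr j)).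
Qed.

(* [Y] is the subspace [X] of [P], with [s] as inclusion. *)
Definition models (P : cspace) (Y : fspace) (X : set P) (s : Y -> P) : Prop :=
  [/\ embedded (fun y => pt (s y)), forall y, X (s y), injective s &
      forall x, X x -> exists y, s y = x].

Lemma space_models (P : cspace) (X : set P) : models X (@space_pt P X).
Proof.
split; [exact: space_embedded|exact: space_ptP|exact: space_pt_inj|].
by move=> x Xx; exists (mk_space Xx); exact: mk_spaceK.
Qed.

Lemma subspace_models (P : cspace) (Y : fspace) (X B : set P) (s : Y -> P) :
  models X s -> models (X `&` B) (s \o (sval : subspace (s @^-1` B) -> Y)).
Proof.
move=> [es Xs si sX]; split.
- exact: (subspace_embedded _ es).
- by move=> [y By]; exact: (conj (Xs y) By).
- by move=> [y By] [z Bz] /si /= yz; exact: eq_exist.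
- move=> x [/sX[y yx] Bx].
  have By : (s @^-1` B) y by rewrite /= yx.
  by exists (exist _ y By).
Qed.

Lemma models_morphism (P P' : cspace) (Y Y' : fspace) (X : set P) (X' : set P')
    (s : Y -> P) (s' : Y' -> P') (F : P -> P') (h : Y -> Y') :
  models X s -> models X' s' -> regmap X F ->
  (forall y, s' (h y) = F (s y)) -> morphism h.
Proof.
move=> [es Xs si sX] [es' _ _ _] rF hE; apply: embedded_morphism es es' _.
move=> i y.
have [p [q [/polyfun_unpt pp /polyfun_unpt pq E]]] := rF (enum_val (ord_of_index i)).
exists (p \o @unpt P), (q \o @unpt P); split=> //=.
  by rewrite ptK; have [] := E _ (Xs y).
by move=> z _ _; rewrite ptK /pt hE; have [] := E _ (Xs z).
Qed.

Lemma models_isomorphic (P P' : cspace) (Y Y' : fspace) (X : set P) (X' : set P')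
    (s : Y -> P) (s' : Y' -> P') (F : P -> P') (G : P' -> P) :
  models X s -> models X' s' -> regmap X F -> regmap X' G ->
  (forall x, X x -> X' (F x) /\ G (F x) = x) ->
  (forall x, X' x -> X (G x) /\ F (G x) = x) ->
  isomorphic Y Y'.
Proof.
move=> mY mY' rF rG XF XG.
have [_ Xs si sX] := mY; have [_ Xs' si' sX'] := mY'.
pose f y := projT1 (cid (sX' _ (XF _ (Xs y)).1)).
pose g y := projT1 (cid (sX _ (XG _ (Xs' y)).1)).
have fE y : s' (f y) = F (s y) by rewrite /f; case: cid.
have gE y : s (g y) = G (s' y) by rewrite /g; case: cid.
exists f, g; split.
- by move=> y; apply: si; rewrite gE fE (XF _ (Xs y)).2.
- by move=> y; apply: si'; rewrite fE gE (XG _ (Xs' y)).2.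
- exact: models_morphism mY mY' rF fE.
- exact: models_morphism mY' mY rG gE.
Qed.

Lemma regmap_id (P : cspace) (X : set P) : regmap X id.
Proof. by move=> j; exact/pf_reg/pf_co. Qed.

Lemma regmap_pair (P P1 P2 : cspace) (X : set P) (F : P -> P1) (G : P -> P2) :
  regmap X F -> regmap X G -> @regmap P X (prod_cspace P1 P2) (fun x => (F x, G x)).
Proof. by move=> rF rG [j|j]; [exact: rF|exact: rG]. Qed.

Lemma regmap_fst (P P' : cspace) (X : set (P * P')) :
  @regmap (prod_cspace P P') X P fst.
Proof. by move=> j; exact/pf_reg/(@pf_co (prod_cspace P P') (inl j)). Qed.

Lemma regmap_snd (P P' : cspace) (X : set (P * P')) :
  @regmap (prod_cspace P P') X P' snd.
Proof. by move=> j; exact/pf_reg/(@pf_co (prod_cspace P P') (inr j)). Qed.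

Lemma closed_affine (P : cspace) (S : set (P -> C)) : S `<=` @pf P ->
  is_affine (space [set x | forall p, S p -> p x = 0]).
Proof.
move=> Sp; exists #|crd P|, [set y | forall p, S p -> p (unpt y) = 0].
split; last exact: isomorphic_refl.
rewrite /closedv /openv /= setCK; exists [set p \o @unpt P | p in S].
  by move=> _ [p /Sp pp <-]; exact: polyfun_unpt.
apply/seteqP; split=> y /= H; first by move=> _ [p Spp <-]; exact: H.
by move=> p Spp; apply: (H (p \o @unpt P)); exists p.
Qed.

Section BasicVariety.
Variable P : cspace.

Lemma principal_open_affine (S : set (P -> C)) (q : P -> C) (Y : fspace) (s : Y -> P) :
  S `<=` @pf P -> pf q ->
  models [set x | (forall p, S p -> p x = 0) /\ q x != 0] s -> is_affine Y.
Proof.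
move=> Sp pq mY.
pose P1 := prod_cspace P scalar_cspace.
pose S1 : set (P1 -> C) := [set p \o fst | p in S] `|`
  [set (fun x : P1 => q x.1 * x.2 - 1)].
have pfst p : pf p -> @pf P1 (p \o fst).
  by apply: pf_comp => j; exact: (@pf_co P1 (inl j)).
have S1p : S1 `<=` @pf P1.
  move=> _ [[p /Sp pp <-]|->]; first exact: pfst.
  apply: pf_sub; last exact: pf_const.
  by apply: pf_mul; [exact: pfst|exact: (@pf_co P1 (inr tt))].
have [n [Z [cZ iZ]]] := closed_affine S1p.
exists n, Z; split=> //; apply: isomorphic_trans iZ.
apply: (models_isomorphic (F := (fun x => (x, (q x)^-1) : P1)) (G := fst)
  mY (space_models _)).
- apply: (@regmap_pair P P scalar_cspace); first exact: regmap_id.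
  by move=> j; apply: reg_inv; [exact: pf_reg|move=> x []].
- exact: regmap_fst.
- move=> x [Sx qx]; split=> // _ [[p /Sx px <-//]|-> /=].
  by rewrite divff// subrr.
- move=> [x t] /= S1x.
  have /eqP := S1x (fun x : P1 => q x.1 * x.2 - 1) (or_intror erefl).
  rewrite /= subr_eq0 => /eqP qt.
  have q0 : q x != 0 by apply: contra_eq_neq qt => ->; rewrite mul0r eq_sym oner_eq0.
  split; last by congr pair; rewrite -[LHS]mulr1 -qt mulKf.
  split=> // p pS; apply: (S1x (p \o fst)).
  by left; exists p.
Qed.

Lemma space_topology (X : set P) : topology_axioms (space X).
Proof. exact/subspace_topology/affine_space_topology. Qed.

Lemma space_sheaf (X : set P) : sheaf_axioms (space X).
Proof.
apply: subspace_sheaf; [exact: affine_space_topology|exact: affine_space_sheaf].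
Qed.

Lemma space_separated (X : set P) : separated (space X).
Proof. exact/subspace_separated/affine_space_separated. Qed.

Lemma space_open_neq0 (X : set P) q : pf q ->
  @openv (space X) [set y | q (space_pt y) != 0].
Proof.
move=> pq; apply/(space_embedded X).1 => y qy; exists (q \o @unpt P); split.
- exact: polyfun_unpt.
- by rewrite /= ptK.
- by move=> z; rewrite /= ptK.
Qed.

Lemma basic_locally_affine (X : set P) : basic X -> locally_affine (space X).
Proof.
move=> [S [I [q [Sp pq XE]]]]; exists #|I|.
exists (fun i => [set y | q (enum_val i) (space_pt y) != 0]); split=> [i|y].
  split; first exact: space_open_neq0.
  have := subspace_models [set x | q (enum_val i) x != 0] (space_models X).
  rewrite (_ : _ `&` _ = [set x | (forall p, S p -> p x = 0) /\ q (enum_val i) x != 0]).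
    exact: principal_open_affine.
  apply/seteqP; split=> x /= [].
    by move=> /XE[].
  by move=> Sx qx; split=> //; apply/XE; split=> //; exists (enum_val i).
have /XE[_ [i qi]] := space_ptP y.
by exists (enum_rank i); rewrite /= enum_rankK.
Qed.

Definition basic_variety (X : set P) (bX : basic X) : variety :=
  Variety (space_topology X) (space_sheaf X) (basic_locally_affine bX)
    (@space_separated X).

(* Junk value [0] if [X] is not basic. *)
Definition cls (X : set P) : motivic_ring :=
  match pselect (basic X) with
  | left bX => motive (basic_variety bX)
  | right _ => 0
  end.

Lemma clsE (X : set P) : basic X ->
  exists2 V : variety, variety_space V = space X & cls X = motive V.
Proof.
move=> bX; rewrite /cls; case: pselect => // bX'.
by exists (basic_variety bX').
Qed.

End BasicVariety.

Section MotivicRing.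

Let loc_mapE (A : comPzRingType) (S : set A) a :
  loc_map S a = presented_gen (@loc_rel A S) (LFrac S a).
Proof. by []. Qed.

Lemma loc_mapD (A : comPzRingType) (S : set A) a b :
  loc_map S (a + b) = loc_map S a + loc_map S b.
Proof.
by rewrite !loc_mapE /presented_gen -presented_piD; exact/presented_rel/loc_relD.
Qed.

Lemma loc_mapM (A : comPzRingType) (S : set A) a b :
  loc_map S (a * b) = loc_map S a * loc_map S b.
Proof.
by rewrite !loc_mapE /presented_gen -presented_piM; exact/presented_rel/loc_relM.
Qed.

Lemma loc_map1 (A : comPzRingType) (S : set A) : loc_map S 1 = 1.
Proof.
by rewrite !loc_mapE /presented_gen -presented_pi1; exact/presented_rel/loc_rel1.
Qed.

Lemma motive_iso (X Y : variety) : isomorphic X Y -> motive X = motive Y.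
Proof.
by move=> XY; congr loc_map; apply: presented_rel; exact: K0_iso.
Qed.

Lemma motive_scissor (X Z U : variety) (A : set X) :
  closedv A -> isomorphic Z (subspace A) -> isomorphic U (subspace (~` A)) ->
  motive X = motive Z + motive U.
Proof.
move=> cA ZA UA; rewrite -loc_mapD; congr loc_map.
by rewrite -presented_piD; apply: presented_rel; exact: K0_scissor cA ZA UA.
Qed.

Lemma motive_product (X Y P : variety) (p : P -> X) (q : P -> Y) :
  is_product p q -> motive P = motive X * motive Y.
Proof.
move=> pq; rewrite -loc_mapM; congr loc_map.
by rewrite -presented_piM; apply: presented_rel; exact: K0_prod pq.
Qed.

Lemma motive_point (X : variety) : isomorphic X (affine_space 0) -> motive X = 1.
Proof.
move=> iX; rewrite -(loc_map1 [set s : K0 | s = lefschetz \/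
  exists2 i, (0 < i)%N & s = 1 - lefschetz ^+ i]); congr loc_map.
by rewrite -presented_pi1; apply: presented_rel; exact: K0_point.
Qed.

End MotivicRing.

Lemma cls_models (P : cspace) (X : set P) (V : variety) (s : V -> P) :
  basic X -> models X s -> cls X = motive V.
Proof.
move=> bX mX; have [W WE ->] := clsE bX; apply: motive_iso; rewrite WE.
by apply: (models_isomorphic (F := id) (G := id) (space_models X) mX) => //;
  exact: regmap_id.
Qed.

Lemma cls_iso (P P' : cspace) (X : set P) (X' : set P') (F : P -> P') (G : P' -> P) :
  basic X -> basic X' -> regmap X F -> regmap X' G ->
  (forall x, X x -> X' (F x) /\ G (F x) = x) ->
  (forall x, X' x -> X (G x) /\ F (G x) = x) ->
  cls X = cls X'.
Proof.
move=> /clsE[V VE ->] /clsE[V' VE' ->] rF rG XF XG.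
apply: motive_iso; rewrite VE VE'.
exact: (models_isomorphic (space_models X) (space_models X') rF rG XF XG).
Qed.

Lemma cls_scissor (P : cspace) (X : set P) (I : finType) (p : I -> P -> C) :
  basic X -> (forall i, pf (p i)) ->
  cls X = cls (X `&` [set x | forall i, p i x = 0]) +
          cls (X `&` [set x | exists i, p i x != 0]).
Proof.
move=> bX pp; rewrite {1}/cls; case: pselect => // bX'.
have [V VE ->] := clsE (basicI bX (basic_eq0s pp)).
have [W WE ->] := clsE (basicI bX (basic_open pp)).
have ext : [set x | exists i, p i x != 0] = ~` [set x | forall i, p i x = 0].
  apply/seteqP; split=> x /=.
    by move=> [i pi] /(_ i) pi0; rewrite pi0 eqxx in pi.
  by move=> /existsNP[i pi]; exists i; apply/eqP.
pose B := [set x | forall i, p i x = 0].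
apply: (@motive_scissor (basic_variety bX') _ _ (@space_pt P X @^-1` B)).
- rewrite /closedv (_ : ~` _ = \bigcup_(U in
      [set [set y : space X | p i (space_pt y) != 0] | i in [set: I]]) U).
    have [_ _] := space_topology X; apply=> _ [i _ <-].
    exact: space_open_neq0.
  rewrite preimage_setC /B -ext bigcup_image.
  by apply/seteqP; split=> y /=; [move=> [i iy]|move=> [i _ iy]]; exists i.
- rewrite VE; apply: (models_isomorphic (F := id) (G := id) (space_models _)
    (subspace_models B (space_models X))) => //; exact: regmap_id.
- rewrite WE ext preimage_setC.
  apply: (models_isomorphic (F := id) (G := id) (space_models _)
    (subspace_models (~` B) (space_models X))) => //; exact: regmap_id.
Qed.

Lemma cls_prod (P P' : cspace) (X : set P) (X' : set P') : basic X -> basic X' ->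
  @cls (prod_cspace P P') (X `*` X') = cls X * cls X'.
Proof.
move=> bX bX'; pose PP := prod_cspace P P'.
rewrite /cls; case: pselect => [bXX|]; last by have := basic_setX bX bX'.
case: pselect => // bX1; case: pselect => // bX1'.
pose p (z : space (X `*` X' : set PP)) : space X := mk_space (space_ptP z).1.
pose q (z : space (X `*` X' : set PP)) : space X' := mk_space (space_ptP z).2.
have pE z : space_pt (p z) = (space_pt z).1 by rewrite mk_spaceK.
have qE z : space_pt (q z) = (space_pt z).2 by rewrite mk_spaceK.
apply: (@motive_product (basic_variety bX1) (basic_variety bX1') (basic_variety bXX) p q);
  split.
- exact: (models_morphism (space_models _) (space_models _) (@regmap_fst P P' _) pE).
- exact: (models_morphism (space_models _) (space_models _) (@regmap_snd P P' _) qE).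
move=> T f g mf mg.
pose h (t : T) : space (X `*` X' : set PP) :=
  @mk_space PP (X `*` X') (space_pt (f t), space_pt (g t))
    (conj (space_ptP (f t)) (space_ptP (g t))).
have hE t : space_pt (h t) = (space_pt (f t), space_pt (g t)) by rewrite mk_spaceK.
have coreg (R : cspace) (Z : set R) (u : T -> space Z) : morphism u ->
    forall j, regular setT (fun t => co j (space_pt (u t))).
  move=> mu j; have oT : @openv (space Z) setT by have [] := space_topology Z.
  have [_ /(_ (fun y => co j (space_pt y)))] := mu _ oT; apply.
  apply/((space_embedded Z).2 _ _ oT) => y _.
  exists (co j \o @unpt R), (fun=> 1); split.
  - exact/polyfun_unpt/pf_co.
  - exact: polyfun_const.
  - exact: oner_neq0.
  - by move=> z _ _; rewrite divr1 /= ptK.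
exists h; split.
  split.
  - apply: (variety_morphism (space_embedded _)) => i.
    rewrite /pt; case: (enum_val _) => j.
      by under eq_fun do rewrite hE /=; exact: coreg.
    by under eq_fun do rewrite hE /=; exact: coreg.
  - by apply/funext => t; apply: space_pt_inj; rewrite /= pE hE.
  - by apply/funext => t; apply: space_pt_inj; rewrite /= qE hE.
move=> h' [_ ph' qh']; apply/funext => t; apply: space_pt_inj.
by rewrite hE -ph' -qh' /= pE qE -surjective_pairing.
Qed.

Lemma cls_set0 (P : cspace) : cls (@set0 P) = 0.
Proof.
have := @cls_scissor P set0 unit (fun _ _ => 1) (@basic_set0 P) (fun _ => pf_const 1).
by rewrite !set0I => /esym/eqP; rewrite addrC -subr_eq0 addrK => /eqP.
Qed.

Lemma affine_space_models n :
  @models (affine_cspace n) (affine_space n) setT id.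
Proof.
pose f (x : affine_space n) := @mk_space (affine_cspace n) setT x I.
pose g (y : @space (affine_cspace n) setT) : affine_space n := space_pt y.
have fg : cancel f g by move=> x; exact: (@mk_spaceK (affine_cspace n) setT x I).
have gf : cancel g f by move=> x; apply: space_pt_inj; exact: fg.
have mf : morphism f.
  apply: (embedded_morphism (affine_space_embedded n) (space_embedded _)).
  move=> i x; rewrite (_ : (fun y => _) = fun y => pt (y : affine_cspace n) i).
    exists (fun y => y (index_of_ord (enum_val (ord_of_index i)))), (fun=> 1).
    split; [exact: polyfun_coord|exact: polyfun_const|exact: oner_neq0|].
    by move=> y _ _; rewrite divr1.
  by apply/funext => y; congr pt; exact: fg.
have mg : morphism g.
  apply: (embedded_morphism (space_embedded _) (affine_space_embedded n)).
  move=> i x; exists ((@co (affine_cspace n) (ord_of_index i)) \o @unpt _), (fun=> 1).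
  split; [exact/polyfun_unpt/pf_co|exact: polyfun_const|exact: oner_neq0|].
  move=> y _ _; rewrite divr1 -[i in LHS]ord_of_indexK -[LHS]/(affine_co _ _).
  exact: (congr1 (affine_co (ord_of_index i))
    (esym (@ptK (affine_cspace n) (space_pt y)))).
split=> //; last by move=> x _; exists x.
have := isomorphic_embedded fg gf mf mg (space_embedded _).
by congr embedded; apply/funext => x; exact: (congr1 (@pt (affine_cspace n)) (fg x)).
Qed.

Lemma cls_scalar : cls [set: scalar_cspace] = mL.
Proof.
transitivity (cls [set: affine_cspace 1]).
  apply: (@cls_iso scalar_cspace (affine_cspace 1) _ _ (fun x _ => x)
    (fun y => y (index_of_ord ord0))); try exact: basicT.
  - by move=> j; exact/pf_reg/(@pf_co scalar_cspace tt).
  - by move=> j; exact/pf_reg/(@pf_co (affine_cspace 1) ord0).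
  - by [].
  - move=> y _; split=> //; apply/funext => i.
    have -> : i = index_of_ord ord0 by rewrite -[LHS]ord_of_indexK [ord_of_index i]ord1.
    by [].
apply: (@cls_models (affine_cspace 1) _ (affine_space_variety 1)).
  exact: basicT.
exact: affine_space_models.
Qed.

Definition coord_subspace (P : cspace) (B : {set crd P}) : set P :=
  [set x | forall j, j \notin B -> co j x = 0].

Lemma basic_coord_subspace (P : cspace) (B : {set crd P}) :
  basic (coord_subspace B).
Proof.
apply: (basic_ext _ (@basic_eq0s P {j | j \notin B} (fun j => co (sval j)) _)).
  by move=> x; split=> H j => [jB|]; [exact: (H (exist _ j jB))|exact/H/(svalP j)].
by move=> j; exact: pf_co.
Qed.

Lemma cls_coord_subspace (P : cspace) (B : {set crd P}) :
  cls (coord_subspace B) = mL ^+ #|B|.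
Proof.
move En: #|B| => n; elim: n B En => [B /cards0_eq ->|n IHn B Bn]; last first.
  have [j jB] : exists j, j \in B by apply/card_gt0P; rewrite Bn.
  move: Bn; rewrite (cardsD1 j) jB => -[Bn].
  have {IHn} IH := IHn _ Bn.
  rewrite -(finset.setD1K jB).
  have : j \notin (B :\ j)%SET by rewrite !inE eqxx.
  move: (B :\ j)%SET IH => {jB Bn} {}B IH jB.
  rewrite exprS -IH -cls_scalar mulrC.
  rewrite -cls_prod; [|exact: basic_coord_subspace|exact: basicT].
  apply: (@cls_iso _ (prod_cspace P scalar_cspace) _ _
    (fun x => (oc (fun k => if k == j then 0 else co k x), co j x) : P * C)
    (fun y => oc (fun k => if k == j then y.2 else co k y.1))).
  - exact: basic_coord_subspace.
  - apply: (basic_setX (P' := scalar_cspace)); first exact: basic_coord_subspace.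
    exact: basicT.
  - apply: (@regmap_pair _ P scalar_cspace) => [k|[]]; last exact/pf_reg/pf_co.
    under eq_fun do rewrite coK.
    by case: eqP => _; [exact/pf_reg/pf_const|exact/pf_reg/pf_co].
  - move=> k; under eq_fun do rewrite coK.
    case: eqP => _; first exact: (@regmap_snd P scalar_cspace _ tt).
    exact: (@regmap_fst P scalar_cspace _ k).
  - move=> x Bx; split; first split=> // k kB; rewrite ?coK.
      by case: eqP => // /eqP kj; apply: Bx; rewrite !inE negb_or kj.
    by apply: co_inj => k; rewrite !coK; case: eqP => [->|].
  - move=> [x t] [/= Bx _]; split=> [k|].
      by rewrite !inE negb_or => /andP[/negPf kj kB]; rewrite coK kj; exact: Bx.
    congr pair; last by rewrite coK eqxx.
    by apply: co_inj => k; rewrite !coK; case: eqP => // ->; rewrite Bx.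
rewrite expr0; have [V VE ->] := clsE (@basic_coord_subspace P finset.set0).
apply: motive_point; rewrite VE.
apply: (models_isomorphic (F := (fun _ _ => 0) : P -> affine_cspace 0)
  (G := fun _ => oc (fun=> 0)) (space_models _) (affine_space_models 0)).
- by move=> j; exact/pf_reg/pf_const.
- by move=> j; under eq_fun do rewrite coK; exact/pf_reg/pf_const.
- move=> x x0; split=> //; apply: co_inj => j; rewrite coK x0//.
  by rewrite inE.
- move=> y _; split; first by move=> j _; rewrite coK.
  by apply/funext => -[].
Qed.

Section Strata.
Variables (P : cspace) (I : finType) (key : I -> nat) (p : I -> P -> C).
Hypotheses (key_inj : injective key) (pp : forall i, pf (p i)).

Definition stratum (X : set P) (i : I) : set P :=
  X `&` [set x | p i x != 0 /\ forall j, (key j < key i)%N -> p j x = 0].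

Lemma basic_stratum X i : basic X -> basic (stratum X i).
Proof.
move=> bX; apply: basicI => //; apply: basicI; first exact: basic_neq0.
apply: (basic_ext _ (@basic_eq0s P {j | (key j < key i)%N} (fun j => p (sval j)) _)).
  by move=> x; split=> H j => [ji|]; [exact: (H (exist _ j ji))|exact/H/(svalP j)].
by move=> j; exact: pp.
Qed.

Lemma cls_strata X : basic X -> (forall x, X x -> exists i, p i x != 0) ->
  cls X = \sum_i cls (stratum X i).
Proof.
move=> bX cov.
have main k : cls X = \sum_(i | (key i < k)%N) cls (stratum X i) +
    cls (X `&` [set x | forall i, (key i < k)%N -> p i x = 0]).
  elim: k => [|k IH].
    rewrite big_pred0// add0r; congr cls.
    by apply/seteqP; split=> x // [].
  rewrite IH; case: (pickP (fun i => key i == k)) => [i /eqP ik|nk]; last first.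
    congr (_ + _).
      apply: eq_bigl => i; rewrite [in RHS]ltnS [in RHS]leq_eqVlt.
      by rewrite [key i == k]nk.
    congr cls; apply/seteqP; split=> x [Xx x0]; split=> // i ik; apply: x0.
      by move: ik; rewrite ltnS leq_eqVlt [key i == k]nk.
    exact: ltnW.
  rewrite [in RHS](bigD1 i) ?ik//= -addrA addrCA; congr (_ + _).
    apply: eq_bigl => j; rewrite [in RHS]ltnS [in RHS]leq_eqVlt andb_orl.
    have [->|ji] := eqVneq j i; first by rewrite ik ltnn !andbF.
    rewrite !andbT; case: eqP => //; rewrite -ik => /key_inj ij.
    by rewrite ij eqxx in ji.
  rewrite (@cls_scissor P _ unit (fun _ => p i)); last by move=> _; exact: pp.
    rewrite addrC; congr (_ + _); congr cls; apply/seteqP; split=> x /=.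
    - move=> [[Xx x0] pi]; split=> // j; rewrite ltnS leq_eqVlt => /orP[|].
        by rewrite -ik => /eqP /key_inj ->; exact: (pi tt).
      exact: x0.
    - move=> [Xx x0]; split; last by move=> _; apply: x0; rewrite ik.
      by split=> // j jk; apply: x0; exact: ltnW.
    - by move=> [[Xx x0] [_ pi]]; split=> //; split=> // j; rewrite ik; exact: x0.
    - move=> [Xx [pi x0]]; split; last by exists tt.
      by split=> // j; rewrite -ik; exact: x0.
  apply: basicI => //.
  apply: (basic_ext _ (@basic_eq0s P {j | (key j < k)%N} (fun j => p (sval j)) _)).
    by move=> x; split=> H j => [ji|]; [exact: (H (exist _ j ji))|exact/H/(svalP j)].
  by move=> j; exact: pp.
rewrite (main (\max_i key i).+1).
rewrite (_ : X `&` _ = set0) ?cls_set0 ?addr0.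
  by apply: eq_bigl => i; rewrite ltnS leq_bigmax.
apply/seteqP; split=> x // [/cov[i /negP pi] /= x0]; apply: pi; rewrite x0//.
by rewrite ltnS leq_bigmax.
Qed.

End Strata.

Section FunctionAlgebra.
Variable P : cspace.

Record function_algebra (K : (P -> C) -> Prop) : Prop := FunctionAlgebra {
  alg_const : forall c, K (fun=> c) ;
  alg_add : forall f g, K f -> K g -> K (fun x => f x + g x) ;
  alg_mul : forall f g, K f -> K g -> K (fun x => f x * g x)
}.

Lemma pf_alg : function_algebra (@pf P).
Proof. by split; [exact: pf_const|exact: pf_add|exact: pf_mul]. Qed.

Lemma reg_alg X : function_algebra (@reg P X).
Proof.
split; [|exact: reg_add|exact: reg_mul].
by move=> c; exact/pf_reg/pf_const.
Qed.

Variables (K : (P -> C) -> Prop) (algK : function_algebra K).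

Definition algmx m n (M : P -> 'M[C]_(m, n)) : Prop :=
  forall i j, K (fun x => M x i j).

Lemma alg_sum (I : Type) (r : seq I) (F : I -> P -> C) :
  (forall i, K (F i)) -> K (fun x => \sum_(i <- r) F i x).
Proof.
move=> Fp; elim: r => [|i r IH].
  by under eq_fun do rewrite big_nil; exact: alg_const.
by under eq_fun do rewrite big_cons; exact: alg_add.
Qed.

Lemma alg_prod (I : Type) (r : seq I) (F : I -> P -> C) :
  (forall i, K (F i)) -> K (fun x => \prod_(i <- r) F i x).
Proof.
move=> Fp; elim: r => [|i r IH].
  by under eq_fun do rewrite big_nil; exact: alg_const.
by under eq_fun do rewrite big_cons; exact: alg_mul.
Qed.

Lemma algmx_const m n (M : 'M[C]_(m, n)) : algmx (fun=> M).
Proof. by move=> i j; exact: alg_const. Qed.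

Lemma algmx_add m n (M M' : P -> 'M[C]_(m, n)) :
  algmx M -> algmx M' -> algmx (fun x => M x + M' x).
Proof. by move=> aM aM' i j; under eq_fun do rewrite mxE; exact: alg_add. Qed.

Lemma algmx_mul m n p (M : P -> 'M[C]_(m, n)) (M' : P -> 'M[C]_(n, p)) :
  algmx M -> algmx M' -> algmx (fun x => M x *m M' x).
Proof.
move=> aM aM' i j; under eq_fun do rewrite mxE.
by apply: alg_sum => k; exact: alg_mul.
Qed.

Lemma alg_det n (M : P -> 'M[C]_n) : algmx M -> K (fun x => \det (M x)).
Proof.
move=> aM; apply: alg_sum => s; apply: alg_mul; [by []|exact: alg_const|].
exact: alg_prod.
Qed.

End FunctionAlgebra.

Lemma regmx_inv (P : cspace) (X : set P) n (M : P -> 'M[C]_n) :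
  algmx (reg X) M -> (forall x, X x -> M x \in unitmx) ->
  algmx (reg X) (fun x => invmx (M x)).
Proof.
move=> rM uM i j; have algX := reg_alg X.
apply: (@reg_ext _ _ (fun x => (\det (M x))^-1 * cofactor (M x) j i)).
  by move=> x Xx; rewrite /invmx uM// !mxE.
apply: reg_mul.
  apply: reg_inv; first exact: alg_det.
  by move=> x Xx; rewrite -unitfE -unitmxE uM.
apply: reg_mul; first exact/pf_reg/pf_const.
apply: alg_det => // k l.
by under eq_fun do rewrite !mxE; exact: rM.
Qed.

Lemma basic_mx_eq (P : cspace) m n (M M' : P -> 'M[C]_(m, n)) :
  algmx (@pf P) M -> algmx (@pf P) M' -> basic [set x | M x = M' x].
Proof.
move=> pM pM'.
apply: (basic_ext _ (@basic_eq0s P ('I_m * 'I_n)%type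
  (fun ij x => M x ij.1 ij.2 - M' x ij.1 ij.2) _)); last first.
  by move=> ij; exact: pf_sub.
move=> x; split=> /= [E|-> ij]; last by rewrite subrr.
by apply/matrixP => i j; have /subr0_eq := E (i, j).
Qed.

(** * Nilpotent representations and the nullcone *)

Section DiagonalProjections.
Variable n : nat.
Implicit Types S : {set 'I_n}.

Definition proj S : 'M[C]_n := diag_mx (\row_u (u \in S)%:R).

Lemma proj_mulE m S (M : 'M[C]_(n, m)) u v :
  (proj S *m M) u v = if u \in S then M u v else 0.
Proof. by rewrite mul_diag_mx !mxE; case: ifP; rewrite ?mul1r ?mul0r. Qed.

Lemma mul_projE m S (M : 'M[C]_(m, n)) u v :
  (M *m proj S) u v = if v \in S then M u v else 0.
Proof. by rewrite mul_mx_diag !mxE; case: ifP; rewrite ?mulr1 ?mulr0. Qed.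

Lemma projE S u v : proj S u v = (u == v)%:R *+ (u \in S).
Proof.
by rewrite -[proj S]mulmx1 proj_mulE mxE; case: ifP => _; rewrite ?mulr1n ?mulr0n.
Qed.

Lemma projI S S' : proj S *m proj S' = proj (S :&: S').
Proof.
by apply/matrixP => u v; rewrite proj_mulE !projE inE; case: (u \in S).
Qed.

Lemma projT : proj finset.setT = 1%:M.
Proof. by apply/matrixP => u v; rewrite projE inE mulr1n mxE. Qed.

Lemma proj0 : proj finset.set0 = 0.
Proof. by apply/matrixP => u v; rewrite projE inE mulr0n mxE. Qed.

Lemma projC S : proj (~: S) = 1%:M - proj S.
Proof.
apply/matrixP => u v; rewrite projE inE mxE [X in _ + X]mxE projE.
rewrite [X in X + _]mxE; case: (u \in S) => /=; first by rewrite mulr1n subrr.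
by rewrite mulr0n subr0 mulr1n.
Qed.

Lemma proj_idem S : proj S *m proj S = proj S.
Proof. by rewrite projI finset.setIid. Qed.

Lemma proj_commP S (M : 'M[C]_n) :
  (forall u v, M u v != 0 -> (u \in S) = (v \in S)) <->
  proj S *m M = M *m proj S.
Proof.
split=> [MS|MS u v Muv].
  apply/matrixP => u v; rewrite proj_mulE mul_projE.
  have [->|/MS ->//] := eqVneq (M u v) 0; by rewrite !if_same.
have := congr1 (fun A : 'M_n => A u v) MS; rewrite proj_mulE mul_projE.
by case: ifP; case: ifP => // _ _ /eqP; rewrite ?[0 == _]eq_sym (negbTE Muv).
Qed.

Lemma proj_idP m S (M : 'M[C]_(n, m)) :
  (forall u v, u \notin S -> M u v = 0) <-> proj S *m M = M.
Proof.
split=> [MS|<- u v /negPf uS]; last by rewrite proj_mulE uS.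
by apply/matrixP => u v; rewrite proj_mulE; case: ifPn => // /MS ->.
Qed.

Lemma id_projP m S (M : 'M[C]_(m, n)) :
  (forall u v, v \notin S -> M u v = 0) <-> M *m proj S = M.
Proof.
split=> [MS|<- u v /negPf uS]; last by rewrite mul_projE uS.
by apply/matrixP => u v; rewrite mul_projE; case: ifPn => // /MS ->.
Qed.

Lemma delta_proj_mul (u : 'I_n) :
  (delta_mx u 0 : 'cV[C]_n) *m (delta_mx 0 u : 'rV_n) = proj [set u]%SET.
Proof.
rewrite mul_delta_mx; apply/matrixP => v w; rewrite projE inE mxE.
have [->|vu] := eqVneq v u; rewrite /= ?mulr0n ?mulr1n; last by [].
by rewrite eq_sym.
Qed.

End DiagonalProjections.

Section Nilpotent.
Variables (A : finType) (n : nat).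
Implicit Types (V : {ffun A -> 'M[C]_n}) (W : 'M[C]_n) (S U : {set 'I_n}).

(* [W *m V a] is the action of [a] on row vectors: nonzero row spaces that are
   generated by their images do not exist iff long products of the [V a]
   vanish. *)
Definition nil V : Prop :=
  forall W, (W <= \sum_a W *m V a)%MS -> W = 0.

Definition conj_rep (g : 'M[C]_n) V : {ffun A -> 'M[C]_n} :=
  [ffun a => g *m V a *m invmx g].

Lemma nil_conj g V : g \in unitmx -> nil V -> nil (conj_rep g V).
Proof.
move=> gu nV W WV; apply: (can_inj (mulmxK gu)); rewrite mul0mx.
apply: nV; have := submxMr g WV; rewrite sumsmxMr.
congr (_ <= _)%MS; apply: eq_bigr => a _.
by rewrite ffunE !mulmxA mulmxKV.
Qed.

Lemma nil_quotient U V : (forall a, V a *m proj U = 0) ->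
  nil V <-> nil [ffun a => proj (~: U) *m V a].
Proof.
move=> VU; have VR a : V a *m proj (~: U) = V a.
  by rewrite projC mulmxBr mulmx1 VU subr0.
have WR (X : A -> 'M[C]_n) W :
    (W <= \sum_a X a *m V a)%MS -> W *m proj (~: U) = W.
  move=> /sub_sumsmxP[c ->]; rewrite mulmx_suml; apply: eq_bigr => a _.
  by rewrite -!mulmxA VR.
split=> nV W WV; apply: nV.
  have WW : W *m proj (~: U) = W.
    apply: (WR (fun a => W *m proj (~: U))); move: WV; congr (_ <= _)%MS.
    by apply: eq_bigr => a _; rewrite ffunE mulmxA.
  move: WV; congr (_ <= _)%MS; apply: eq_bigr => a _.
  by rewrite ffunE mulmxA WW.
have WW := WR _ _ WV.
move: WV; congr (_ <= _)%MS; apply: eq_bigr => a _.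
by rewrite ffunE mulmxA WW.
Qed.

Lemma nil_kernel S V : nil V -> (exists u, u \in S) ->
  (forall a, proj S *m V a = V a) -> (forall a, V a *m proj S = V a) ->
  exists z : 'cV[C]_n, [/\ z != 0, proj S *m z = z & forall a, V a *m z = 0].
Proof.
move=> nV [u uS] SV VS.
pose K := cokermx (\sum_a V a)%MS.
have VK a : V a *m K = 0 by apply/eqP; rewrite -submxE (sumsmx_sup a).
have : proj S *m K != 0.
  apply: contraT; rewrite negbK => /eqP SK.
  have /nV/matrixP/(_ u u) : (proj S <= \sum_a proj S *m V a)%MS.
    rewrite (eq_bigr V) => [|a _]; last exact: SV.
    by rewrite submxE SK.
  by rewrite projE uS eqxx mxE mulr1n => /eqP; rewrite oner_eq0.
move=> /matrix0Pn[v [j vj]]; exists (proj S *m col j K); split.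
- by apply/matrix0Pn; exists v, 0; rewrite colE mulmxA -colE mxE.
- by rewrite mulmxA proj_idem.
- by move=> a; rewrite mulmxA VS colE mulmxA VK mul0mx.
Qed.

End Nilpotent.

Section Bridge.
Variables (Q : quiver) (n : nat) (lam : 'I_n -> vertex Q).
Local Notation trep := {ffun arrow Q -> 'M[C]_n}.
Implicit Types (V : trep) (U S : {set 'I_n}).

Definition fib (i : vertex Q) : {set 'I_n} := [set u | lam u == i].

Definition graded_rep V : Prop := forall a u v,
  V a u v != 0 -> lam u = target a /\ lam v = source a.

Definition graded_mx (M : 'M[C]_n) : Prop :=
  forall u v, M u v != 0 -> lam u = lam v.

Definition nil_rep U : set trep := [set V |
  [/\ graded_rep V, forall a, proj U *m V a *m proj U = V a & nil V]].

Lemma graded_mx_comm M : graded_mx M -> forall i, proj (fib i) *m M = M *m proj (fib i).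
Proof. by move=> gM i; apply/proj_commP => u v /gM; rewrite !inE => ->. Qed.

Lemma graded_mxP M : (forall i, proj (fib i) *m M = M *m proj (fib i)) -> graded_mx M.
Proof.
move=> cM u v Muv; have := (proj_commP _ _).2 (cM (lam v)) u v Muv.
by rewrite !inE eqxx => /eqP.
Qed.

Lemma graded_repP V : graded_rep V <->
  forall a, proj (fib (target a)) *m V a *m proj (fib (source a)) = V a.
Proof.
split=> gV a.
  apply/matrixP => u v; rewrite mul_projE proj_mulE !inE.
  have [->|/gV[-> ->]] := eqVneq (V a u v) 0; first by rewrite !if_same.
  by rewrite !eqxx.
move=> u v; rewrite -gV mul_projE proj_mulE !inE.
have [->|_] := eqVneq (lam v) (source a); last by rewrite eqxx.
by have [->|_] := eqVneq (lam u) (target a); rewrite ?eqxx.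
Qed.

Lemma graded_mx_mul M N : graded_mx M -> graded_mx N -> graded_mx (M *m N).
Proof.
move=> /graded_mx_comm gM /graded_mx_comm gN; apply: graded_mxP => i.
by rewrite mulmxA gM -mulmxA gN mulmxA.
Qed.

Lemma graded_mx_add M N : graded_mx M -> graded_mx N -> graded_mx (M + N).
Proof.
move=> /graded_mx_comm gM /graded_mx_comm gN; apply: graded_mxP => i.
by rewrite mulmxDl mulmxDr gM gN.
Qed.

Lemma graded_proj S : graded_mx (proj S).
Proof.
by apply: graded_mxP => i; rewrite !projI finset.setIC.
Qed.

Lemma graded_mx_inv M : graded_mx M -> M \in unitmx -> graded_mx (invmx M).
Proof.
move=> /graded_mx_comm gM uM; apply: graded_mxP => i.
apply: (can_inj (mulKmx uM)); rewrite mulmxA -gM -mulmxA mulmxV// mulmxA mulmxV//.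
by rewrite mul1mx mulmx1.
Qed.

Lemma graded_conj g V : g \in unitmx -> graded_mx g -> graded_rep V ->
  graded_rep (conj_rep g V).
Proof.
move=> gu gg /graded_repP gV; apply/graded_repP => a; rewrite ffunE.
have gg' := graded_mx_comm (graded_mx_inv gg gu).
rewrite !mulmxA (graded_mx_comm gg) -!mulmxA -gg' !mulmxA; congr (_ *m _).
by rewrite -!mulmxA; congr (_ *m _); rewrite mulmxA gV.
Qed.

Variables (e : dimvec Q) (U : {set 'I_n}).
Hypothesis Ue : forall i, #|[set u in U | lam u == i]| = e i.

Definition incl i : 'M[C]_(n, e i) :=
  \matrix_(u, j) (u == enum_val (cast_ord (esym (Ue i)) j))%:R.

Local Notation UI i := [set u in U | lam u == i].

Lemma incl_tr_incl i : (incl i)^T *m incl i = 1%:M.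
Proof.
apply/matrixP => j k; rewrite !mxE.
rewrite (bigD1 (enum_val (cast_ord (esym (Ue i)) j)))//= !mxE eqxx mul1r.
rewrite big1 ?addr0; last by move=> u /negPf uj; rewrite !mxE uj mul0r.
by rewrite (inj_eq enum_val_inj) (inj_eq (@cast_ord_inj _ _ _)).
Qed.

Lemma incl_incl_tr i : incl i *m (incl i)^T = proj (UI i).
Proof.
apply/matrixP => u v; rewrite projE mxE.
have [uU|uU] := boolP (u \in UI i); last first.
  rewrite mulr0n big1// => j _; rewrite !mxE; case: eqP => [uj|_].
    by have := enum_valP (cast_ord (esym (Ue i)) j); rewrite -uj (negPf uU).
  by rewrite mul0r.
rewrite mulr1n (bigD1 (cast_ord (Ue i) (enum_rank_in uU u)))//=.
rewrite !mxE cast_ordK enum_rankK_in// eqxx mul1r [u == v]eq_sym big1 ?addr0//.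
move=> j jn; rewrite !mxE; case: eqP => [uj|]; last by rewrite mul0r.
case/eqP: jn; apply: (@cast_ord_inj _ _ (esym (Ue i))).
by rewrite cast_ordK; apply: enum_val_inj; rewrite enum_rankK_in// -uj.
Qed.

Lemma proj_incl i : proj (UI i) *m incl i = incl i.
Proof. by rewrite -incl_incl_tr -mulmxA incl_tr_incl mulmx1. Qed.

Lemma incl_tr_proj i : (incl i)^T *m proj (UI i) = (incl i)^T.
Proof. by rewrite -incl_incl_tr mulmxA incl_tr_incl mul1mx. Qed.

Lemma projU_incl i : proj U *m incl i = incl i.
Proof.
rewrite -{1}proj_incl mulmxA projI (_ : _ :&: _ = UI i) ?proj_incl//.
by apply/setP => u; rewrite !inE andbA andbb.
Qed.

Lemma incl_tr_projU i : (incl i)^T *m proj U = (incl i)^T.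
Proof.
rewrite -{1}incl_tr_proj -mulmxA projI (_ : _ :&: _ = UI i) ?incl_tr_proj//.
by apply/setP => u; rewrite !inE andbAC andbb.
Qed.

Lemma UI_fib i : UI i = U :&: fib i.
Proof. by apply/setP => u; rewrite !inE. Qed.

Definition total (V : rep e) : trep :=
  [ffun a => incl (target a) *m V a *m (incl (source a))^T].

Definition components V : rep e :=
  fun a => (incl (target a))^T *m V a *m incl (source a).

Lemma totalK : cancel total components.
Proof.
move=> V; apply: functional_extensionality_dep => a; rewrite /components ffunE.
by rewrite !mulmxA incl_tr_incl mul1mx -mulmxA incl_tr_incl mulmx1.
Qed.

Lemma componentsK V : graded_rep V -> (forall a, proj U *m V a *m proj U = V a) ->
  total (components V) = V.
Proof.
move=> /graded_repP gV sV; apply/ffunP => a; rewrite ffunE /components !mulmxA.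
rewrite incl_incl_tr -!mulmxA incl_incl_tr !UI_fib -[proj (U :&: fib (source a))]projI.
by rewrite finset.setIC -projI -[RHS]gV -[in RHS]sV !mulmxA.
Qed.

Lemma total_graded (X : rep e) : graded_rep (total X).
Proof.
apply/graded_repP => a; rewrite ffunE.
have fi i : proj (fib i) *m incl i = incl i.
  rewrite -proj_incl mulmxA projI (_ : _ :&: _ = UI i)//.
  by apply/setP => u; rewrite !inE andbCA andbb.
have fi' i : (incl i)^T *m proj (fib i) = (incl i)^T.
  rewrite -incl_tr_proj -mulmxA projI (_ : _ :&: _ = UI i)//.
  by apply/setP => u; rewrite !inE -andbA andbb.
by rewrite -!mulmxA fi' !mulmxA fi.
Qed.

Lemma total_supp (X : rep e) a : proj U *m total X a *m proj U = total X a.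
Proof. by rewrite ffunE -!mulmxA incl_tr_projU !mulmxA projU_incl. Qed.

End Bridge.

Section NullconeNilpotent.
Variables (Q : quiver) (n : nat) (lam : 'I_n -> vertex Q).
Variables (e : dimvec Q) (U : {set 'I_n}).
Hypothesis Ue : forall i, #|[set u in U | lam u == i]| = e i.
Implicit Types (X : rep e) (W : 'M[C]_n).

Local Notation E := (incl Ue).
Local Notation tot := (total Ue).
Local Notation UI i := [set u in U | lam u == i].

Lemma incl_tr_incl0 i j : i != j -> (E i)^T *m E j = 0.
Proof.
move=> ij; rewrite -[(E i)^T]incl_tr_proj -[E j]proj_incl mulmxA.
rewrite -(mulmxA _ (proj (UI i))) projI.
rewrite (_ : _ :&: _ = finset.set0) ?proj0 ?mulmx0 ?mul0mx//.
apply/setP => u; rewrite !inE; case: eqP => [->|_]; last by rewrite andbF.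
by rewrite (negPf ij) !andbF.
Qed.

Lemma block_incl (h : forall i, 'M[C]_(e i)) i :
  (\sum_j E j *m h j *m (E j)^T) *m E i = E i *m h i.
Proof.
rewrite mulmx_suml (bigD1 i)//= -mulmxA incl_tr_incl mulmx1 big1 ?addr0// => j ji.
by rewrite -mulmxA incl_tr_incl0// mulmx0.
Qed.

Lemma incl_tr_block (h : forall i, 'M[C]_(e i)) i :
  (E i)^T *m (\sum_j E j *m h j *m (E j)^T) = h i *m (E i)^T.
Proof.
rewrite mulmx_sumr (bigD1 i)//= !mulmxA incl_tr_incl mul1mx big1 ?addr0// => j ji.
by rewrite !mulmxA incl_tr_incl0 1?eq_sym// !mul0mx.
Qed.

Lemma polymx_total a : polymx (fun x : rep_space e => tot (rep_of_point x) a).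
Proof.
rewrite (_ : (fun x => _) = fun x => (E (target a) *m rep_of_point x a) *m (E (source a))^T).
  apply: polymx_mul; last exact: polymx_const.
  apply: polymx_mul; first exact: polymx_const.
  move=> i j; rewrite (_ : (fun x => _) = fun x => x
    (index_of_ord (enum_rank (Tagged (fun a => _) (i, j) : rep_coord e)))).
    exact: polyfun_coord.
  by apply/funext => x; rewrite mxE.
by apply/funext => x; rewrite ffunE.
Qed.

Lemma polymx_lin_mulmxr (N : nat) (M : affine_space N -> 'M[C]_n) :
  polymx M -> polymx (fun x => lin_mulmxr (M x) : 'M_(n * n)).
Proof.
move=> pM i j; case/mxvec_indexP: j => k l.
pose R := fun x => (vec_mx (delta_mx 0 i) : 'M[C]_n) *m M x.
rewrite (_ : (fun x => _) = fun x => R x k l); first exact: (@polymx_mul N _ _ _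
  (fun=> _) M (@polymx_const N _ _ _) pM k l).
by apply/funext => x; rewrite /lin_mulmxr /lin_mx /lin1_mx mxE /= mxvecE.
Qed.

(* A nonzero [W = \sum_a c a *m W *m V a] makes the linear operator
   [Z |-> \sum_a c a *m Z *m V a - Z] singular on the whole orbit of [V], while
   it is invertible at [0]. *)
Lemma nullcone_nil x : nullcone e x -> nil (tot (rep_of_point x)).
Proof.
move=> /smallest_closedP Nx W /sub_sumsmxP[c WE]; apply/eqP; apply: contraT => W0.
pose M X : 'M[C]_(n * n) :=
  \sum_a lin_mulmx (c a) *m lin_mulmxr (tot X a) + (-1) *: 1%:M.
have ME X Z : mxvec Z *m M X = mxvec (\sum_a c a *m Z *m tot X a - Z).
  rewrite mulmxDr mulmx_sumr linearB linear_sum /= -scalemxAr mulmx1 scaleN1r.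
  congr (_ + _); apply: eq_bigr => a _.
  by rewrite mulmxA !mul_vec_lin.
have pF : polyfun (fun y : rep_space e => \det (M (rep_of_point y))).
  apply: polymx_det; apply: polymx_add; last exact: polymx_const.
  apply: polymx_sum => a; apply: polymx_mul; first exact: polymx_const.
  exact/polymx_lin_mulmxr/polymx_total.
have : \det (M (fun=> 0)) = 0.
  rewrite -[X in M X](@point_of_repK _ e); apply: (Nx _ pF) => _ [g gu ->].
  rewrite point_of_repK; apply/eqP/det0P.
  pose G := \sum_j E j *m invmx (g j) *m (E j)^T.
  have GE i : G *m E i = E i *m invmx (g i) by exact: block_incl.
  have EG i : (E i)^T *m G = invmx (g i) *m (E i)^T by exact: incl_tr_block.
  exists (mxvec (W *m G)).
    rewrite mxvec_eq0; apply: contra_neq W0 => WG0.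
    have WE0 i : W *m E i = 0.
      rewrite -[LHS]mulmx1 -(mulVmx (gu i)) mulmxA -(mulmxA W) -GE mulmxA WG0.
      by rewrite !mul0mx.
    rewrite WE big1// => a _.
    by rewrite ffunE !mulmxA -(mulmxA (c a)) WE0 mulmx0 !mul0mx.
  rewrite ME; apply/eqP; rewrite mxvec_eq0 subr_eq0; apply/eqP.
  rewrite [in RHS]WE mulmx_suml; apply: eq_bigr => a _.
  rewrite !ffunE /base_change !mulmxA -!mulmxA EG.
  congr (_ *m (_ *m _)); rewrite !mulmxA GE.
  by rewrite -!mulmxA (mulmxA (invmx (g (target a)))) mulVmx// mul1mx.
move=> /eqP/det0P[v v0 vM]; case/eqP: v0.
rewrite -[v]vec_mxK; apply/eqP; rewrite mxvec_eq0; apply/eqP.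
move: vM; rewrite -[v in v *m _]vec_mxK ME big1 => [|a _].
  by rewrite sub0r => /eqP; rewrite mxvec_eq0 oppr_eq0 => /eqP.
by rewrite ffunE mulmx0 mul0mx mulmx0.
Qed.

Lemma block_conj (g h : 'M[C]_n) : g *m h = 1%:M ->
  (forall i, proj (UI i) *m g = g *m proj (UI i)) ->
  forall i, (E i)^T *m g *m E i *m ((E i)^T *m h *m E i) = 1%:M.
Proof.
move=> gh cg i; rewrite !mulmxA -(mulmxA _ (E i) (E i)^T) incl_incl_tr.
rewrite -(mulmxA _ g) -cg mulmxA incl_tr_proj -(mulmxA _ g) gh mulmx1.
exact: incl_tr_incl.
Qed.

Lemma base_change_comp (g h : forall i, 'M[C]_(e i)) X :
  (forall i, g i \in unitmx) -> (forall i, h i \in unitmx) ->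
  base_change g (base_change h X) = base_change (fun i => g i *m h i) X.
Proof.
move=> gu hu; apply: functional_extensionality_dep => a.
rewrite /base_change (_ : invmx (_ *m _) = invmx (h (source a)) *m invmx (g (source a))).
  by rewrite !mulmxA.
by apply: invmx_eq; rewrite mulmxA mulmxK// mulmxV.
Qed.

End NullconeNilpotent.

Section NilpotentNullcone.
Variables (Q : quiver) (n : nat) (lam : 'I_n -> vertex Q).
Variables (e : dimvec Q) (U : {set 'I_n}).
Hypothesis Ue : forall i, #|[set u in U | lam u == i]| = e i.

Local Notation E := (incl Ue).
Local Notation UI i := [set u in U | lam u == i].
Implicit Types X : rep e.

Section Degeneration.
Variable F : rep_space e -> C.
Hypothesis pF : polyfun F.

Let vanishes X := forall g : forall i, 'M[C]_(e i), (forall i, g i \in unitmx) ->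
  F (point_of_rep (base_change g X)) = 0.

Let vanishes_conj (V : {ffun arrow Q -> 'M[C]_n}) (g h : 'M[C]_n) :
  g *m h = 1%:M -> graded_mx lam g -> proj U *m g = g *m proj U ->
  graded_rep lam V -> (forall a, proj U *m V a *m proj U = V a) ->
  vanishes (components Ue V) ->
  vanishes (components Ue [ffun a => g *m V a *m h]).
Proof.
move=> gh gg gU gV sV van k ku.
have cg i : proj (UI i) *m g = g *m proj (UI i).
  by rewrite UI_fib -projI -mulmxA graded_mx_comm// !mulmxA gU.
have inv := block_conj Ue gh cg.
have gu i : (E i)^T *m g *m E i \in unitmx by have [] := mulmx1_unit (inv i).
have := van (fun i => k i *m ((E i)^T *m g *m E i)) _.
rewrite -base_change_comp//.
rewrite (_ : base_change _ (components Ue V) = components Ue [ffun a => g *m V a *m h]).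
  by apply=> i; rewrite unitmx_mul ku gu.
apply: functional_extensionality_dep => a; rewrite /base_change (invmx_eq (inv _)).
rewrite /components ffunE -[in RHS](componentsK Ue gV sV) ffunE /components.
have gE i : E i *m ((E i)^T *m g *m E i) = g *m E i.
  by rewrite !mulmxA incl_incl_tr cg -mulmxA proj_incl.
have gE' i : (E i)^T *m g *m E i *m (E i)^T = (E i)^T *m g.
  by rewrite -(mulmxA _ (E i)) incl_incl_tr -mulmxA -cg mulmxA incl_tr_proj.
by rewrite !mulmxA gE'.
Qed.

Lemma nil_degenerates k (S : {set 'I_n}) (V : {ffun arrow Q -> 'M[C]_n}) :
  #|S| = k -> S \subset U -> nil_rep lam S V -> vanishes (components Ue V) ->
  F (point_of_rep ((fun=> 0) : rep e)) = 0.
Proof.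
elim: k S V => [|k IH] S V Sk SU [gV sV nV] van.
  have V0 a : V a = 0.
    by rewrite -sV (cards0_eq Sk) proj0 mul0mx mul0mx.
  have := van (fun=> 1%:M) (fun i => unitmx1 _ _).
  congr (F (point_of_rep _) = _); apply: functional_extensionality_dep => a.
  by rewrite /base_change /components V0 mulmx0 mul0mx mulmx0 mul0mx.
have SV a : proj S *m V a = V a by rewrite -sV !mulmxA proj_idem.
have VS a : V a *m proj S = V a by rewrite -sV -!mulmxA proj_idem.
have exS : exists u, u \in S by apply/card_gt0P; rewrite Sk.
have [y [y0 Sy Vy]] := nil_kernel nV exS SV VS.
have [u0 [j yu]] := matrix0Pn _ y0; rewrite (ord1 j) {j} in yu.
have VsE a : V a *m proj (fib lam (source a)) = V a.
  by rewrite -[in LHS]((graded_repP lam V).1 gV) -mulmxA proj_idem ((graded_repP lam V).1 gV).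
have u0S : u0 \in S by apply: contraNT yu => /(proj_idP _ _).2 ->.
pose z : 'cV[C]_n := (y u0 0)^-1 *: (proj (fib lam (lam u0)) *m y).
have zE v : z v 0 = if lam v == lam u0 then (y u0 0)^-1 * y v 0 else 0.
  by rewrite mxE proj_mulE !inE; case: eqP; rewrite ?mulr0.
have zu : z u0 0 = 1 by rewrite zE eqxx mulVf.
have Vz a : V a *m z = 0.
  rewrite -scalemxAr mulmxA -(VsE a) -[V a *m _ *m _]mulmxA projI.
  have [<-|sl] := eqVneq (source a) (lam u0).
    by rewrite finset.setIid VsE Vy scaler0.
  rewrite (_ : _ :&: _ = finset.set0) ?proj0 ?mulmx0 ?mul0mx ?scaler0//.
  apply/setP => v; rewrite !inE; case: eqP => // ->.
  exact: negPf.
clearbody z.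
pose N : 'M[C]_n := (z - delta_mx u0 0) *m delta_mx 0 u0.
have NE w v : N w v != 0 -> [/\ v = u0, w \in S & lam w = lam u0].
  rewrite mxE big_ord1 !mxE [z _ _]zE eqxx /= [v == u0]eq_sym andbT.
  have [<-|] := eqVneq u0 v; last by rewrite mulr0 eqxx.
  rewrite mulr1; have [->|wu] := eqVneq w u0; first by [].
  rewrite subr0; have [lw|_] := eqVneq (lam w) (lam u0); last by rewrite eqxx.
  rewrite mulf_eq0 negb_or => /andP[_ yw]; split=> //.
  by apply: contraNT yw => /(proj_idP _ _).2 ->.
have N2 : N *m N = 0.
  rewrite /N mulmxA -(mulmxA _ _ (z - _)) -rowE.
  rewrite (_ : row u0 _ = 0) ?mulmx0 ?mul0mx//.
  by apply/rowP => k0; rewrite (ord1 k0) !mxE [z _ _]zu !eqxx subrr.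
pose g := 1%:M - N; pose h := 1%:M + N.
have gh : g *m h = 1%:M.
  by rewrite mulmxBl !mulmxDr !mul1mx !mulmx1 N2 addr0 addrK.
have gu : g \in unitmx by have [] := mulmx1_unit gh.
have gE w v : g w v != 0 -> w = v \/ N w v != 0.
  rewrite !mxE; have [->|_] := eqVneq w v; first by left.
  by rewrite sub0r oppr_eq0; right.
have gg : graded_mx lam g by move=> w v /gE[->//|/NE[-> _ ->]].
have gcomm (B : {set 'I_n}) : S \subset B -> proj B *m g = g *m proj B.
  move=> /fintype.subsetP SB; apply/proj_commP => w v /gE[->//|/NE[-> wS _]].
  by rewrite !SB.
pose V' : {ffun arrow Q -> 'M[C]_n} := [ffun a => g *m V a *m h].
have V'E : V' = conj_rep g V.
  by apply/ffunP => a; rewrite !ffunE (invmx_eq gh).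
have gV' : graded_rep lam V' by rewrite V'E; exact: graded_conj.
have SV' a : proj S *m V' a = V' a.
  by rewrite ffunE !mulmxA gcomm// -(mulmxA g) SV.
have V'S a : V' a *m proj S = V' a.
  rewrite V'E ffunE; apply: (can_inj (mulmxK gu)); rewrite mulmxKV//.
  by rewrite -(mulmxA _ (proj S)) gcomm// mulmxA mulmxKV// -mulmxA VS.
have sUV (B : {ffun arrow Q -> 'M[C]_n}) : (forall a, proj S *m B a = B a) ->
    (forall a, B a *m proj S = B a) -> forall a, proj U *m B a *m proj U = B a.
  move=> SB BS a; rewrite -SB -BS !mulmxA projI -!mulmxA projI.
  by rewrite (finset.setIidPr SU) (finset.setIidPl SU).
have van' : vanishes (components Ue V').
  by apply: vanishes_conj => //; [exact: gcomm|exact: sUV].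
have V'u a : V' a *m proj [set u0]%SET = 0.
  have hd : h *m (delta_mx u0 0 : 'cV_n) = z.
    rewrite mulmxDl mul1mx /N -mulmxA mul_delta_mx (_ : delta_mx 0 0 = 1%:M).
      by rewrite mulmx1 addrC subrK.
    by apply/matrixP => k0 l0; rewrite !ord1 !mxE !eqxx.
  by rewrite -delta_proj_mul mulmxA ffunE -(mulmxA _ h) hd -(mulmxA g) Vz mulmx0 mul0mx.
have nV' : nil V' by rewrite V'E; exact: nil_conj.
have V'R a : V' a *m proj (~: [set u0]%SET) = V' a.
  by rewrite projC mulmxBr mulmx1 V'u subr0.
pose V'' : {ffun arrow Q -> 'M[C]_n} := [ffun a => proj (~: [set u0]%SET) *m V' a].
have gV'' : graded_rep lam V''.
  by move=> a v w; rewrite ffunE proj_mulE; case: ifP => [_ /gV'|]; rewrite ?eqxx.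
have SD : (S :\ u0 = ~: [set u0] :&: S)%SET.
  by apply/setP => v; rewrite !inE.
apply: (IH (S :\ u0)%SET V'').
- by move: Sk; rewrite (cardsD1 u0) u0S => -[].
- exact: fintype.subset_trans (subD1set _ _) SU.
- have V''E a : V'' a = proj (S :\ u0)%SET *m V' a.
    by rewrite SD -projI ffunE -mulmxA SV'.
  split=> //; last exact: ((nil_quotient V'u).1 nV').
  move=> a; rewrite V''E mulmxA proj_idem SD finset.setIC -[X in _ *m _ *m X]projI.
  by rewrite -!mulmxA (mulmxA (V' a)) V'S V'R.
move=> k0 ku.
pose R : rep e := fun a => (E (target a))^T *m (proj [set u0]%SET *m V' a) *m E (source a).
apply: (@polyfun_line0 _ F _ (point_of_rep (base_change k0 R))) => // t t0.
pose D (r : C) := proj (~: [set u0]%SET) + r *: proj [set u0]%SET.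
have DD : D t *m D t^-1 = 1%:M.
  rewrite mulmxDl !mulmxDr -!scalemxAl -!scalemxAr !projI finset.setICr finset.setIC.
  rewrite finset.setICr !finset.setIid proj0 !scaler0 addr0 add0r scalerA divff// scale1r.
  by rewrite projC subrK.
have gD : graded_mx lam (D t).
  apply: graded_mx_add; first exact: graded_proj.
  by move=> v w; rewrite mxE mulf_eq0 negb_or => /andP[_]; exact: graded_proj.
have UD : proj U *m D t = D t *m proj U.
  by rewrite mulmxDl mulmxDr -scalemxAl -scalemxAr !projI ![U :&: _]finset.setIC.
have := vanishes_conj DD gD UD gV' (sUV _ SV' V'S) van' ku.
congr (F _ = _); apply/funext => i; rewrite /point_of_rep.
set c := enum_val _; case: c => a [r s] /=.
transitivity ((base_change k0 (components Ue V'') a + t *: base_change k0 R a) r s).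
  2: by rewrite !mxE.
have V'D : V' a *m D t^-1 = V' a.
  by rewrite mulmxDr -scalemxAr V'u scaler0 addr0 V'R.
congr (fun_of_matrix _ r s); rewrite /base_change /components /R !ffunE in V'D *.
rewrite scalemxAl scalemxAr -mulmxDl -mulmxDr; congr (_ *m _ *m _).
rewrite scalemxAl scalemxAr -mulmxDl -mulmxDr; congr (_ *m _ *m _).
by rewrite -(mulmxA (D t)) V'D scalemxAl -mulmxDl.
Qed.

End Degeneration.

Lemma nil_nullcone x : nil (total Ue (rep_of_point x)) -> nullcone e x.
Proof.
move=> nx; apply/smallest_closedP => F pF Fx.
apply: (nil_degenerates pF (S := U) erefl (fintype.subxx _) (V := total Ue (rep_of_point x))).
  by split=> //; [exact: total_graded|exact: total_supp].
move=> g gu; rewrite totalK; apply: Fx; exists g => //.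
Qed.

Lemma nullcone_nilP x : nullcone e x <-> nil (total Ue (rep_of_point x)).
Proof. by split; [exact: nullcone_nil|exact: nil_nullcone]. Qed.

End NilpotentNullcone.

Lemma pfmx_const (P : cspace) m n (M : 'M[C]_(m, n)) : algmx (@pf P) (fun=> M).
Proof. exact: (algmx_const (pf_alg P)). Qed.

Lemma pfmx_mul (P : cspace) m n p (M : P -> 'M[C]_(m, n)) (M' : P -> 'M[C]_(n, p)) :
  algmx (@pf P) M -> algmx (@pf P) M' -> algmx (@pf P) (fun x => M x *m M' x).
Proof. exact: (algmx_mul (pf_alg P)). Qed.

Lemma pfmx_add (P : cspace) m n (M M' : P -> 'M[C]_(m, n)) :
  algmx (@pf P) M -> algmx (@pf P) M' -> algmx (@pf P) (fun x => M x + M' x).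
Proof. exact: (algmx_add (pf_alg P)). Qed.

Lemma basic_mx_eqs (P : cspace) (I : Type) m n (M M' : I -> P -> 'M[C]_(m, n)) :
  (forall i, algmx (@pf P) (M i)) -> (forall i, algmx (@pf P) (M' i)) ->
  basic [set x | forall i, M i x = M' i x].
Proof.
move=> pM pM'.
apply: (basic_ext _ (@basic_eq0s P (I * ('I_m * 'I_n))%type
  (fun c x => M c.1 x c.2.1 c.2.2 - M' c.1 x c.2.1 c.2.2) _)); last first.
  by move=> c; apply: pf_sub; [exact: pM|exact: pM'].
move=> x; split=> /= [E i|E c]; last by rewrite E subrr.
by apply/matrixP => u v; have /subr0_eq := E (i, (u, v)).
Qed.

Lemma regmap_mx (P : cspace) (X : set P) m n (M : P -> 'M[C]_(m, n)) :
  algmx (reg X) M -> @regmap P X (matrix_cspace m n) M.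
Proof. by move=> rM [i j]; exact: rM. Qed.

Lemma regmap_ffun (P P' : cspace) (X : set P) (A : finType) (F : P -> {ffun A -> P'}) :
  (forall a, regmap X (fun x => F x a)) -> @regmap P X (ffun_cspace P' A) F.
Proof. by move=> rF [a j]; exact: rF. Qed.

Lemma algmx_pf_reg (P : cspace) (X : set P) m n (M : P -> 'M[C]_(m, n)) :
  algmx (@pf P) M -> algmx (reg X) M.
Proof. by move=> pM i j; exact/pf_reg/pM. Qed.

Lemma algmx_app (A : finType) m n (a : A) :
  algmx (@pf (ffun_cspace (matrix_cspace m n) A)) (fun V => V a).
Proof. by move=> i j; exact: (@pf_co (ffun_cspace (matrix_cspace m n) A) (a, (i, j))). Qed.

Lemma algmx_id m n : algmx (@pf (matrix_cspace m n)) id.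
Proof. by move=> i j; exact: (@pf_co (matrix_cspace m n) (i, j)). Qed.

Lemma pf_fst (P P' : cspace) j : @pf (prod_cspace P P') (fun x => co j x.1).
Proof. exact: (@pf_co (prod_cspace P P') (inl j)). Qed.

Lemma pf_snd (P P' : cspace) j : @pf (prod_cspace P P') (fun x => co j x.2).
Proof. exact: (@pf_co (prod_cspace P P') (inr j)). Qed.

Lemma polyfun_pf n p : @polyfun n p -> @pf (affine_cspace n) p.
Proof.
elim=> [c|i|q r _ IHq _ IHr|q r _ IHq _ IHr].
- exact: pf_const.
- apply: pf_ext (@pf_co (affine_cspace n) (ord_of_index i)) => x.
  by rewrite /= /affine_co ord_of_indexK.
- exact: pf_add.
- exact: pf_mul.
Qed.

Lemma basic_zariski_closed n (Z : set (affine_space n)) :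
  closedv Z -> @basic (affine_cspace n) Z.
Proof.
rewrite /closedv /openv /= setCK => -[S Sp ->].
by apply: basic_closed => p /Sp; exact: polyfun_pf.
Qed.

Section NilRepClass.
Variables (Q : quiver) (n : nat) (lam : 'I_n -> vertex Q).
Local Notation reps := (ffun_cspace (matrix_cspace n n) (arrow Q)).

Lemma basic_graded_rep : basic (@graded_rep Q n lam : set reps).
Proof.
have := @basic_mx_eqs reps (arrow Q) _ _
  (fun a V => proj (fib lam (target a)) *m V a *m proj (fib lam (source a)))
  (fun a V => V a) _ _.
move=> H; apply: (basic_ext _ (H _ _)).
- by move=> V; apply: iff_sym; exact: graded_repP.
- move=> a; apply: pfmx_mul; last exact: pfmx_const.
  by apply: pfmx_mul; [exact: pfmx_const|exact: algmx_app].
- by move=> a; exact: algmx_app.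
Qed.

Lemma basic_supp (S : {set 'I_n}) :
  basic ([set V : {ffun arrow Q -> 'M[C]_n} | forall a,
      proj S *m V a *m proj S = V a] : set reps).
Proof.
apply: (@basic_mx_eqs reps (arrow Q) _ _
  (fun a V => proj S *m V a *m proj S) (fun a V => V a)).
- move=> a; apply: pfmx_mul; last exact: pfmx_const.
  by apply: pfmx_mul; [exact: pfmx_const|exact: algmx_app].
- by move=> a; exact: algmx_app.
Qed.

Variables (e : dimvec Q) (U : {set 'I_n}).
Hypothesis Ue : forall i, #|[set u in U | lam u == i]| = e i.

Let pf_point (j : 'I_#|rep_coord e|) :
  @pf reps (fun V => @co (affine_cspace #|rep_coord e|) j
                      (point_of_rep (components Ue V))).
Proof.
rewrite /= /affine_co /point_of_rep; case: (enum_val _) => a [r s] /=.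
suff : algmx (@pf reps) (fun V => components Ue V a) by apply.
apply: pfmx_mul; last exact: pfmx_const.
by apply: pfmx_mul; [exact: pfmx_const|exact: algmx_app].
Qed.

Let nil_repE : (nil_rep lam U : set reps) = (@graded_rep Q n lam : set reps) `&`
  ([set V : {ffun arrow Q -> 'M[C]_n} | forall a, proj U *m V a *m proj U = V a] `&`
   [set V | nullcone e (point_of_rep (components Ue V))]).
Proof.
apply/seteqP; split=> V /=.
  move=> [gV sV nV]; split=> //; split=> //.
  by apply/(nullcone_nilP Ue); rewrite point_of_repK componentsK.
move=> [gV [sV /(nullcone_nilP Ue)]].
by rewrite point_of_repK componentsK.
Qed.

Lemma basic_nil_rep : basic (nil_rep lam U : set reps).
Proof.
rewrite nil_repE; apply: basicI; first exact: basic_graded_rep.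
apply: basicI; first exact: basic_supp.
apply: (@basic_preimage reps (affine_cspace #|rep_coord e|)
  (fun V => point_of_rep (components Ue V)) (nullcone e)).
  exact: pf_point.
exact/basic_zariski_closed/nullcone_closed.
Qed.

Lemma cls_nil_rep : cls (nil_rep lam U : set reps) = motive (nullcone_variety e).
Proof.
have bN : @basic (affine_cspace #|rep_coord e|) (nullcone e).
  exact/basic_zariski_closed/nullcone_closed.
transitivity (@cls (affine_cspace #|rep_coord e|) (nullcone e)).
  apply: (@cls_iso reps (affine_cspace #|rep_coord e|) _ _
    (fun V => point_of_rep (components Ue V))
    (fun x => total Ue (rep_of_point x))) => //.
  - exact: basic_nil_rep.
  - by move=> j; exact: pf_reg.
  - apply: regmap_ffun => a; apply/regmap_mx/algmx_pf_reg => u v.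
    exact/polyfun_pf/polymx_total.
  - move=> V [gV sV nV]; rewrite point_of_repK componentsK//; split=> //.
    by apply/(nullcone_nilP Ue); rewrite point_of_repK componentsK.
  - move=> x Nx; rewrite totalK rep_of_pointK; split=> //; split.
    + exact: total_graded.
    + exact: total_supp.
    + exact/(nullcone_nilP Ue).
apply: (@cls_models (affine_cspace #|rep_coord e|) _ (nullcone_variety e) sval bN).
have := @subspace_models (affine_cspace #|rep_coord e|) _ _ (nullcone e) _
  (affine_space_models #|rep_coord e|).
by rewrite setTI; exact.
Qed.

End NilRepClass.

(** * Classes of injective maps *)

Section Frames.
Variables (Q : quiver) (n : nat) (lam : 'I_n -> vertex Q).
Local Notation ecol v := (delta_mx v 0 : 'cV[C]_n).
Local Notation erow v := (delta_mx 0 v : 'rV[C]_n).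
Implicit Types (U S : {set 'I_n}) (f g : 'M[C]_n) (s : 'S_n).

Definition inj_mx U S : set 'M[C]_n := [set f |
  [/\ graded_mx lam f, f *m proj U = f, proj S *m f = f &
      exists L, L *m f = proj U]].

Definition frame s U f : 'M[C]_n := f + (perm_mx s)^T *m proj (~: U).

Definition label_preserving s : bool := [forall v, lam (s v) == lam v].

Definition pivot s U f : C :=
  if label_preserving s then \det (frame s U f) else 0.

Lemma pivot_neq0 s U f : pivot s U f != 0 <->
  (forall v, lam (s v) = lam v) /\ frame s U f \in unitmx.
Proof.
rewrite /pivot unitmxE unitfE; case: ifP => [/fintype.forallP ls|nls].
  by split=> [->|[]//]; split=> // v; exact/eqP.
rewrite eqxx; split=> // -[ls _]; suff : label_preserving s by rewrite nls.
by apply/fintype.forallP => v; rewrite ls.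
Qed.

Lemma mul_perm_trE m (M : 'M[C]_(m, n)) s i j :
  (M *m (perm_mx s)^T) i j = M i (s j).
Proof.
rewrite mxE (bigD1 (s j))//= big1 ?addr0 => [|k kj].
  by rewrite !mxE eqxx mulr1.
by rewrite !mxE eq_sym (negPf kj) mulr0.
Qed.

Lemma graded_perm s : (forall v, lam (s v) = lam v) -> graded_mx lam (perm_mx s)^T.
Proof.
move=> ls u v; rewrite !mxE; have [<- _|_] := eqVneq (s v) u; first exact: ls.
by rewrite eqxx.
Qed.

Lemma graded_frame s U f : (forall v, lam (s v) = lam v) -> graded_mx lam f ->
  graded_mx lam (frame s U f).
Proof.
move=> ls gf; apply: graded_mx_add => //.
by apply: graded_mx_mul; [exact: graded_perm|exact: graded_proj].
Qed.

Lemma frame_proj s U f : f *m proj U = f -> frame s U f *m proj U = f.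
Proof.
move=> fU; rewrite mulmxDl fU -mulmxA projI finset.setIC finset.setICr proj0.
by rewrite mulmx0 addr0.
Qed.

Lemma unit_frame_inj s U f : f *m proj U = f -> frame s U f \in unitmx ->
  exists L, L *m f = proj U.
Proof.
move=> fU gu; exists (invmx (frame s U f)).
by rewrite -{2}(frame_proj s fU) mulmxA mulVmx// mul1mx.
Qed.

Lemma replace_col_unit (y : 'cV[C]_n) w : y w 0 != 0 ->
  1%:M + (y - ecol w) *m erow w \in unitmx.
Proof.
move=> yw; set N := _ *m _.
have NN : N *m N = (y w 0 - 1) *: N.
  rewrite {1}/N -mulmxA (mulmxA _ (y - _)) -rowE.
  rewrite (_ : row w _ = (y w 0 - 1)%:M).
    by rewrite mul_scalar_mx -scalemxAr.
  by apply/matrixP => i j; rewrite !ord1 !mxE !eqxx.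
suff /mulmx1_unit[] : (1%:M + N) *m (1%:M - (y w 0)^-1 *: N) = 1%:M by [].
rewrite mulmxDl !mulmxBr !mul1mx mulmx1 -scalemxAr NN scalerA mulrBr mulVf// mulr1.
by rewrite scalerBl scale1r opprB [N + _]addrC subrK subrK.
Qed.

Section Peel.
Variables (U : {set 'I_n}) (u : 'I_n).
Hypothesis uU : u \notin U.

Let U' := (u |: U)%SET.

Let UU' : proj U' *m proj U = proj U.
Proof.
rewrite projI; congr proj; apply/setP => v; rewrite !inE.
by case: (v \in U); rewrite ?orbT ?andbF.
Qed.

Lemma inj_mx_restrict S f : inj_mx U' S f -> inj_mx U S (f *m proj U).
Proof.
move=> [gf fU Sf [L Lf]]; split.
- by apply: graded_mx_mul => //; exact: graded_proj.
- by rewrite -mulmxA proj_idem.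
- by rewrite mulmxA Sf.
- by exists L; rewrite mulmxA Lf UU'.
Qed.

Lemma inj_mx_new_coord S f s : inj_mx U' S f -> frame s U (f *m proj U) \in unitmx ->
  exists2 w, w \notin U &
    (invmx (frame s U (f *m proj U)) *m f *m ecol u : 'cV_n) w 0 != 0.
Proof.
set g := frame _ _ _; move=> [gf fU Sf [L Lf]] gu; set y := _ *m _.
have fUU : f *m proj U *m proj U = f *m proj U by rewrite -mulmxA proj_idem.
apply: contrapT => noy.
have yU : proj U *m y = y.
  apply/proj_idP => w j wU; apply/eqP; apply: contrapT => /negP yw; apply: noy.
  by exists w => //; rewrite -(ord1 j).
have : f *m (ecol u - y) = 0.
  rewrite mulmxBr -yU mulmxA -[f *m proj U](frame_proj s fUU) -/g -mulmxA yU.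
  by rewrite /y !mulmxA mulmxV// mul1mx subrr.
move=> /(congr1 (mulmx L)); rewrite mulmxA Lf mulmx0.
move=> /matrixP/(_ u 0); rewrite proj_mulE !inE eqxx /= -yU !mxE !eqxx.
rewrite big1 ?subr0 => [/eqP|v _]; first by rewrite oner_eq0.
by rewrite projE (negPf uU) mulr0n mul0r.
Qed.

Lemma frame_exchange s w f : w \notin U -> f *m proj U' = f ->
  frame (tperm u w * s) U' f *m (perm_mx (tperm u w))^T =
  frame s U (f *m proj U) + (f *m ecol u -
    frame s U (f *m proj U) *m ecol w) *m erow w.
Proof.
move=> wU fU; apply/matrixP => i j.
rewrite mul_perm_trE [RHS]mxE [X in _ + X]mxE big_ord1 [(erow w) 0 j]mxE eqxx /=.
rewrite [X in _ + X * _]mxE [X in (_ + X) * _]mxE.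
have mulecol (M : 'M[C]_n) v : (M *m ecol v) i ord0 = M i v by rewrite -colE mxE.
rewrite !mulecol.
have frE s0 U0 f0 k : frame s0 U0 f0 i k =
    f0 i k + (if k \in U0 then 0 else (s0 k == i)%:R).
  by rewrite [LHS]mxE mul_projE !mxE !inE; case: (k \in U0).
have f0 k : k \notin U' -> f i k = 0 by move=> kU; apply: ((id_projP _ _).2 fU).
rewrite !frE !mul_projE permM.
have [->|jw] := eqVneq j w.
  by rewrite tpermR (negPf wU) setU11 !add0r mulr1 addr0 addrC subrK.
rewrite mulr0 addr0; have [jE|ju] := eqVneq j u.
  rewrite jE in jw *; rewrite tpermL tpermR (negPf uU) add0r.
  have wU' : w \notin U' by rewrite in_setU1 negb_or eq_sym jw wU.
  by rewrite f0// (negPf wU') add0r.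
rewrite tpermD 1?eq_sym// tpermD 1?eq_sym// in_setU1 (negPf ju) /=.
by case: ifPn => jU; rewrite ?addr0// f0 ?add0r// in_setU1 negb_or ju.
Qed.

End Peel.

Lemma inj_mx_pivot U S f : inj_mx U S f -> exists s, pivot s U f != 0.
Proof.
suff main : inj_mx U S f -> exists s, (forall v, lam (s v) = lam v) /\ frame s U f \in unitmx.
  by move=> /main[s sf]; exists s; apply/pivot_neq0.
move En: #|U| => k; elim: k U En f => [|k IH] U Uk f.
  move=> [_ fU _ _]; exists 1%g; split=> [v|]; first by rewrite perm1.
  rewrite /frame -fU (cards0_eq Uk) proj0 mulmx0 add0r finset.setC0 projT mulmx1.
  by rewrite unitmx_tr unitmx_perm.
have [u uU] : exists u, u \in U by apply/card_gt0P; rewrite Uk.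
have u0 : u \notin (U :\ u)%SET by rewrite !inE eqxx.
move: Uk; rewrite (cardsD1 u) uU => -[Uk]; rewrite -(finset.setD1K uU).
move: (U :\ u)%SET u0 Uk => {uU}U uU Uk inj_f.
have [s [ls gu]] := IH _ Uk _ (inj_mx_restrict inj_f).
have [w wU yw] := inj_mx_new_coord uU inj_f gu.
have [gf fU _ _] := inj_f.
set g := frame _ _ _ in gu yw.
exists (tperm u w * s)%g.
have gg : graded_mx lam g.
  by apply: graded_frame => //; apply: graded_mx_mul => //; exact: graded_proj.
have luw : lam w = lam u.
  have : graded_mx lam (invmx g *m f).
    by apply: graded_mx_mul => //; exact: graded_mx_inv.
  by apply; rewrite -colE mxE in yw.
split=> [v|].
  by rewrite permM ls; case: tpermP => [->|->|].
have := frame_exchange uU s wU fU.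
rewrite -/g (_ : f *m _ - _ = g *m (invmx g *m f *m ecol u - ecol w)); last first.
  by rewrite mulmxBr !mulmxA mulmxV// mul1mx.
rewrite -mulmxA -[X in X + _]mulmx1 -mulmxDr => gE.
have : g *m (1%:M + (invmx g *m f *m ecol u - ecol w) *m erow w) \in unitmx.
  by rewrite unitmx_mul gu replace_col_unit.
by rewrite -gE unitmx_mul => /andP[].
Qed.

Lemma pf_pivot s U : @pf (matrix_cspace n n) (pivot s U).
Proof.
rewrite /pivot; case: label_preserving; last exact: pf_const.
apply: (alg_det (pf_alg _)); apply: pfmx_add; first exact: algmx_id.
exact: pfmx_const.
Qed.

Lemma basic_graded_mx : basic (graded_mx lam : set (matrix_cspace n n)).
Proof.
have H := @basic_mx_eqs (matrix_cspace n n) (vertex Q) _ _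
  (fun i f => proj (fib lam i) *m f) (fun i f => f *m proj (fib lam i)).
apply: (basic_ext _ (H _ _)).
- by move=> f; split; [exact: graded_mxP|move=> /graded_mx_comm gf i; exact: gf].
- by move=> i; apply: pfmx_mul; [exact: pfmx_const|exact: algmx_id].
- by move=> i; apply: pfmx_mul; [exact: algmx_id|exact: pfmx_const].
Qed.

Lemma basic_inj_mx U S : basic (inj_mx U S : set (matrix_cspace n n)).
Proof.
have pfU : algmx (@pf (matrix_cspace n n)) (fun f => f *m proj U).
  by apply: pfmx_mul; [exact: algmx_id|exact: pfmx_const].
have pSf : algmx (@pf (matrix_cspace n n)) (fun f => proj S *m f).
  by apply: pfmx_mul; [exact: pfmx_const|exact: algmx_id].
have := basicI basic_graded_mx (basicI (basic_mx_eq pfU (@algmx_id n n))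
  (basicI (basic_mx_eq pSf (@algmx_id n n)) (basic_open (pf_pivot ^~ U)))).
apply: basic_ext => f; split.
  move=> [gf [fU [Sf [s /pivot_neq0[_ su]]]]]; split=> //.
  exact: unit_frame_inj su.
by move=> inj_f; have [gf fU Sf _] := inj_f; do !split=> //; exact: inj_mx_pivot inj_f.
Qed.

End Frames.

Section InjectiveClass.
Variables (Q : quiver) (n : nat) (lam : 'I_n -> vertex Q).
Local Notation ecol v := (delta_mx v 0 : 'cV[C]_n).
Local Notation erow v := (delta_mx 0 v : 'rV[C]_n).
Implicit Types (U S Z : {set 'I_n}) (f g : 'M[C]_n) (s : 'S_n) (y : 'cV[C]_n).

Definition label_card U i := #|[set v in U | lam v == i]|.

Definition supp_off Z U : set 'cV[C]_n :=
  [set y | proj Z *m y = y /\ exists w, w \notin U /\ y w 0 != 0].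

Lemma coord_cV Z : @coord_subspace (matrix_cspace n 1) [set j : 'I_n * 'I_1 | j.1 \in Z]%SET =
  [set y | proj Z *m y = y].
Proof.
apply/seteqP; split=> y /=.
  by move=> yZ; apply/proj_idP => w j wZ; apply: (yZ (w, j)); rewrite inE.
by move=> /proj_idP yZ [w j]; rewrite inE; exact: yZ.
Qed.

Lemma cls_cV Z : cls ([set y | proj Z *m y = y] : set (matrix_cspace n 1)) = mL ^+ #|Z|.
Proof.
rewrite -coord_cV cls_coord_subspace; congr (_ ^+ _).
rewrite -(card_imset Z (f := fun w => (w, 0 : 'I_1))) => [|v w []//].
apply: eq_card => -[w j]; rewrite !inE /= (ord1 j); apply/idP/imsetP => [wZ|[v vZ [->]]//].
by exists w.
Qed.

Lemma pf_cV w : @pf (matrix_cspace n 1) (fun y => y w 0).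
Proof. exact: (@pf_co (matrix_cspace n 1) (w, 0)). Qed.

Lemma basic_cV Z : basic ([set y | proj Z *m y = y] : set (matrix_cspace n 1)).
Proof. by rewrite -coord_cV; exact: basic_coord_subspace. Qed.

Let off U w y : C := if w \in U then 0 else y w 0.

Let pf_off U w : @pf (matrix_cspace n 1) (off U w).
Proof. by rewrite /off; case: (w \in U); [exact: pf_const|exact: pf_cV]. Qed.

Let supp_offE Z U : (supp_off Z U : set (matrix_cspace n 1)) =
  [set y | proj Z *m y = y] `&` [set y | exists w, off U w y != 0].
Proof.
apply/seteqP; split=> y /= [yZ [w]].
  by move=> [/negPf wU yw]; split=> //; exists w; rewrite /off wU.
by rewrite /off; case: ifPn; [rewrite eqxx|move=> wU yw; split=> //; exists w].
Qed.

Lemma basic_supp_off Z U : basic (supp_off Z U : set (matrix_cspace n 1)).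
Proof.
by rewrite supp_offE; apply: basicI; [exact: basic_cV|exact/basic_open/pf_off].
Qed.

Lemma cls_supp_off Z U : cls (supp_off Z U : set (matrix_cspace n 1)) =
  mL ^+ #|Z| - mL ^+ #|Z :&: U|.
Proof.
rewrite -!cls_cV (cls_scissor (basic_cV Z) (pf_off U)) supp_offE [X in X - _]addrC.
rewrite (_ : [set y | proj Z *m y = y] `&` [set y | forall w, off U w y = 0] =
  [set y | proj (Z :&: U) *m y = y]) ?addrK//.
apply/seteqP; split=> y /=.
  move=> [/proj_idP yZ yU]; apply/proj_idP => w j; rewrite inE negb_and (ord1 j).
  case/orP => [/yZ//|/negPf wU]; have := yU w.
  by rewrite /off wU.
move=> /proj_idP yZU; split.
  by apply/proj_idP => w j wZ; rewrite yZU// inE negb_and wZ.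
by move=> w; rewrite /off; case: ifPn => // wU; rewrite yZU// inE negb_and wU orbT.
Qed.

Section Peel.
Variables (U S : {set 'I_n}) (u : 'I_n).
Hypothesis uU : u \notin U.
Local Notation U' := (u |: U)%SET.
Local Notation mat := (matrix_cspace n n).

Let key s : nat := enum_rank s.

Let key_inj : injective key.
Proof. by move=> s t /val_inj /enum_rank_inj. Qed.

Let new_supp s : {set 'I_n} :=
  [set w | (lam w == lam u) && ((w \in U) || (s w \in S))].

Let strat' s : set mat := stratum key (fun t f => pivot lam t U (f *m proj U))
  (inj_mx lam U' S) s.
Let strat s : set mat := stratum key (fun t f => pivot lam t U f) (inj_mx lam U S) s.

Let col_add f y : 'M[C]_n := f + y *m erow u.

Let col_add_proj f y : f *m proj U = f -> col_add f y *m proj U = f.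
Proof.
move=> fU; rewrite mulmxDl fU -mulmxA (_ : erow u *m proj U = 0) ?mulmx0 ?addr0//.
apply/rowP => v; rewrite mul_projE !mxE eqxx /=.
by case: ifP => // vU; case: eqP => // vu; move: uU; rewrite -vu vU.
Qed.

Let col_add_col f y : f *m proj U = f -> col_add f y *m ecol u = y.
Proof.
move=> fU; rewrite mulmxDl -fU -mulmxA (_ : proj U *m ecol u = 0).
  rewrite mulmx0 add0r -mulmxA mul_delta_mx (_ : delta_mx _ _ = 1%:M) ?mulmx1//.
  by apply/matrixP => i j; rewrite !ord1 !mxE !eqxx.
apply/colP => v; rewrite proj_mulE !mxE.
by case: ifP => // vU; case: eqP => // vu; move: uU; rewrite -vu vU.
Qed.

Let col_addK f : f *m proj U' = f -> col_add (f *m proj U) (f *m ecol u) = f.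
Proof.
move=> fU; rewrite /col_add -mulmxA delta_proj_mul -mulmxDr -[RHS]fU; congr (_ *m _).
apply/matrixP => v w; rewrite mxE !projE !inE.
by have [->|_] := eqVneq v u; rewrite ?(negPf uU) /= ?mulr0n ?add0r ?addr0.
Qed.

Let mem_col_add s f y : (forall v, lam (s v) = lam v) -> inj_mx lam U S f ->
  frame s U f \in unitmx ->
  (inj_mx lam U' S (col_add f (frame s U f *m y)) <-> supp_off (new_supp s) U y).
Proof.
set g := frame s U f => ls inj_f gu; have [gf fU Sf _] := inj_f.
have gg : graded_mx lam g by exact: graded_frame.
have gyE : g *m y = f *m y + (perm_mx s)^T *m (proj (~: U) *m y).
  by rewrite mulmxDl mulmxA.
have permE w : ((perm_mx s)^T *m (proj (~: U) *m y)) (s w) 0 =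
    if w \in U then 0 else y w 0.
  have pE v v' : (perm_mx s)^T v v' = (s v' == v)%:R by rewrite !mxE.
  rewrite mxE (bigD1 w)//= big1 ?addr0 => [|k kw].
    by rewrite pE eqxx mul1r proj_mulE inE; case: (w \in U).
  by rewrite pE (inj_eq perm_inj) (negPf kw) mul0r.
split.
  move=> inj_f'; have [gf' fU' Sf' _] := inj_f'.
  have := inj_mx_new_coord uU inj_f' (s := s).
  rewrite col_add_proj// -/g => /(_ gu); rewrite -mulmxA col_add_col// mulKmx//.
  move=> [w wU yw]; split; last by exists w.
  have Sgy : proj S *m (g *m y) = g *m y.
    by rewrite -(col_add_col (g *m y) fU) !mulmxA Sf'.
  apply/proj_idP => v j; rewrite (ord1 j) !inE negb_and negb_or => vZ.
  have [//|yv] := eqVneq (y v 0) 0.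
  have vl : lam v = lam u.
    have := graded_mx_mul (graded_mx_inv gg gu) gf'; apply.
    have : (invmx g *m col_add f (g *m y) *m ecol u) v 0 = y v 0.
      by rewrite -mulmxA col_add_col// mulKmx.
    by rewrite -colE mxE => ->.
  move: vZ; rewrite vl eqxx /= => /andP[/negPf vU svS].
  have := permE v; rewrite vU => <-.
  have -> : (perm_mx s)^T *m (proj (~: U) *m y) = proj S *m (g *m y - f *m y).
    by rewrite mulmxBr Sgy (mulmxA _ f) Sf gyE addrC addKr.
  by rewrite proj_mulE (negPf svS).
move=> [yZ [w [wU yw]]].
have yl v : y v 0 != 0 -> lam v = lam u.
  by rewrite -yZ proj_mulE !inE; have [//|_] := eqVneq (lam v) (lam u); rewrite eqxx.
have yE : col_add f (g *m y) = g *m (proj U + y *m erow u).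
  by rewrite mulmxDr frame_proj// mulmxA.
split.
- apply: graded_mx_add => // v v'.
  rewrite mxE big_ord1 [(erow u) _ _]mxE eqxx /=.
  have [->|_] := eqVneq v' u; last by rewrite mulr0 eqxx.
  rewrite mulr1 mxE => /eqP gyv; apply: contrapT => lv; apply: gyv.
  rewrite big1// => k _; have [->|/yl lk] := eqVneq (y k 0) 0; first by rewrite mulr0.
  have [->|/gg lvk] := eqVneq (g v k) 0; first by rewrite mul0r.
  by case: lv; rewrite lvk lk.
- rewrite mulmxDl; congr (_ + _); last first.
    rewrite -mulmxA; congr (_ *m _); apply/id_projP => k v.
    by rewrite !inE negb_or mxE (ord1 k) eqxx /= => /andP[/negPf ->].
  rewrite -{1}fU -mulmxA projI (_ : _ :&: _ = U) ?fU//.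
  by apply/setP => v; rewrite !inE; case: (v \in U); rewrite ?orbT ?andbF.
- rewrite mulmxDr Sf mulmxA; congr (_ + _ *m _).
  apply/proj_idP => v j vS; rewrite (ord1 j) gyE mxE.
  have -> : (f *m y) v 0 = 0 by rewrite -Sf -mulmxA proj_mulE (negPf vS).
  rewrite add0r -(permKV s v) permE; case: ifPn => // sU.
  by rewrite -yZ proj_mulE !inE permKV (negPf vS) orbF (negPf sU) andbF.
- exists ((proj U - (y w 0)^-1 *: (proj U *m y *m erow w) +
      (y w 0)^-1 *: (ecol u *m erow w)) *m invmx g).
  have ww : erow w *m y = (y w 0)%:M.
    by rewrite -rowE; apply/matrixP => i j; rewrite !ord1 !mxE eqxx.
  have wPU : erow w *m proj U = 0.
    by apply/rowP => v; rewrite mul_projE !mxE eqxx /=; case: ifP => // vU;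
      case: eqP => // vw; rewrite -vw vU in wU.
  rewrite -mulmxA yE mulKmx// mulmxDl mulmxBl -!scalemxAl !mulmxDr.
  rewrite -!(mulmxA _ (erow w)) !wPU !mulmx0 !add0r proj_idem.
  rewrite !(mulmxA (erow w)) ww !mul_scalar_mx -!scalemxAr !scalerA mulVf// !scale1r.
  rewrite -mulmxA addrK delta_proj_mul; apply/matrixP => v v'.
  rewrite mxE !projE !inE.
  by have [->|_] := eqVneq v u; rewrite ?(negPf uU) /= ?mulr0n ?add0r ?addr0.
Qed.

Let restrict_strat s f : strat' s f -> strat s (f *m proj U).
Proof.
by move=> [inj_f [ps p0]]; exact: (conj (inj_mx_restrict inj_f) (conj ps p0)).
Qed.

Let pf_restrict s : @pf mat (fun f => pivot lam s U (f *m proj U)).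
Proof.
apply: (@pf_comp mat mat (fun f => f *m proj U)); last exact: pf_pivot.
move=> [i j]; have : algmx (@pf mat) (fun f => f *m proj U) by
  apply: pfmx_mul; [exact: algmx_id|exact: pfmx_const].
exact.
Qed.

Let basic_strat' s : basic (strat' s).
Proof. exact: basic_stratum pf_restrict _ _ (basic_inj_mx _ _ _). Qed.

Let basic_strat s : basic (strat s).
Proof. exact: basic_stratum (fun t => pf_pivot lam t U) _ _ (basic_inj_mx _ _ _). Qed.

Let new_supp_card s f : strat s f ->
  #|new_supp s| = label_card S (lam u) /\ #|new_supp s :&: U| = label_card U (lam u).
Proof.
move=> [[gf fU Sf _] [/pivot_neq0[ls gu] _]].
have sUS w : w \in U -> s w \in S.
  move=> wU; apply: contraT => sw; have /eqP := oner_eq0 C.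
  have := mulmxV gu => /matrixP/(_ (s w) (s w)).
  rewrite [RHS]mxE eqxx mulr1n => <-.
  rewrite mxE big1 ?eqxx// => k _.
  rewrite [frame _ _ _ _ _]mxE mul_projE -Sf proj_mulE (negPf sw) add0r inE.
  case: ifPn => [kU|_]; last by rewrite mul0r.
  rewrite !mxE (inj_eq perm_inj); case: eqP => [kw|]; last by rewrite mul0r.
  by rewrite kw wU in kU.
split; rewrite /label_card.
  rewrite -[RHS](card_preimset _ (@perm_inj _ s)); apply: eq_card => w.
  rewrite !inE ls andbC; congr (_ && _).
  by case: (boolP (w \in U)) => //= wU; rewrite sUS.
by apply: eq_card => w; rewrite !inE; case: (w \in U); rewrite ?andbF ?andbT.
Qed.

Let cls_strat' s : cls (strat' s) =
  cls (strat s) * (mL ^+ label_card S (lam u) - mL ^+ label_card U (lam u)).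
Proof.
have [[f0 sf0]|nos] := pselect (exists f, strat s f); last first.
  have c0 (X : set mat) : X = set0 -> cls X = 0 by move=> ->; exact: cls_set0.
  have e0 : strat s = set0.
    by apply/seteqP; split=> // f sf; apply: nos; exists f.
  have e0' : strat' s = set0.
    apply/seteqP; split=> // f sf; apply: nos; exists (f *m proj U).
    exact: restrict_strat.
  by rewrite (c0 _ e0') (c0 _ e0) mul0r.
have [cZ cZU] := new_supp_card sf0.
rewrite -cZ -cZU -cls_supp_off -cls_prod; [|exact: basic_strat|exact: basic_supp_off].
have strat_frame f : strat s f -> (forall v, lam (s v) = lam v) /\ frame s U f \in unitmx.
  by move=> [_ [/pivot_neq0]].
apply: (@cls_iso mat (prod_cspace mat (matrix_cspace n 1)) _ _
  (fun f => (f *m proj U, invmx (frame s U (f *m proj U)) *m f *m ecol u))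
  (fun fy => col_add fy.1 (frame s U fy.1 *m fy.2))).
- exact: basic_strat'.
- by apply: basic_setX; [exact: basic_strat|exact: basic_supp_off].
- have rid : algmx (reg (strat' s)) id by exact/algmx_pf_reg/algmx_id.
  have rc m k (M : 'M[C]_(m, k)) : algmx (reg (strat' s)) (fun=> M).
    exact/algmx_pf_reg/pfmx_const.
  have rU : algmx (reg (strat' s)) (fun f => f *m proj U).
    by apply: (algmx_mul (reg_alg _)).
  apply: (@regmap_pair mat mat (matrix_cspace n 1)); first exact/regmap_mx.
  apply: regmap_mx; apply: (algmx_mul (reg_alg _)) => //.
  apply: (algmx_mul (reg_alg _)) => //; apply: regmx_inv.
    exact: (algmx_add (reg_alg _)).
  by move=> f /restrict_strat /strat_frame[].
- apply: regmap_mx; apply: algmx_pf_reg.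
  have p1 : algmx (@pf (prod_cspace mat (matrix_cspace n 1))) (fun fy => fy.1).
    by move=> i j; exact: (@pf_fst mat (matrix_cspace n 1) (i, j)).
  have p2 : algmx (@pf (prod_cspace mat (matrix_cspace n 1))) (fun fy => fy.2).
    by move=> i j; exact: (@pf_snd mat (matrix_cspace n 1) (i, j)).
  apply: pfmx_add => //; apply: pfmx_mul; last exact: pfmx_const.
  apply: pfmx_mul => //; apply: pfmx_add => //; exact: pfmx_const.
- move=> f sf; have sfU := restrict_strat sf.
  have [ls gu] := strat_frame _ sfU; have [inj_f _] := sf; have [_ fU' _ _] := inj_f.
  have fE : col_add (f *m proj U)
      (frame s U (f *m proj U) *m (invmx (frame s U (f *m proj U)) *m f *m ecol u)) = f.
    by rewrite -(mulmxA (invmx _)) mulKVmx// col_addK.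
  split; last exact: fE.
  split; first exact: sfU.
  have [inj_fU _] := sfU.
  by have := (mem_col_add
    (invmx (frame s U (f *m proj U)) *m f *m ecol u) ls inj_fU gu).1; rewrite fE; apply.
- move=> [f y] [/= sf Zy]; have [ls gu] := strat_frame _ sf.
  have [inj_f [ps p0]] := sf; have [_ fU _ _] := inj_f.
  rewrite col_add_proj//; split; last first.
    by congr pair; rewrite -mulmxA col_add_col// mulKmx.
  split; first exact/mem_col_add.
  by rewrite /= col_add_proj.
Qed.

Lemma cls_inj_mx_peel : cls (inj_mx lam U' S : set mat) =
  cls (inj_mx lam U S : set mat) * (mL ^+ label_card S (lam u) - mL ^+ label_card U (lam u)).
Proof.
rewrite (cls_strata key_inj pf_restrict (basic_inj_mx _ _ _)); last first.
  by move=> f /inj_mx_restrict /inj_mx_pivot.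
rewrite [in RHS](cls_strata key_inj (fun t => pf_pivot lam t U) (basic_inj_mx _ _ _)).
  by rewrite mulr_suml; apply: eq_bigr => s _; exact: cls_strat'.
by move=> f /inj_mx_pivot.
Qed.

End Peel.

Lemma cls_inj_mx U S : cls (inj_mx lam U S : set (matrix_cspace n n)) =
  \prod_i \prod_(k < label_card U i) (mL ^+ label_card S i - mL ^+ k).
Proof.
move En: #|U| => m; elim: m U En => [|m IH] U Um.
  rewrite [RHS]big1 => [|i _]; last first.
    rewrite /label_card (cards0_eq Um) big1// => -[k kn].
    by suff: false by []; rewrite (_ : #|_| = 0%N) in kn => //; apply: eq_card0 => v;
      rewrite !inE.
  rewrite (_ : inj_mx lam U S = @coord_subspace (matrix_cspace n n) finset.set0).
    by rewrite cls_coord_subspace cards0 expr0.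
  rewrite (cards0_eq Um); apply/seteqP; split=> f.
    move=> [_ f0 _ _] [i j] _; rewrite -f0 proj0 mulmx0 /= /matrix_co mxE//.
  move=> f0; have -> : f = 0.
    by apply/matrixP => i j; rewrite mxE; apply: (f0 (i, j)); rewrite inE.
  split; [|by rewrite mul0mx|by rewrite mulmx0|by exists 0; rewrite mulmx0 proj0].
  by move=> v w; rewrite mxE eqxx.
have [u uU] : exists u, u \in U by apply/card_gt0P; rewrite Um.
have u0 : u \notin (U :\ u)%SET by rewrite !inE eqxx.
move: Um; rewrite (cardsD1 u) uU => -[Um]; rewrite -(finset.setD1K uU).
move: (U :\ u)%SET u0 Um => {uU}U uU Um.
rewrite cls_inj_mx_peel// IH// [RHS](bigD1 (lam u))//= [in LHS](bigD1 (lam u))//=.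
rewrite mulrAC; congr (_ * _); last first.
  apply: eq_bigr => i /negPf iu; rewrite (_ : label_card (u |: U) i = label_card U i)//.
  apply: eq_card => v; rewrite !inE.
  by case: eqP => // ->; rewrite (negPf uU) [_ == i]eq_sym iu.
rewrite (_ : label_card (u |: U) (lam u) = (label_card U (lam u)).+1).
  by rewrite big_ord_recr.
rewrite /label_card (cardsD1 u) !inE !eqxx /=; congr _.+1.
apply: eq_card => v; rewrite !inE.
by have [->|] := eqVneq v u; rewrite //= (negPf uU).
Qed.

End InjectiveClass.

(** * Representations with a subspace of the socle *)

Section KernelPairs.
Variables (Q : quiver) (n : nat) (lam : 'I_n -> vertex Q).
Local Notation trep := {ffun arrow Q -> 'M[C]_n}.
Local Notation reps := (ffun_cspace (matrix_cspace n n) (arrow Q)).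
Local Notation mat := (matrix_cspace n n).
Local Notation pairs := (prod_cspace reps mat).
Implicit Types (U S : {set 'I_n}) (V : trep) (f g : 'M[C]_n) (s : 'S_n).

Definition label_vec U : dimvec Q := [ffun i => label_card lam U i].

Let label_vecE U i : #|[set v in U | lam v == i]| = label_vec U i.
Proof. by rewrite ffunE. Qed.

Lemma basic_nil U : basic (nil_rep lam U : set reps).
Proof. exact: (basic_nil_rep (label_vecE U)). Qed.

Lemma cls_nil U :
  cls (nil_rep lam U : set reps) = motive (nullcone_variety (label_vec U)).
Proof. exact: (cls_nil_rep (label_vecE U)). Qed.

Lemma nil_repT V : nil_rep lam finset.setT V <-> graded_rep lam V /\ nil V.
Proof.
split=> [[gV _ nV]//|[gV nV]]; split=> // a.
by rewrite projT mul1mx mulmx1.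
Qed.

Lemma nil_repT_conj g V : g \in unitmx -> graded_mx lam g ->
  nil_rep lam finset.setT V -> nil_rep lam finset.setT (conj_rep g V).
Proof.
move=> gu gg /nil_repT[gV nV]; apply/nil_repT; split; first exact: graded_conj.
exact: nil_conj.
Qed.

Definition hom_card U : nat := (\sum_(a : arrow Q)
  label_card lam U (target a) * label_card lam (~: U) (source a))%N.

Definition kernel_pairs U : set pairs := (nil_rep lam finset.setT `*` inj_mx lam U finset.setT)
  `&` [set Vf : trep * 'M[C]_n | forall a, Vf.1 a *m Vf.2 = 0].

Definition kills U : set reps := nil_rep lam finset.setT `&`
  [set V : trep | forall a, V a *m proj U = 0].

Let pf1 a : algmx (@pf pairs) (fun Vf : trep * 'M[C]_n => Vf.1 a).
Proof. by move=> i j; exact: (@pf_fst reps mat (a, (i, j))). Qed.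

Let pf2 : algmx (@pf pairs) (fun Vf : trep * 'M[C]_n => Vf.2).
Proof. by move=> i j; exact: (@pf_snd reps mat (i, j)). Qed.

Lemma basic_kernel_pairs U : basic (kernel_pairs U).
Proof.
apply: basicI; first by apply: basic_setX; [exact: basic_nil|exact: basic_inj_mx].
apply: (@basic_mx_eqs pairs (arrow Q) _ _ (fun a (Vf : trep * 'M[C]_n) => Vf.1 a *m Vf.2)
  (fun _ _ => 0)).
  by move=> a; exact: pfmx_mul.
by move=> a; exact: pfmx_const.
Qed.

Lemma basic_kills U : basic (kills U).
Proof.
apply: basicI; first exact: basic_nil.
apply: (@basic_mx_eqs reps (arrow Q) _ _ (fun a (V : trep) => V a *m proj U) (fun _ _ => 0)).
  by move=> a; apply: pfmx_mul; [exact: algmx_app|exact: pfmx_const].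
by move=> a; exact: pfmx_const.
Qed.

Let hom_coords U : {set crd reps} := [set c : arrow Q * ('I_n * 'I_n) |
  [&& c.2.1 \in U, lam c.2.1 == target c.1, c.2.2 \notin U & lam c.2.2 == source c.1]]%SET.

Let card_hom_coords U : #|hom_coords U| = hom_card U.
Proof.
rewrite -sum1_card (eq_bigl (fun c : arrow Q * ('I_n * 'I_n) =>
  xpredT c.1 && ((c.2.1 \in [set v in U | lam v == target c.1]) &&
    (c.2.2 \in [set v in ~: U | lam v == source c.1])))); last first.
  by move=> c; rewrite !inE -!andbA.
rewrite -(pair_big_dep xpredT (fun a (p : 'I_n * 'I_n) => (p.1 \in
    [set v in U | lam v == target a]) &&
    (p.2 \in [set v in ~: U | lam v == source a])) (fun _ _ => 1%N)) /=.
apply: eq_bigr => a _; rewrite /label_card -cardsX -sum1_card.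
by apply: eq_bigl => -[u v]; rewrite finset.in_setX.
Qed.

Lemma cls_kills U :
  cls (kills U) = mL ^+ hom_card U * cls (nil_rep lam (~: U) : set reps).
Proof.
rewrite -card_hom_coords -cls_coord_subspace -cls_prod; last first.
- exact: basic_nil.
- exact: basic_coord_subspace.
have pfp S a : algmx (@pf reps) (fun V : trep => proj S *m V a).
  by apply: pfmx_mul; [exact: pfmx_const|exact: algmx_app].
have killE V a u v : V a *m proj U = 0 -> v \in U -> V a u v = 0.
  by move=> VU vU; have := congr1 (fun M : 'M_n => M u v) VU; rewrite mul_projE vU mxE.
apply: (@cls_iso reps (prod_cspace reps reps) _ _
  (fun V : trep => ([ffun a => proj U *m V a], [ffun a => proj (~: U) *m V a]))
  (fun HD : trep * trep => [ffun a => HD.1 a + HD.2 a])).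
- exact: basic_kills.
- by apply: basic_setX; [exact: basic_coord_subspace|exact: basic_nil].
- by apply: (@regmap_pair reps reps reps); apply: regmap_ffun => a;
    under eq_fun do rewrite ffunE; exact/regmap_mx/algmx_pf_reg.
- apply: regmap_ffun => a; under eq_fun do rewrite ffunE.
  apply/regmap_mx/algmx_pf_reg/pfmx_add => i j.
    exact: (@pf_fst reps reps (a, (i, j))).
  exact: (@pf_snd reps reps (a, (i, j))).
- move=> V [/nil_repT[gV nV] VU]; split; last first.
    apply/ffunP => a; rewrite !ffunE -mulmxDl projC addrC subrK.
    by rewrite mul1mx.
  split=> /=.
    move=> [a [u v]]; rewrite inE /= /ffun_co /matrix_co /= ffunE proj_mulE => uv.
    case: ifP => // uU; apply/eqP; apply: contraNT uv => Vuv.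
    have [-> ->] := gV _ _ _ Vuv; rewrite uU !eqxx andbT /=.
    by apply: contraNN Vuv => vU; rewrite (killE _ _ _ _ (VU a) vU).
  split.
  - by move=> a u v; rewrite ffunE proj_mulE; case: ifP => [_ /gV//|_]; rewrite eqxx.
  - move=> a; rewrite ffunE mulmxA proj_idem -mulmxA; congr (_ *m _).
    by rewrite projC mulmxBr mulmx1 VU subr0.
  - exact: ((nil_quotient VU).1 nV).
- move=> [H D] [/= HB [gD sD nD]].
  have HE a u v : H a u v != 0 -> [/\ u \in U, lam u = target a, v \notin U & lam v = source a].
    move=> Huv; suff : (a, (u, v)) \in hom_coords U.
      by rewrite inE /= => /and4P[uU /eqP lu vU /eqP lv].
    by apply: contraNT Huv => /HB H0; apply/eqP; exact: H0.
  have UH a : proj U *m H a = H a.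
    apply/proj_idP => u v uU; apply/eqP; apply: contraNT uU.
    by move=> /HE[].
  have HU a : H a *m proj U = 0.
    apply/matrixP => u v; rewrite mul_projE mxE; case: ifP => // vU.
    by apply/eqP; apply: contraTT vU => /HE[].
  have DU a : D a *m proj U = 0.
    by rewrite -sD -mulmxA projI finset.setIC finset.setICr proj0 mulmx0.
  have UD a : proj U *m D a = 0.
    by rewrite -sD !mulmxA projI finset.setICr proj0 !mul0mx.
  have CD a : proj (~: U) *m D a = D a by rewrite projC mulmxBl mul1mx UD subr0.
  have CH a : proj (~: U) *m H a = 0 by rewrite projC mulmxBl mul1mx UH subrr.
  have SU a : ([ffun b => H b + D b] : trep) a *m proj U = 0.
    by rewrite ffunE mulmxDl HU DU addr0.
  split; last first.
    by congr pair; apply/ffunP => a; rewrite !ffunE mulmxDr ?UH ?UD ?CH ?CD ?addr0 ?add0r.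
  split; last exact: SU.
  apply/nil_repT; split.
    move=> a u v; rewrite ffunE mxE; have [->|/HE[]//] := eqVneq (H a u v) 0.
    by rewrite add0r; exact: gD.
  apply/(nil_quotient SU); rewrite (_ : finfun _ = D)//.
  by apply/ffunP => a; rewrite !ffunE mulmxDr CH CD add0r.
Qed.

Let key s : nat := enum_rank s.

Let key_inj : injective key.
Proof. by move=> s t /val_inj /enum_rank_inj. Qed.

Let pf_pivot2 U s : @pf pairs (fun Vf : trep * 'M[C]_n => pivot lam s U Vf.2).
Proof.
by apply: (@pf_comp pairs mat snd) (pf_pivot lam s U) => j; exact: pf_snd.
Qed.

Lemma cls_kernel_pairs_kills U :
  cls (kernel_pairs U) = cls (inj_mx lam U finset.setT : set mat) * cls (kills U).
Proof.
rewrite (cls_strata key_inj (pf_pivot2 U) (basic_kernel_pairs U)); last first.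
  by move=> [V f] [[_ inj_f] _]; exact: inj_mx_pivot inj_f.
rewrite (cls_strata key_inj (fun s => pf_pivot lam s U) (basic_inj_mx _ _ _)); last first.
  by move=> f; exact: inj_mx_pivot.
rewrite mulr_suml; apply: eq_bigr => s _.
set X := stratum _ _ _ _; set X' := stratum _ _ _ _.
have bX' : basic X' by apply: basic_stratum => [t|]; [exact: pf_pivot|exact: basic_inj_mx].
have bX : basic X by apply: basic_stratum => [t|]; [exact: pf_pivot2|exact: basic_kernel_pairs].
rewrite -cls_prod//; last exact: basic_kills.
have strat_frame f : X' f -> [/\ graded_mx lam (frame s U f),
    frame s U f \in unitmx & frame s U f *m proj U = f].
  move=> [[gf fU _ _] [/pivot_neq0[ls gu] _]]; split=> //; first exact: graded_frame.
  exact: frame_proj.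
apply: (@cls_iso pairs (prod_cspace mat reps) _ _
  (fun Vf => (Vf.2, [ffun a => invmx (frame s U Vf.2) *m (Vf.1 : trep) a *m frame s U Vf.2]))
  (fun fV => ([ffun a => frame s U fV.1 *m (fV.2 : trep) a *m invmx (frame s U fV.1)], fV.1))).
- by [].
- by apply: basic_setX => //; exact: basic_kills.
- have rf : algmx (reg X) (fun Vf : trep * 'M[C]_n => frame s U Vf.2).
    apply: (algmx_pf_reg (P := pairs)); apply: pfmx_add => //; exact: pfmx_const.
  apply: (@regmap_pair pairs mat reps); first exact: regmap_snd.
  apply: regmap_ffun => a; under eq_fun do rewrite ffunE.
  apply: regmap_mx; apply: (algmx_mul (reg_alg _)) => //.
  apply: (algmx_mul (reg_alg _)); last exact: algmx_pf_reg.
  apply: regmx_inv => //.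
  by move=> [V f] [[[_ inj_f] _] pf]; have [] := strat_frame f (conj inj_f pf).
- have rf : algmx (reg (X' `*` kills U : set (prod_cspace mat reps)))
  (fun fV : 'M[C]_n * trep => frame s U fV.1).
    apply: (algmx_pf_reg (P := prod_cspace mat reps)); apply: pfmx_add; last exact: pfmx_const.
    by move=> i j; exact: (@pf_fst mat reps (i, j)).
  apply: (@regmap_pair (prod_cspace mat reps) reps mat); last exact: regmap_fst.
  apply: regmap_ffun => a; under eq_fun do rewrite ffunE.
  apply: regmap_mx; apply: (algmx_mul (reg_alg _)).
    apply: (algmx_mul (reg_alg _)) => //; apply: algmx_pf_reg => i j.
    exact: (@pf_snd mat reps (a, (i, j))).
  by apply: regmx_inv => // -[f V] [/strat_frame[]].
- move=> [V f] [[[/= nV inj_f] Vf] pf]; have X'f : X' f by exact: (conj inj_f pf).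
  have [gg gu fE] := strat_frame f X'f; set g := frame s U f in gg gu fE *.
  split; last first.
    congr pair; apply/ffunP => a; rewrite !ffunE /= ?ffunE.
    by rewrite !mulmxA mulmxV// mul1mx mulmxK.
  split=> //=; split.
    rewrite (_ : finfun _ = conj_rep (invmx g) V).
      by apply: nil_repT_conj => //; [rewrite unitmx_inv|exact: graded_mx_inv].
    by apply/ffunP => a; rewrite !ffunE invmxK.
  by move=> a; rewrite ffunE -/g -(mulmxA _ g) fE -mulmxA [V a *m f]Vf mulmx0.
- move=> [f V] [/= X'f [nV VU]]; have [gg gu fE] := strat_frame f X'f.
  have [inj_f pf] := X'f; set g := frame s U f in gg gu fE *.
  split; last first.
    congr pair; apply/ffunP => a; rewrite !ffunE /= ?ffunE.
    by rewrite !mulmxA mulVmx// mul1mx mulmxKV.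
  split=> //; split; first by split=> //; exact: nil_repT_conj.
  by move=> a /=; rewrite ffunE -/g -[X in _ *m X]fE !mulmxA mulmxKV//
    -mulmxA [V a *m _]VU mulmx0.
Qed.

End KernelPairs.

Section KernelFrames.
Variables (Q : quiver) (n : nat) (lam : 'I_n -> vertex Q).
Local Notation trep := {ffun arrow Q -> 'M[C]_n}.
Local Notation reps := (ffun_cspace (matrix_cspace n n) (arrow Q)).
Local Notation mat := (matrix_cspace n n).
Local Notation pairs := (prod_cspace reps mat).
Implicit Types (U S : {set 'I_n}) (V : trep) (f g : 'M[C]_n).

(* The rows outside [S] are taken among the rows of [V], those in [S] are
   coordinate vectors. *)
Definition frame_choice : finType :=
  ({set 'I_n} * ({ffun 'I_n -> 'I_n} * {ffun 'I_n -> option (arrow Q * 'I_n)}))%type.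
Implicit Types c : frame_choice.

Definition kframe c V : 'M[C]_n := \matrix_(u, v)
  if u \in c.1 then ((v == c.2.1 u) && (lam v == lam u))%:R
  else if c.2.2 u is Some ap then (source ap.1 == lam u)%:R * V ap.1 ap.2 v else 0.

Lemma graded_kframe c V : graded_rep lam V -> graded_mx lam (kframe c V).
Proof.
move=> gV u v; rewrite mxE; case: ifP => _.
  by have [->//|_] := eqVneq (lam v) (lam u); rewrite andbF eqxx.
case: (c.2.2 u) => [[a p]|]; last by rewrite eqxx.
rewrite mulf_eq0 negb_or => /andP[+ /gV[_ ->]] /=.
by have [->//|_] := eqVneq (source a) (lam u); rewrite eqxx.
Qed.

(* The cardinal of [S] is compared first. *)
Definition kkey c : nat := (#|c.1| * #|frame_choice| + enum_rank c)%N.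

Lemma kkey_lt c c' : (#|c.1| < #|c'.1|)%N -> (kkey c < kkey c')%N.
Proof.
move=> cc'; rewrite /kkey; apply: leq_trans (leq_addr _ _).
have := leq_mul cc' (leqnn #|frame_choice|); apply: leq_trans.
by rewrite mulSn addnC -addSn leq_add2r ltn_ord.
Qed.

Lemma kkey_inj : injective kkey.
Proof.
move=> c c' cc'; have [lt|lt|E] := ltngtP #|c.1| #|c'.1|.
- by have := kkey_lt lt; rewrite cc' ltnn.
- by have := kkey_lt lt; rewrite cc' ltnn.
- by move: cc'; rewrite /kkey E => /addnI /val_inj /enum_rank_inj.
Qed.

Definition kpivot c V : C := \det (kframe c V).

Lemma pf_kpivot c : @pf reps (kpivot c).
Proof.
apply: (alg_det (pf_alg reps)) => u v; rewrite /kframe.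
under eq_fun do rewrite mxE.
case: (u \in c.1); first exact: pf_const.
case: (c.2.2 u) => [ap|]; last exact: pf_const.
by apply: pf_mul; [exact: pf_const|exact: algmx_app].
Qed.

Lemma kpivot_unit c V : kpivot c V != 0 -> kframe c V \in unitmx.
Proof. by rewrite unitmxE unitfE. Qed.

Lemma kpivot_cover V : exists c, kpivot c V != 0.
Proof.
exists (finset.setT, ([ffun u => u], [ffun=> None])).
rewrite /kpivot (_ : kframe _ _ = 1%:M) ?det1 ?oner_eq0//.
apply/matrixP => u v; rewrite !mxE inE ffunE eq_sym.
by case: eqP => [->|_]; rewrite ?eqxx.
Qed.

(* Otherwise a row of [V] could replace a coordinate vector, for a choice with
   a smaller [S]. *)
Lemma kframe_kernel c V : graded_rep lam V -> kpivot c V != 0 ->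
  (forall c', (kkey c' < kkey c)%N -> kpivot c' V = 0) ->
  forall a, V a *m invmx (kframe c V) *m proj c.1 = 0.
Proof.
move=> gV pc min a; have gu := kpivot_unit pc; set g := kframe c V in gu *.
have gg : graded_mx lam g by exact: graded_kframe.
apply/matrixP => p w; rewrite mul_projE [RHS]mxE; case: ifP => // wS.
apply/eqP; apply: contraT => yw.
have lw : source a = lam w.
  move: yw; rewrite mxE; have [//|slw] := eqVneq (source a) (lam w).
  rewrite big1 ?eqxx// => k _; have [->|Vk] := eqVneq (V a p k) 0; first by rewrite mul0r.
  have [->|gk] := eqVneq (invmx g k w) 0; first by rewrite mulr0.
  have [_ lk] := gV _ _ _ Vk; have := graded_mx_inv gg gu gk.
  by rewrite lk => /eqP; rewrite (negPf slw).
pose c' : frame_choice := ((c.1 :\ w)%SET, (c.2.1,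
  [ffun u => if u == w then Some (a, p) else c.2.2 u])).
have lt : (kkey c' < kkey c)%N by apply: kkey_lt; rewrite [X in (_ < X)%N](cardsD1 w) wS.
have /eqP := min c' lt; apply: contraTT => _.
rewrite /kpivot -unitfE -unitmxE.
pose y := row p (V a) *m invmx g.
have -> : kframe c' V = (1%:M + (delta_mx w 0 : 'cV_n) *m (y - delta_mx 0 w)) *m g.
  rewrite mulmxDl mul1mx -mulmxA mulmxBl mulmxKV// -rowE.
  apply/matrixP => u v; rewrite [RHS]mxE [X in _ + X]mxE big_ord1.
  rewrite [delta_mx _ _ _ _]mxE eqxx andbT [X in _ * X]mxE [X in _ * (_ + X)]mxE.
  rewrite ![row _ _ _ _]mxE [LHS]mxE !inE ffunE.
  have [->|uw] := eqVneq u w.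
    by rewrite /= lw eqxx !mul1r addrC subrK.
  by rewrite /= mul0r addr0 /g mxE.
rewrite unitmx_mul gu andbT -unitmx_tr linearD /= trmx1 trmx_mul linearB /= !trmx_delta.
by apply: replace_col_unit; rewrite mxE /y -row_mul mxE.
Qed.

Lemma cls_kernel_pairs_frames U : cls (kernel_pairs lam U) =
  \sum_c cls (stratum kkey kpivot (nil_rep lam finset.setT : set reps) c) *
         cls (inj_mx lam U c.1 : set mat).
Proof.
have pf2 c : @pf pairs (fun Vf : trep * 'M[C]_n => kpivot c Vf.1).
  by apply: (@pf_comp pairs reps fst) (pf_kpivot c) => j; exact: pf_fst.
rewrite (cls_strata kkey_inj pf2 (basic_kernel_pairs _ _)); last first.
  by move=> [V f] _; exact: kpivot_cover.
apply: eq_bigr => c _; set X := stratum _ _ _ _; set X' := stratum _ _ _ _.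
have bX' : basic X' by apply: basic_stratum => [t|]; [exact: pf_kpivot|exact: basic_nil].
have bX : basic X by apply: basic_stratum => [t|]; [exact: pf2|exact: basic_kernel_pairs].
rewrite -cls_prod//; last exact: basic_inj_mx.
have rf (P : cspace) (Y : set P) (F : P -> trep) : (forall a, algmx (@pf P) (fun x => F x a)) ->
    algmx (reg Y) (fun x => kframe c (F x)).
  move=> pF; apply: algmx_pf_reg => u v; under eq_fun do rewrite mxE.
  case: (u \in c.1); first exact: pf_const.
  case: (c.2.2 u) => [ap|]; last exact: pf_const.
  by apply: pf_mul; [exact: pf_const|exact: pF].
have p1 a : algmx (@pf pairs) (fun Vf : trep * 'M[C]_n => Vf.1 a).
  by move=> i j; exact: (@pf_fst reps mat (a, (i, j))).
have p2 : algmx (@pf pairs) (fun Vf : trep * 'M[C]_n => Vf.2).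
  by move=> i j; exact: (@pf_snd reps mat (i, j)).
have XP V : X' V -> [/\ graded_mx lam (kframe c V), kframe c V \in unitmx &
    forall a, V a *m invmx (kframe c V) *m proj c.1 = 0].
  move=> [/nil_repT[gV nV] [pV min]]; split.
  - exact: graded_kframe.
  - exact: kpivot_unit.
  - exact: kframe_kernel.
apply: (@cls_iso pairs pairs _ _
  (fun Vf : trep * 'M[C]_n => (Vf.1, kframe c Vf.1 *m Vf.2))
  (fun Vf : trep * 'M[C]_n => (Vf.1, invmx (kframe c Vf.1) *m Vf.2))).
- by [].
- by apply: basic_setX => //; exact: basic_inj_mx.
- apply: (@regmap_pair pairs reps mat); first exact: regmap_fst.
  apply: regmap_mx; apply: (algmx_mul (reg_alg _)); last exact: algmx_pf_reg.
  exact: (rf pairs _ fst).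
- apply: (@regmap_pair pairs reps mat); first exact: regmap_fst.
  apply: regmap_mx; apply: (algmx_mul (reg_alg _)); last exact: algmx_pf_reg.
  apply: regmx_inv; first exact: (rf pairs _ fst).
  by move=> [V f] [/XP[]].
- move=> [V f] [[[/= nV inj_f] Vf] pV]; have X'V : X' V by exact: (conj nV pV).
  have [gg gu Vg] := XP _ X'V; have [gf fU _ [L Lf]] := inj_f.
  split; last by rewrite /= mulKmx.
  split=> //=; split.
  + exact: graded_mx_mul.
  + by rewrite -mulmxA fU.
  + apply/proj_idP => u v uS; rewrite mxE; under eq_bigr do rewrite mxE (negPf uS).
    case: (c.2.2 u) => [[a p]|]; last by rewrite big1// => k _; rewrite mul0r.
    under eq_bigr do rewrite -mulrA; rewrite -mulr_sumr /=.
    have := congr1 (fun M : 'M_n => M p v) (Vf a); rewrite /= !mxE => ->.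
    by rewrite mulr0.
  + by exists (L *m invmx (kframe c V)); rewrite -mulmxA mulKmx.
- move=> [V f] [/= X'V inj_f]; have [gg gu Vg] := XP _ X'V.
  have [gf fU Sf [L Lf]] := inj_f; have [nV pV] := X'V.
  split; last by rewrite /= mulKVmx.
  split=> //=; split; last by move=> a /=; rewrite -Sf !mulmxA Vg mul0mx.
  split=> //=; split.
  + by apply: graded_mx_mul => //; exact: graded_mx_inv.
  + by rewrite -mulmxA fU.
  + by rewrite projT mul1mx.
  + by exists (L *m kframe c V); rewrite -mulmxA mulKVmx.
Qed.

Lemma kframe_set0 c : (0 < n)%N -> c.1 = finset.set0 ->
  cls (stratum kkey kpivot (nil_rep lam finset.setT : set reps) c) = 0.
Proof.
move=> n0 c0; rewrite (_ : stratum _ _ _ _ = set0) ?cls_set0//.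
apply/seteqP; split=> // V [/nil_repT[gV nV] [pV _]].
have TV a : proj finset.setT *m V a = V a by rewrite projT mul1mx.
have VT a : V a *m proj finset.setT = V a by rewrite projT mulmx1.
have [z [/eqP z0 _ Vz]] :=
  nil_kernel nV (ex_intro _ (Ordinal n0) (finset.in_setT _)) TV VT.
apply: z0; rewrite -(mulKmx (kpivot_unit pV) z) (_ : kframe c V *m z = 0) ?mulmx0//.
apply/matrixP => u j; rewrite [RHS]mxE mxE; under eq_bigr do rewrite mxE c0 inE.
case: (c.2.2 u) => [[a p]|]; last by rewrite big1// => k _; rewrite mul0r.
under eq_bigr do rewrite -mulrA; rewrite -mulr_sumr /=.
have := congr1 (fun M : 'cV_n => M p j) (Vz a); rewrite /= !mxE => ->.
by rewrite mulr0.
Qed.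

Lemma kernel_pairs_count U :
  \sum_c cls (stratum kkey kpivot (nil_rep lam finset.setT : set reps) c) *
    \prod_i \prod_(k < label_card lam U i) (mL ^+ label_card lam c.1 i - mL ^+ k) =
  \prod_i \prod_(k < label_card lam U i) (mL ^+ label_card lam finset.setT i - mL ^+ k) *
    (mL ^+ hom_card lam U * motive (nullcone_variety (label_vec lam (~: U)))).
Proof.
rewrite -cls_inj_mx -cls_nil -cls_kills -cls_kernel_pairs_kills cls_kernel_pairs_frames.
by apply: eq_bigr => c _; rewrite cls_inj_mx.
Qed.

End KernelFrames.

(** * Identities in q *)

Section PzInverse.
Variable A : comPzRingType.
Implicit Types x y : A.

Definition invertible x : Prop := exists y, x * y = 1.

Lemma pzinvV x : invertible x -> x * pzinv x = 1.
Proof. by move=> [y xy]; rewrite (pzinvP xy). Qed.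

Lemma invertible1 : invertible 1.
Proof. by exists 1; rewrite mulr1. Qed.

Lemma invertibleM x y : invertible x -> invertible y -> invertible (x * y).
Proof. by move=> [x' xx'] [y' yy']; exists (x' * y'); rewrite mulrACA xx' yy' mulr1. Qed.

Lemma invertible_prod (I : Type) (r : seq I) (P : pred I) (F : I -> A) :
  (forall i, P i -> invertible (F i)) -> invertible (\prod_(i <- r | P i) F i).
Proof. by move=> FI; apply: big_ind; [exact: invertible1|exact: invertibleM|]. Qed.

Lemma invertibleX x n : invertible x -> invertible (x ^+ n).
Proof.
by move=> xI; elim: n => [|n IH]; [exact: invertible1|rewrite exprS; exact: invertibleM].
Qed.

Lemma pzinv1 : pzinv (1 : A) = 1.
Proof. by apply: pzinvP; rewrite mulr1. Qed.

Lemma pzinvM x y : invertible x -> invertible y -> pzinv (x * y) = pzinv x * pzinv y.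
Proof. by move=> xI yI; apply: pzinvP; rewrite mulrACA !pzinvV// mulr1. Qed.

Lemma pzinv_prod (I : Type) (r : seq I) (F : I -> A) :
  (forall i, invertible (F i)) -> pzinv (\prod_(i <- r) F i) = \prod_(i <- r) pzinv (F i).
Proof.
move=> FI; elim: r => [|i r IH]; first by rewrite !big_nil pzinv1.
by rewrite !big_cons pzinvM ?IH//; exact: invertible_prod.
Qed.

Lemma mulIpz x y z : invertible x -> x * y = x * z -> y = z.
Proof.
by move=> xI /(congr1 ( *%R (pzinv x))); rewrite !mulrA ![pzinv x * x]mulrC pzinvV// !mul1r.
Qed.

Lemma pzexpzB x m n : invertible x ->
  pzexpz x (m%:Z - n%:Z) = x ^+ m * pzinv x ^+ n.
Proof.
move=> xI; have [nm|mn] := leqP n m.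
  rewrite subzn// -[X in _ = x ^+ X * _](subnK nm) exprD -mulrA -exprMn.
  by rewrite pzinvV// expr1n mulr1.
rewrite -opprB subzn ?(ltnW mn)//; have : (0 < n - m)%N by rewrite subn_gt0.
case E : (n - m)%N => [//|k] _; rewrite -NegzE /= -E.
rewrite -[X in _ = _ * _ ^+ X](subnK (ltnW mn)) exprD mulrCA -exprMn pzinvV//.
by rewrite expr1n mulr1.
Qed.

Lemma int_subn (z : int) : exists m n : nat, z = m%:Z - n%:Z.
Proof.
case: z => n; first by exists n, 0%N; rewrite subr0.
by exists 0%N, n.+1; rewrite NegzE sub0r.
Qed.

Lemma pzexpzD x (y z : int) : invertible x ->
  pzexpz x (y + z) = pzexpz x y * pzexpz x z.
Proof.
move=> xI; have [m [n ->]] := int_subn y; have [k [l ->]] := int_subn z.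
rewrite addrACA -opprD -!PoszD !pzexpzB// !exprD.
by rewrite mulrACA.
Qed.

End PzInverse.

Section QIdentities.
Variables (A : comPzRingType) (q : A).
Hypothesis qI : invertible q.
Hypothesis q1I : forall i, (0 < i)%N -> invertible (1 - q ^+ i).

Local Notation qf := (qfact q).
Local Notation h n := (pzinv (qf n)).

Definition qfalling (e s : nat) : A := \prod_(k < e) (q ^+ s - q ^+ k).

Lemma qfactS n : qf n.+1 = qf n * (1 - q ^+ n.+1).
Proof. by rewrite /qfact big_nat_recr. Qed.

Lemma qfact0 : qf 0 = 1.
Proof. by rewrite /qfact big_geq. Qed.

Lemma qfact_inv n : invertible (qf n).
Proof.
elim: n => [|n IH]; first by rewrite qfact0; exact: invertible1.
by rewrite qfactS; apply: invertibleM => //; exact: q1I.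
Qed.

Lemma qfact_pzinvS n : h n = (1 - q ^+ n.+1) * h n.+1.
Proof.
rewrite qfactS pzinvM; [|exact: qfact_inv|exact: q1I].
by rewrite mulrCA (pzinvV (q1I _))// mulr1.
Qed.

Lemma qfalling0 e s : (s < e)%N -> qfalling e s = 0.
Proof. by move=> se; rewrite /qfalling (bigD1 (Ordinal se))//= subrr mul0r. Qed.

(* The partial sums telescope. *)
Lemma sum_qfalling m s :
  \sum_(e < m.+1) qfalling e s * h e = \prod_(k < m) (q ^+ s - q ^+ k.+1) * h m.
Proof.
elim: m => [|m IH]; first by rewrite big_ord1 /qfalling !big_ord0.
rewrite big_ord_recr /= IH [in RHS]big_ord_recr /= /qfalling big_ord_recl expr0.
rewrite qfact_pzinvS.
under [in X in _ + X]eq_bigr do rewrite lift0.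
by rewrite /=; ring.
Qed.

Lemma sum_qfalling_eq0 m s : (s <= m)%N ->
  \sum_(e < m.+1) qfalling e s * h e = (s == 0%N)%:R.
Proof.
case: s => [_|s sm].
  rewrite big_ord_recl /= {1}/qfalling big_ord0 mul1r qfact0 pzinv1 big1 ?addr0// => e _.
  by rewrite qfalling0 ?mul0r.
by rewrite sum_qfalling (bigD1 (Ordinal sm))//= subrr !mul0r.
Qed.

Lemma qfallingE e d : (e <= d)%N ->
  qfalling e d = (-1) ^+ e * q ^+ 'C(e, 2) * qf d * h (d - e).
Proof.
elim: e => [_|e IH ed].
  by rewrite /qfalling big_ord0 subn0 expr0 bin0n expr0 !mul1r pzinvV//; exact: qfact_inv.
rewrite /qfalling big_ord_recr /= -/(qfalling e d) IH ?(ltnW ed)//.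
rewrite [h (d - e.+1)]qfact_pzinvS subnSK//.
have -> : q ^+ d = q ^+ (d - e) * q ^+ e by rewrite -exprD subnK// ltnW.
by rewrite binS bin1 exprD exprS; ring.
Qed.

End QIdentities.

(** * The recursion *)

Section Decompositions.
Variable Q : quiver.
Implicit Types (d e : dimvec Q) (ds : seq (dimvec Q)).

Definition dsub d e : dimvec Q := [ffun i => (d i - e i)%N].
Definition dle e d : bool := [forall i, e i <= d i]%N.

Lemma dleP e d : reflect (forall i, e i <= d i)%N (dle e d).
Proof. exact: fintype.forallP. Qed.

Lemma dimD d e i : (d + e) i = (d i + e i)%N.
Proof. by rewrite ffunE. Qed.

Lemma dsubK d e : dle e d -> dsub d e + e = d.
Proof. by move=> /dleP ed; apply/ffunP => i; rewrite dimD ffunE subnK. Qed.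

Lemma daddK d e : dsub (d + e) e = d.
Proof. by apply/ffunP => i; rewrite ffunE dimD addnK. Qed.

Lemma dle_addl d e : dle e (d + e).
Proof. by apply/dleP => i; rewrite dimD leq_addl. Qed.

Lemma total_dimD d e : total_dim (d + e) = (total_dim d + total_dim e)%N.
Proof. by rewrite /total_dim -big_split; apply: eq_bigr => i _; rewrite dimD. Qed.

Lemma total_dim_eq0 d : (total_dim d == 0%N) = (d == 0).
Proof.
apply/eqP/eqP => [|->]; last by rewrite /total_dim big1// => i _; rewrite ffunE.
move=> /eqP; rewrite sum_nat_eq0 => /fintype.forallP d0.
by apply/ffunP => i; rewrite ffunE; exact/eqP/d0.
Qed.

Lemma leq_total_dim d i : (d i <= total_dim d)%N.
Proof. by rewrite /total_dim (bigD1 i)//= leq_addr. Qed.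

Definition bounded_dimvec m (t : {ffun vertex Q -> 'I_m.+1}) : dimvec Q :=
  [ffun i => t i : nat].

Lemma bounded_dimvec_inj m : injective (@bounded_dimvec m).
Proof.
move=> t t' tt'; apply/ffunP => i; apply: val_inj.
by have := congr1 (fun d : dimvec Q => d i) tt'; rewrite !ffunE.
Qed.

Definition parts d : seq (dimvec Q) :=
  [seq e <- [seq bounded_dimvec t | t : {ffun vertex Q -> 'I_(total_dim d).+1}] |
    (e != 0) && dle e d].

Lemma mem_parts d e : (e \in parts d) = (e != 0) && dle e d.
Proof.
rewrite mem_filter; case: (boolP (_ && dle e d)) => //= /andP[_ /dleP ed].
apply/codomP; exists [ffun i => inord (e i)]; apply/ffunP => i.
by rewrite !ffunE inordK// ltnS (leq_trans (ed i))// leq_total_dim.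
Qed.

Lemma uniq_parts d : uniq (parts d).
Proof. by rewrite filter_uniq// map_inj_uniq ?enum_uniq//; exact: bounded_dimvec_inj. Qed.

Fixpoint declist k d : seq (seq (dimvec Q)) :=
  if d == 0 then [:: [::]] else
  if k is k'.+1 then [seq rcons ds e | e <- parts d, ds <- declist k' (dsub d e)]
  else [::].

Lemma uniq_declist k d : uniq (declist k d).
Proof.
elim: k d => [|k IH] d /=; case: eqP => // _.
apply: allpairs_uniq_dep => //; first exact: uniq_parts.
by move=> [e ds] [e' ds'] _ _ /= /rcons_inj[-> ->].
Qed.

Lemma decomposition0 ds : decompositions 0 ds <-> ds = [::].
Proof.
split=> [[ds0 E]|->]; last by split=> //; rewrite big_nil.
case: ds ds0 E => // e ds ds0; rewrite big_cons => E.
have /eqP[] := ds0 e (mem_head _ _); apply/eqP; rewrite -total_dim_eq0.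
have /eqP := congr1 (@total_dim Q) E.
by rewrite total_dimD (_ : total_dim 0 = 0%N) 1?eq_sym ?addn_eq0 => [/andP[]//|];
  apply/eqP; rewrite total_dim_eq0.
Qed.

Lemma decompositionS d ds e :
  decompositions d (rcons ds e) <-> [/\ e != 0, dle e d & decompositions (dsub d e) ds].
Proof.
split.
  move=> [ds0 ->]; rewrite big_rcons /=; split.
  - by apply: ds0; rewrite mem_rcons mem_head.
  - exact: dle_addl.
  - split; last by rewrite daddK.
    by move=> e' e'ds; apply: ds0; rewrite mem_rcons inE e'ds orbT.
move=> [e0 ed [ds0 E]]; split; last by rewrite big_rcons /= -E dsubK.
by move=> e'; rewrite mem_rcons inE => /predU1P[->//|/ds0].
Qed.

Lemma total_dim_dsub d e : e != 0 -> dle e d -> (total_dim (dsub d e) < total_dim d)%N.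
Proof.
move=> e0 ed; rewrite -[in X in (_ < X)%N](dsubK ed) total_dimD -addn1 leq_add2l.
by rewrite lt0n total_dim_eq0.
Qed.

Lemma mem_declist k d ds : (total_dim d <= k)%N ->
  ds \in declist k d <-> decompositions d ds.
Proof.
elim: k d ds => [|k IH] d ds dk.
  have d0 : d = 0 by apply/eqP; rewrite -total_dim_eq0 -leqn0.
  rewrite d0 /= eqxx inE; apply: iff_trans (iff_sym (decomposition0 ds)).
  by split=> [/eqP|->].
rewrite /=; have [->|d0] := eqVneq d 0.
  rewrite inE; apply: iff_trans (iff_sym (decomposition0 ds)).
  by split=> [/eqP|->].
split.
  move=> /allpairsPdep[e [ds' [+ + ->]]]; rewrite mem_parts => /andP[e0 ed] ds'd.
  apply/decompositionS; split=> //; apply/IH => //.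
  by rewrite -ltnS (leq_trans _ dk)// total_dim_dsub.
case/lastP: ds => [[_]|ds e]; first by rewrite big_nil => /eqP; rewrite (negPf d0).
move=> /decompositionS[e0 ed dds]; apply/allpairsPdep; exists e, ds; split=> //.
  by rewrite mem_parts e0.
by apply/IH => //; rewrite -ltnS (leq_trans _ dk)// total_dim_dsub.
Qed.

Lemma decompositions_sum (A : comPzRingType) (F : seq (dimvec Q) -> A) d :
  \sum_(ds \in decompositions d) F ds = \sum_(ds <- declist (total_dim d) d) F ds.
Proof.
rewrite [RHS]fsbig_seq ?uniq_declist//.
by apply: eq_fsbigl; apply/seteqP; split=> ds /= ?; apply/(@mem_declist (total_dim d)).
Qed.

Section Recursion.
Variables (A : comPzRingType) (X : dimvec Q -> dimvec Q -> A).
Variables (w : dimvec Q -> A) (T : seq (dimvec Q) -> A).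
Hypothesis w0 : w 0 = 1.
Hypothesis wS : forall d, d != 0 ->
  w d = - \sum_(e <- parts d) X (dsub d e) e * w (dsub d e).
Hypothesis T0 : T [::] = 1.
Hypothesis TS : forall ds e, T (rcons ds e) = - (X (\sum_(e' <- ds) e') e * T ds).

Lemma decompositions_rec d : w d = \sum_(ds \in decompositions d) T ds.
Proof.
have main k d' : (total_dim d' <= k)%N -> w d' = \sum_(ds <- declist k d') T ds.
  elim: k d' => [|k IH] {}d dk.
    have -> : d = 0 by apply/eqP; rewrite -total_dim_eq0 -leqn0.
    by rewrite /= eqxx big_seq1 w0 T0.
  rewrite /=; have [->|d0] := eqVneq d 0; first by rewrite big_seq1 w0 T0.
  rewrite big_allpairs_dep /= wS// -sumrN big_seq [RHS]big_seq.
  apply: eq_bigr => e; rewrite mem_parts => /andP[e0 ed].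
  have dk' : (total_dim (dsub d e) <= k)%N.
    by rewrite -ltnS (leq_trans _ dk)// total_dim_dsub.
  rewrite IH// mulr_sumr -sumrN big_seq [RHS]big_seq; apply: eq_bigr => ds.
  by move=> /(mem_declist _ dk')[_ E]; rewrite TS -E.
by rewrite decompositions_sum (main (total_dim d)).
Qed.

End Recursion.

Lemma euler_formDl d d' e : euler_form (d + d') e = euler_form d e + euler_form d' e.
Proof.
rewrite /euler_form addrACA -opprD -!big_split /=; congr (_ - _); apply: eq_bigr => i _.
  by rewrite dimD mulnDl PoszD.
by rewrite dimD mulnDl PoszD.
Qed.

Lemma euler_form0l e : euler_form (0 : dimvec Q) e = 0.
Proof.
by rewrite /euler_form !big1 ?subr0// => i _; rewrite ffunE mul0n.
Qed.

Lemma euler_form_suml ds e :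
  euler_form (\sum_(d <- ds) d) e = \sum_(d <- ds) euler_form d e.
Proof.
elim: ds => [|d ds IH]; first by rewrite !big_nil euler_form0l.
by rewrite !big_cons euler_formDl IH.
Qed.

Lemma decomposition_euler_rcons ds e : decomposition_euler (rcons ds e) =
  decomposition_euler ds + euler_form (\sum_(d <- ds) d) e.
Proof.
rewrite /decomposition_euler size_rcons big_ord_recr /=; congr (_ + _).
  apply: eq_bigr => l _; apply: eq_bigr => k _.
  by rewrite !nth_rcons ltn_ord (ltn_trans (ltn_ord k)).
rewrite euler_form_suml (big_nth 0) big_mkord; apply: eq_bigr => k _.
by rewrite !nth_rcons ltn_ord ltnn eqxx.
Qed.

Lemma decomposition_euler0 : decomposition_euler ([::] : seq (dimvec Q)) = 0.
Proof. by rewrite /decomposition_euler big_ord0. Qed.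

End Decompositions.

Section LefschetzUnits.

Let S : set K0 := [set s | s = lefschetz \/ exists2 i, (0 < i)%N & s = 1 - lefschetz ^+ i].

Lemma invertible_mL : invertible mL.
Proof. by exists (pzinv mL); apply: (@loc_mapV _ S); left. Qed.

Lemma invertible_1BmLX i : (0 < i)%N -> invertible (1 - mL ^+ i).
Proof.
move=> i0; have mLX k : mL ^+ k = loc_map S (lefschetz ^+ k).
  elim: k => [|k IH]; first by rewrite !expr0 loc_map1.
  by rewrite !exprS loc_mapM IH.
have -> : 1 - mL ^+ i = loc_map S (1 - lefschetz ^+ i).
  apply/eqP; rewrite subr_eq mLX -loc_mapD subrK; apply/eqP.
  by rewrite loc_map1.
by exists (pzinv (loc_map S (1 - lefschetz ^+ i))); apply: loc_mapV; right; exists i.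
Qed.

End LefschetzUnits.

Section Labels.
Variables (Q : quiver) (d : dimvec Q).
Local Notation T := {i : vertex Q & 'I_(d i)}.

Definition dlabel (u : 'I_#|{: T}|) : vertex Q := tag (enum_val u).

Definition first_labels (e : dimvec Q) : {set 'I_#|{: T}|} :=
  [set u | ((tagged (enum_val u) : 'I_(d (dlabel u))) < e (dlabel u))%N].

Lemma label_card_first e i : dle e d -> label_card dlabel (first_labels e) i = e i.
Proof.
move=> /dleP ed; pose f (j : 'I_(e i)) := enum_rank (Tagged (fun i => 'I_(d i))
  (widen_ord (ed i) j)).
have fi : injective f.
  move=> j k /enum_rank_inj/eqP; rewrite -tag_eqE /tag_eq /= eqxx /= => /eqP.
  rewrite tagged_asE => /(congr1 val) /= jk; exact: val_inj.
transitivity #|(f @: finset.setT)%SET|; last by rewrite card_imset// cardsT card_ord.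
apply: eq_card => u.
rewrite !inE; apply/idP/imsetP => [|[j _ ->]]; last first.
  by rewrite /dlabel enum_rankK /= eqxx ltn_ord.
rewrite /dlabel /f; case Eu: (enum_val u) => [i' j] /= /andP[je /eqP i'i].
subst i'; exists (Ordinal je); rewrite ?inE// -[LHS]enum_valK Eu.
by congr (enum_rank (Tagged _ _)); exact: val_inj.
Qed.

Lemma label_cardT i : label_card dlabel finset.setT i = d i.
Proof.
rewrite -(label_card_first (e := d) i); last exact/dleP.
apply: eq_card => u; rewrite !inE.
by rewrite ltn_ord.
Qed.

Lemma label_cardC U i :
  label_card dlabel (~: U) i = (d i - label_card dlabel U i)%N.
Proof.
rewrite -label_cardT /label_card.
rewrite (_ : [set v in ~: U | dlabel v == i] = [set v in finset.setT
  | dlabel v == i] :\: U)%SET.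
  rewrite cardsD; congr (_ - _)%N; apply: eq_card => v; rewrite !inE.
  by rewrite andbC.
by apply/setP => v; rewrite !inE.
Qed.

Lemma label_card_le S i : (label_card dlabel S i <= d i)%N.
Proof.
rewrite -label_cardT; apply: fintype.subset_leq_card.
by apply/fintype.subsetP => v; rewrite !inE => /andP[].
Qed.

End Labels.

Section NullconeRecursion.
Variable Q : quiver.
Implicit Types d e f : dimvec Q.

Local Notation qf := (qfact mL).
Local Notation h n := (pzinv (qf n)).
Local Notation nc d := (motive (nullcone_variety d)).

Let LI := invertible_mL.
Let L1I := invertible_1BmLX.

Definition normalized d : motivic_ring :=
  (-1) ^+ total_dim d * pzinv mL ^+ (\sum_i 'C(d i, 2))%N * \prod_i h (d i) * nc d.

Lemma normalized0 : normalized 0 = 1.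
Proof.
rewrite /normalized (_ : total_dim 0 = 0%N) ?expr0; last first.
  by apply/eqP; rewrite total_dim_eq0.
rewrite !big1 ?expr0 ?mul1r => [|i _|i _]; rewrite ?ffunE ?bin0n ?qfact0 ?pzinv1//.
pose lam := @dlabel Q 0.
have vac (u : 'I_#|{: {i : vertex Q & 'I_((0%R : dimvec Q) i)}}|) : False.
  have : u \in [set v in finset.setT | lam v == lam u] by rewrite !inE eqxx.
  move=> uu; have := label_cardT (0 : dimvec Q) (lam u); rewrite ffunE => /eqP.
  by rewrite cards_eq0 => /eqP E; rewrite E inE in uu.
have -> : (0 : dimvec Q) = label_vec lam finset.setT.
  by apply/ffunP => i; rewrite [RHS]ffunE label_cardT.
rewrite -cls_nil.
set X := nil_rep _ _.
rewrite (_ : X = @coord_subspace (ffun_cspace (matrix_cspace _ _) (arrow Q)) finset.set0).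
  by rewrite cls_coord_subspace cards0 expr0.
apply/seteqP; split=> V _; first by move=> [a [u]]; case: (vac u).
apply/nil_repT; split=> [a u|W _]; first by case: (vac u).
by apply/matrixP => u; case: (vac u).
Qed.

Lemma bin2D a b : 'C(a + b, 2) = ('C(a, 2) + 'C(b, 2) + a * b)%N.
Proof.
elim: b => [|b IH]; first by rewrite addn0 bin0n !muln0 !addn0.
by rewrite addnS binS IH bin1 binS bin1 mulnS; lia.
Qed.

Definition euler_weight f e : motivic_ring :=
  \prod_i h (e i) * pzexpz mL (- euler_form f e).

Lemma pzexpz_euler f e : pzexpz mL (- euler_form f e) =
  mL ^+ (\sum_(a : arrow Q) e (target a) * f (source a))%N *
  pzinv mL ^+ (\sum_i f i * e i)%N.
Proof.
rewrite -pzexpzB//; congr pzexpz; rewrite /euler_form opprB.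
rewrite !(big_morph Posz PoszD (erefl _)); congr (_ - _).
by apply: eq_bigr => a _; rewrite mulnC.
Qed.

Let scale d : motivic_ring :=
  (-1) ^+ total_dim d * mL ^+ (\sum_i 'C(d i, 2))%N * \prod_i qf (d i).

Let scaleI d : invertible (scale d).
Proof.
apply: invertibleM; last by apply: invertible_prod => i _; exact: qfact_inv.
apply: invertibleM; last exact: invertibleX.
by apply: invertibleX; exists (-1); rewrite mulrNN mulr1.
Qed.

Lemma normalizedE d : nc d = scale d * normalized d.
Proof.
rewrite /scale /normalized; set s := (-1) ^+ _; set l := (\sum_i _)%N.
have ss : s * s = 1 by rewrite /s -exprMn mulrNN mulr1 expr1n.
have ll : mL ^+ l * pzinv mL ^+ l = 1 by rewrite -exprMn pzinvV// expr1n.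
have qq : \prod_i qf (d i) * \prod_i h (d i) = 1.
  by rewrite -big_split /= big1// => i _; rewrite pzinvV//; exact: qfact_inv.
transitivity ((s * s) * (mL ^+ l * pzinv mL ^+ l) * (\prod_i qf (d i) *
  \prod_i h (d i)) * nc d).
  by rewrite ss ll qq !mul1r.
ring.
Qed.

Let pairs_term d e : motivic_ring :=
  \prod_i (qfalling mL (e i) (d i) * h (e i)) *
  (mL ^+ (\sum_(a : arrow Q) e (target a) * dsub d e (source a))%N * nc (dsub d e)).

Let pairs_termE d e : dle e d ->
  pairs_term d e = scale d * (euler_weight (dsub d e) e * normalized (dsub d e)).
Proof.
move=> ed; have /dleP ei := ed.
pose f := dsub d e; have dE i : d i = (f i + e i)%N by rewrite ffunE subnK.
rewrite /pairs_term -/f.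
rewrite (eq_bigr (fun i => (-1) ^+ e i * mL ^+ 'C(e i, 2) * (qf (d i) * h (f i) *
  h (e i)))); last first.
  by move=> i _; rewrite (qfallingE L1I (ei i)) ffunE; ring.
rewrite !big_split /= -!expr_sum.
rewrite /scale /normalized /euler_weight pzexpz_euler.
have -> : total_dim d = (total_dim f + total_dim e)%N by rewrite -total_dimD dsubK.
have -> : (\sum_i 'C(d i, 2) = \sum_i 'C(f i, 2) + \sum_i 'C(e i, 2) + \sum_i f i * e i)%N.
  by rewrite -!big_split; apply: eq_bigr => i _; rewrite dE bin2D.
rewrite !exprD -/(total_dim e).
have ss : (-1) ^+ total_dim f * (-1) ^+ total_dim f = 1 :> motivic_ring.
  by rewrite -exprMn mulrNN mulr1 expr1n.
have ll k : mL ^+ k * pzinv mL ^+ k = 1 by rewrite -exprMn pzinvV// expr1n.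
move: (ll (\sum_i 'C(f i, 2))%N) (ll (\sum_i f i * e i)%N) ss.
move: (mL ^+ (\sum_i 'C(f i, 2))%N) (mL ^+ (\sum_i f i * e i)%N) ((-1) ^+ total_dim f).
move: (pzinv mL ^+ (\sum_i 'C(f i, 2))%N) (pzinv mL ^+ (\sum_i f i * e i)%N).
move=> x' y' x y t xx yy tt.
set s := (-1) ^+ _; set z := mL ^+ _; set b := \prod_i qf _; set k := \prod_i h (f i).
set j := \prod_i h _; set g := mL ^+ _; set v := nc f.
transitivity ((t * t) * (x * x') * (y * y') * (s * g * (b * k * j) * (z * v))).
  by rewrite tt xx yy !mul1r.
ring.
Qed.

Lemma sum_pairs_term d : d != 0 ->
  \sum_(t : {ffun vertex Q -> 'I_(total_dim d).+1} | dle (bounded_dimvec t) d)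
    pairs_term d (bounded_dimvec t) = 0.
Proof.
move=> d0; pose lam := @dlabel Q d; set m := total_dim d.
have n0 : (0 < #|{: {i : vertex Q & 'I_(d i)}}|)%N.
  have [i di] : exists i, (0 < d i)%N.
    apply: contrapT => nd; case/eqP: d0; apply/ffunP => i; rewrite ffunE.
    by apply/eqP; rewrite -leqn0 leqNgt; apply/negP => di; apply: nd; exists i.
  by apply/card_gt0P; exists (Tagged (fun i => 'I_(d i)) (Ordinal di)).
pose N c := cls (stratum (@kkey Q _) (@kpivot Q _ lam)
  (nil_rep lam finset.setT : set (ffun_cspace (matrix_cspace _ _) (arrow Q))) c).
transitivity (\sum_(t : {ffun vertex Q -> 'I_m.+1}) \sum_c N c *
    \prod_i (qfalling mL (t i) (label_card lam c.1 i) * h (t i))).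
  rewrite [RHS](bigID (fun t => dle (bounded_dimvec t) d)) /= [X in _ = _ + X]big1 ?addr0.
    apply: eq_bigr => t; move Ee: (bounded_dimvec t) => e td.
    rewrite /pairs_term big_split /= mulrAC.
    have := kernel_pairs_count lam (first_labels d e).
    have -> : label_vec lam (~: first_labels d e) = dsub d e.
      by apply/ffunP => i; rewrite !ffunE label_cardC label_card_first.
    have -> : hom_card lam (first_labels d e) =
        (\sum_(a : arrow Q) e (target a) * dsub d e (source a))%N.
      apply: eq_bigr => a _.
      by rewrite label_cardC !label_card_first// [in RHS]ffunE.
    have pE (s : vertex Q -> nat) :
        \prod_i \prod_(k < label_card lam (first_labels d e) i) (mL ^+ s i - mL ^+ k) =
        \prod_i qfalling mL (e i) (s i).
      by apply: eq_bigr => i _; rewrite label_card_first.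
    rewrite (pE (label_card lam finset.setT)).
    rewrite (eq_bigr (fun c => N c * \prod_i qfalling mL (e i) (label_card lam c.1 i)));
      last first.
      by move=> c _; rewrite (pE (label_card lam c.1)).
    under [in X in _ = X * _]eq_bigr => i _ do rewrite label_cardT.
    move=> <-; rewrite mulr_suml; apply: eq_bigr => c _.
    rewrite big_split /= mulrA; congr (_ * _ * _).
      by apply: eq_bigr => i _; rewrite -Ee ffunE.
    by apply: eq_bigr => i _; rewrite -Ee ffunE.
  move=> t; rewrite negb_forall => /fintype.existsP di; case: di => i;
    rewrite -ltnNge ffunE => dt.
  rewrite big1// => c _; rewrite (bigD1 i)//= qfalling0 ?mul0r ?mulr0//.
  exact: leq_ltn_trans (label_card_le _ _) dt.
rewrite exchange_big /= big1// => c _; rewrite -mulr_sumr.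
rewrite -(bigA_distr_bigA (fun i (k : 'I_m.+1) => qfalling mL k (label_card lam c.1 i) * h k)).
rewrite (eq_bigr (fun i => (label_card lam c.1 i == 0%N)%:R)); last first.
  move=> i _; apply: (sum_qfalling_eq0 L1I).
  exact: leq_trans (label_card_le _ _) (leq_total_dim _ _).
have [c0|[u uc]] := set_0Vmem c.1; first by rewrite /N kframe_set0// mul0r.
rewrite (bigD1 (lam u))//= (_ : (_ == 0%N) = false) ?mul0r ?mulr0//.
by apply/negbTE; rewrite -lt0n; apply/card_gt0P; exists u; rewrite !inE uc eqxx.
Qed.

Lemma dsub0 d : dsub d 0 = d.
Proof. by apply/ffunP => i; rewrite !ffunE subn0. Qed.

Lemma euler_weight0 d : euler_weight d 0 = 1.
Proof.
rewrite /euler_weight big1 => [|i _]; last by rewrite ffunE qfact0 pzinv1.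
rewrite mul1r (_ : euler_form d 0 = 0) ?oppr0 ?expr0//.
by rewrite /euler_form !big1 ?subr0// => i _; rewrite ffunE muln0.
Qed.

Lemma normalized_rec d : d != 0 -> normalized d =
  - \sum_(e <- parts d) euler_weight (dsub d e) e * normalized (dsub d e).
Proof.
move=> d0; have := sum_pairs_term d0.
rewrite (eq_bigr (fun t => scale d * (
  euler_weight (dsub d (bounded_dimvec t)) (bounded_dimvec t) *
  normalized (dsub d (bounded_dimvec t))))); last by move=> t; exact: pairs_termE.
rewrite -mulr_sumr -(mulr0 (scale d)) => /(mulIpz (scaleI d)).
rewrite (bigD1 [ffun=> ord0]) /=; last by apply/dleP => i; rewrite !ffunE.
have b0 : bounded_dimvec [ffun=> ord0] = 0 :> dimvec Q.
  by move=> m; apply/ffunP => i; rewrite !ffunE.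
rewrite b0 dsub0 euler_weight0 mul1r => /eqP; rewrite addr_eq0 => /eqP ->.
congr (- _); rewrite /parts big_filter big_map big_enum_cond /=.
apply: eq_bigl => t; rewrite andbC; congr (_ && _).
by rewrite -(b0 (total_dim d)) (inj_eq (@bounded_dimvec_inj _ _)).
Qed.

End NullconeRecursion.

Theorem corollary3p3 (Q : quiver) (d : dimvec Q) :
  motive (nullcone_variety d) =
    (-1) ^+ total_dim d * mL ^+ (\sum_i 'C(d i, 2))%N *
    \sum_(ds \in decompositions d)
      ((-1) ^+ size ds * pzexpz mL (- decomposition_euler ds) *
       qmultinomial mL d ds).
Proof.
pose h n := pzinv (qfact mL n).
pose T (ds : seq (dimvec Q)) := (-1) ^+ size ds * pzexpz mL (- decomposition_euler ds) *
  \prod_(e <- ds) \prod_i h (e i).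
have wT : normalized d = \sum_(ds \in decompositions d) T ds.
  apply: (decompositions_rec (X := @euler_weight Q)).
  - exact: normalized0.
  - exact: normalized_rec.
  - by rewrite /T big_nil decomposition_euler0 oppr0 /= !expr0 !mulr1.
  - move=> ds e; rewrite /T size_rcons big_rcons /= decomposition_euler_rcons.
    rewrite opprD pzexpzD; last exact: invertible_mL.
    by rewrite /euler_weight -/(h _) exprS; ring.
rewrite normalizedE wT -[X in X = _]mulrA; congr (_ * _).
rewrite !decompositions_sum mulr_sumr; apply: eq_bigr => ds _.
rewrite /T /qmultinomial big_split /= exchange_big /=.
have -> : \prod_i pzinv (\prod_(e <- ds) qfact mL (e i)) = \prod_i \prod_(e <- ds) h (e i).
  apply: eq_bigr => i _; apply: pzinv_prod => e.
  by apply: qfact_inv => k; exact: invertible_1BmLX.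
by ring.
Qed.
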